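(* Let $X=\{\zeta\in B_1(0)\subseteq\mathbb{C}^3:\zeta_1\zeta_2-\zeta_3^2=0\}$ and let $\mathcal{A}^X_q$ be the sheaf on $X$ of $(0,q)$-currents which can (locally) be written as finite sums of currents of the form $$\xi_\nu\wedge\mathcal{K}_\nu\big(\cdots\,\xi_2\wedge\mathcal{K}_2(\xi_1\wedge\mathcal{K}_1(\xi_0))\big),$$ where each $\mathcal{K}_i$ is an Andersson--Samuelsson Koppelman integral operator and the $\xi_i$ are smooth forms (see context). Then $$\mathcal{A}^X_q\subseteq C^0_{0,q}(X),$$ i.e. every section of $\mathcal{A}^X_q$ is a continuous $(0,q)$-form.
   Context: Let $Z=\{\zeta\in\mathbb{C}^3:\zeta_1\zeta_2-\zeta_3^2=0\}$ and for $0<r<R$ let $X_r=Z\cap B_r(0)$, $X_R=Z\cap B_R(0)$. A smooth $(0,q)$-form on $X_R$ is (the restriction to the regular part of) a smooth $(0,q)$-form in a neighborhood of $X_R$ in $\mathbb{C}^3$. A $(0,q)$-form $\varphi$ on an open subset of $Z$ is continuous at a point $a$ if it has a representation $\varphi=\sum_{|I|=q}\varphi_I\,d\bar z_I$ (with $d\bar z_I$ restricted from $\mathbb{C}^3$) whose coefficient functions $\varphi_I$ are continuous at $a$; $C^0_{0,q}$ denotes forms continuous at every point. Integral operators from $X_R$ to $X_r$. For $\zeta\in X_R$, $z\in X_r$ put $\eta=\zeta-z$, $d\eta=d\eta_1\wedge d\eta_2\wedge d\eta_3$, and let $\chi=\chi(\zeta)$ be a smooth function with compact support in $B_R(0)$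 and $\chi\equiv1$ in a neighborhood of $\overline{B_r(0)}$. Put $$h=\tfrac12\big((\zeta_2+z_2)d\eta_1+(\zeta_1+z_1)d\eta_2\big)-(\zeta_3+z_3)d\eta_3,\quad s=\frac{\sum_j\bar\eta_j d\eta_j}{2\pi i\|\eta\|^2},\quad \sigma=\frac{\sum_j\bar\zeta_j d\eta_j}{2\pi i(\|\zeta\|^2-\sum_j\bar\zeta_j z_j)}.$$ With $\bar\partial$ acting in $(\zeta,z)$, let $\tilde K$ be the form of degree one in $d\bar\zeta_j,d\bar z_j$ determined by $d\eta\wedge\tilde K=h\wedge(\chi\, s\wedge\bar\partial s-\bar\partial\chi\wedge\sigma\wedge s)$, let $\omega=\frac{d\zeta_1\wedge d\zeta_2}{-2\zeta_3}\big|_{Z}$, and $(\mathcal{K}\varphi)(z)=\int_{X_R}\omega(\zeta)\wedge\tilde K(\zeta,z)\wedge\varphi(\zeta)$. It maps $(0,q)$-forms on $X_R$ to $(0,q-1)$-forms on $X_r$ (and is $0$ on $(0,0)$-forms). In a composition $\xi_\nu\wedge\mathcal{K}_\nu(\cdots\xi_1\wedge\mathcal{K}_1(\xi_0))$, $\nu\ge0$, there are radii $R_0>R_1>\cdots>R_\nu>0$, $\mathcal{K}_i$ is such an operator from $X_{R_{i-1}}$ to $X_{R_i}$, and $\xi_i$ is a smooth form (of bidegree $(0,* )$) on $X_{R_i}$. A section of $\mathcal{A}^X_q$ over an open $V\subseteq X$ is a $(0,q)$-current on $V$ that in a neighborhood of each point of $V$ is a finite sum of restrictions of such compositions. *)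

(* Defs.v *)
From HB Require Import structures.
From mathcomp Require Import all_boot all_order all_algebra.
From mathcomp Require Import all_classical all_reals all_analysis.
From mathcomp Require Import complex.

Set Implicit Arguments.
Unset Strict Implicit.
Unset Printing Implicit Defensive.

Import Order.TTheory GRing.Theory Num.Theory numFieldNormedType.Exports.

Local Open Scope classical_set_scope.
Local Open Scope ring_scope.

(* [R[i]] seen as a [numClosedFieldType], so that it and ['rV_3] receive the
   topology of [numFieldNormedType]. *)
Definition Cplx (R : realType) : numClosedFieldType := R[i].

Notation C3 R := 'rV[Cplx R]_3.

(* The exterior algebra of [C^n]: [a S] is the coefficient of [a] on the
   wedge product, in increasing order, of the generators [e_i], [i \in S]. *)
Section ExteriorAlgebra.
Variable R : realType.
Local Notation C := (Cplx R).

Definition ext (n : nat) := {ffun {set 'I_n} -> C}.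

Definition scal n (c : C) (a : ext n) : ext n := [ffun S => c * a S].

Definition eone n : ext n := [ffun S => (S == finset.set0)%:R].

Definition gen n (i : 'I_n) : ext n := [ffun S => (S == [set i]%SET)%:R].

Definition inversions n (A B : {set 'I_n}) : nat :=
  #|[set ij : 'I_n * 'I_n |
      [&& ij.1 \in A, ij.2 \in B & (ij.2 < ij.1)%N]]%SET|.

Definition wedge n (a b : ext n) : ext n :=
  [ffun S : {set 'I_n} =>
     \sum_(A : {set 'I_n} | A \subset S)
        (-1) ^+ inversions A (S :\: A) * a A * b (S :\: A)%SET].

(* The algebra morphism sending the generator [e_i] to the 1-vector [g i]. *)
Definition subst n m (g : 'I_n -> ext m) (a : ext n) : ext m :=
  \sum_(S : {set 'I_n}) scal (a S) (\big[@wedge m/@eone m]_(i in S) g i).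

End ExteriorAlgebra.

Notation "a '/w\' b" := (wedge a b) (at level 39, left associativity).

(* Differential forms on [C^n] have values in [ext R (n + n)], the generators
   being [dz_1, .., dz_n, dzbar_1, .., dzbar_n]. *)
Section Forms.
Variable R : realType.
Local Notation C := (Cplx R).

Definition form3 := C3 R -> ext R (3 + 3).

Definition holdeg (S : {set 'I_(3 + 3)}) : nat :=
  #|[set j : 'I_3 | lshift 3 j \in S]%SET|.
Definition antideg (S : {set 'I_(3 + 3)}) : nat :=
  #|[set j : 'I_3 | rshift 3 j \in S]%SET|.

Definition has_bideg (p q : nat) (a : ext R (3 + 3)) : Prop :=
  forall S, a S != 0 -> holdeg S = p /\ antideg S = q.

(* Real directions in [C^3]: [(j, false)] is [x_j] and [(j, true)] is [y_j],
   where [z_j = x_j + i y_j]. *)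
Definition dir := ('I_3 * bool)%type.

Definition on_line (f : C3 R -> C) (p : C3 R) (d : dir) (t : R) : R[i] :=
  f (p + (t%:C%C * (if d.2 then 'i%C else 1)) *: delta_mx ord0 d.1).

Definition pderivable (d : dir) (f : C3 R -> C) (p : C3 R) : Prop :=
  derivable (fun t => complex.Re (on_line f p d t)) 0 1 /\
  derivable (fun t => complex.Im (on_line f p d t)) 0 1.

Definition pderive (d : dir) (f : C3 R -> C) (p : C3 R) : C :=
  Complex (derive1 (fun t => complex.Re (on_line f p d t)) 0)
          (derive1 (fun t => complex.Im (on_line f p d t)) 0).

Definition pderives (ds : seq dir) (f : C3 R -> C) : C3 R -> C :=
  foldr pderive f ds.

Definition smooth_on (U : set (C3 R)) (f : C3 R -> C) : Prop :=
  forall (ds : seq dir) (p : C3 R), U p ->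
    {for p, continuous (pderives ds f)} /\
    forall d, pderivable d (pderives ds f) p.

Definition smooth_form_on (U : set (C3 R)) (a : form3) : Prop :=
  forall S, smooth_on U (fun p => a p S).

Definition dzbar_deriv (j : 'I_3) (f : C3 R -> C) (p : C3 R) : C :=
  2^-1 * (pderive (j, false) f p + 'i%C * pderive (j, true) f p).

End Forms.

(* Forms on [C^3 x C^3], with variables [(zeta, z)]. *)
Section FormsOnProduct.
Variable R : realType.
Local Notation C := (Cplx R).

Definition form33 := C3 R -> C3 R -> ext R ((3 + 3) + (3 + 3)).

Definition dzeta (j : 'I_3) : ext R ((3 + 3) + (3 + 3)) :=
  gen R (lshift (3 + 3) (lshift 3 j)).
Definition dzetabar (j : 'I_3) : ext R ((3 + 3) + (3 + 3)) :=
  gen R (lshift (3 + 3) (rshift 3 j)).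
Definition dz (j : 'I_3) : ext R ((3 + 3) + (3 + 3)) :=
  gen R (rshift (3 + 3) (lshift 3 j)).
Definition dzbar (j : 'I_3) : ext R ((3 + 3) + (3 + 3)) :=
  gen R (rshift (3 + 3) (rshift 3 j)).

Definition in_zeta (a : ext R (3 + 3)) : ext R ((3 + 3) + (3 + 3)) :=
  subst (fun i => gen R (lshift (3 + 3) i)) a.

Definition dbar (F : form33) : form33 := fun zeta z =>
  \sum_(j < 3)
    (dzetabar j /w\ [ffun S => dzbar_deriv j (fun zeta' => F zeta' z S) zeta] +
     dzbar j /w\ [ffun S => dzbar_deriv j (fun z' => F zeta z' S) z]).

Definition antiholomorphic_1form (a : ext R ((3 + 3) + (3 + 3))) : Prop :=
  exists b c : 'I_3 -> C,
    a = \sum_(j < 3) (scal (b j) (dzetabar j) + scal (c j) (dzbar j)).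

End FormsOnProduct.

(* Lebesgue measure on [R * R].  Its sigma-finiteness, needed to form the
   product below, is not inferred from that of the factors. *)
Section Lebesgue2.
Variable R : realType.

Definition leb2 : set (measurableTypeR R * measurableTypeR R)%type -> \bar R :=
  (@lebesgue_measure R \x @lebesgue_measure R)%E.

HB.instance Definition _ := Measure.on leb2.

Let leb2_sigma_finite : sigma_finite setT leb2.
Proof.
have /sigma_finiteP[F [TF ndF Foo]] := @sigma_finiteT _ _ _ (@lebesgue_measure R).
exists (fun n => F n `*` F n).
  rewrite -setXTT TF predeqE => -[x y]; split.
    move=> [/= [n _ Fnx] [k _ Fky]]; exists (maxn n k) => //; split.
    - by move: x Fnx; exact/subsetPset/ndF/leq_maxl.
    - by move: y Fky; exact/subsetPset/ndF/leq_maxr.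
  by move=> [n _ []/= ? ?]; split; exists n.
move=> k; have [? ?] := Foo k.
split; first exact: measurableX.
by rewrite /leb2 product_measure1E// lte_mul_pinfty// ge0_fin_numE.
Qed.

HB.instance Definition _ :=
  @Measure_isSigmaFinite.Build _ _ _ leb2 leb2_sigma_finite.

End Lebesgue2.

Section Surface.
Variable R : realType.
Local Notation C := (Cplx R).

Definition i1 : 'I_3 := @Ordinal 3 0 isT.
Definition i2 : 'I_3 := @Ordinal 3 1 isT.
Definition i3 : 'I_3 := @Ordinal 3 2 isT.

Definition Z : set (C3 R) :=
  [set p | p ord0 i1 * p ord0 i2 - p ord0 i3 ^+ 2 = 0].

Definition norm2 (p : C3 R) : C := \sum_(j < 3) `|p ord0 j| ^+ 2.

Definition B (r : R) : set (C3 R) := [set p | norm2 p < (r ^+ 2)%:C%C].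
Definition closedB (r : R) : set (C3 R) := [set p | norm2 p <= (r ^+ 2)%:C%C].

Definition XB (r : R) : set (C3 R) := Z `&` B r.

(* [cov (u, v) = (u^2, v^2, u v)]; on [C^2 \ 0] it is a two-sheeted
   holomorphic covering of [Z \ 0], the regular part of [Z], the two preimages
   of a point being opposite.  Hence the local inverses of [cov] are charts of
   the regular part, and [cov] restricted to [Re u > 0] is the inverse of a
   single chart, whose domain, the points of [Z] with [zeta_1] outside
   [(-oo, 0]], has full measure in [Z].
   Complex coordinates [u = x1 + i y1], [v = x2 + i y2] are given by a point
   [((x1, y1), (x2, y2))] of [R^4]. *)
Definition R4 := ((R * R) * (R * R))%type.

Definition ucoord (w : R4) : C := Complex w.1.1 w.1.2.
Definition vcoord (w : R4) : C := Complex w.2.1 w.2.2.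

Definition cov (w : R4) : C3 R :=
  \row_(j < 3) [:: ucoord w ^+ 2; vcoord w ^+ 2; ucoord w * vcoord w]`_j.

(* Generators of [ext R (2 + 2)]: [du, dv, dubar, dvbar]. *)
Definition du : ext R (2 + 2) := gen R (lshift 2 (@Ordinal 2 0 isT)).
Definition dv : ext R (2 + 2) := gen R (lshift 2 (@Ordinal 2 1 isT)).
Definition dubar : ext R (2 + 2) := gen R (rshift 2 (@Ordinal 2 0 isT)).
Definition dvbar : ext R (2 + 2) := gen R (rshift 2 (@Ordinal 2 1 isT)).

(* Derivatives with respect to [u] and [v] of the coordinates of [cov]. *)
Definition cov_du (w : R4) (j : 'I_3) : C :=
  [:: 2 * ucoord w; 0; vcoord w]`_j.
Definition cov_dv (w : R4) (j : 'I_3) : C :=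
  [:: 0; 2 * vcoord w; ucoord w]`_j.

Definition cov_diff (w : R4) (i : 'I_(3 + 3)) : ext R (2 + 2) :=
  match fintype.split i with
  | inl j => scal (cov_du w j) du + scal (cov_dv w j) dv
  | inr j => scal (cov_du w j)^* dubar + scal (cov_dv w j)^* dvbar
  end.

Definition pull (w : R4) (a : ext R (3 + 3)) : ext R (2 + 2) :=
  subst (cov_diff w) a.

(* Pull-back in the variable [zeta] of a form in [(zeta, z)]. *)
Definition pull_zeta (w : R4) (a : ext R ((3 + 3) + (3 + 3))) :
    ext R ((2 + 2) + (3 + 3)) :=
  subst (fun i =>
    match fintype.split i with
    | inl k => subst (fun l => gen R (lshift (3 + 3) l)) (cov_diff w k)
    | inr k => gen R (rshift (2 + 2) k)
    end) a.

(* Equality of the restrictions to the regular part of [Z], over [V]. *)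
Definition eq_on_reg (V : set (C3 R)) (a b : form3 R) : Prop :=
  forall w, w != 0 -> V (cov w) -> pull w (a (cov w)) = pull w (b (cov w)).

(* [dx1 /\ dy1 /\ dx2 /\ dy2]. *)
Definition vol : ext R (2 + 2) :=
  scal (('i%C / 2) ^+ 2) (du /w\ dubar /w\ dv /w\ dvbar).

Definition Cintegral (D : set R4) (f : R4 -> C) : C :=
  Complex (Rintegral (@leb2 R \x @leb2 R)%E D (fun w => complex.Re (f w)))
          (Rintegral (@leb2 R \x @leb2 R)%E D (fun w => complex.Im (f w))).

Definition chart_dom (V : set (C3 R)) : set R4 :=
  [set w | 0 < w.1.1 /\ V (cov w)].

Definition integral_Z (V : set (C3 R)) (a : form3 R) : C :=
  Cintegral (chart_dom V)
    (fun w => pull w (a (cov w)) [set: 'I_(2 + 2)]%SET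
              / vol [set: 'I_(2 + 2)]%SET).

(* The integral over [V] in the variable [zeta] of a form in [(zeta, z)]: only
   the part of bidegree (2, 2) in [zeta] contributes.  Being of even degree in
   [zeta], that part commutes with the differentials of [z], so that no sign
   depends on their position. *)
Definition integral_Z_zeta (V : set (C3 R))
    (a : C3 R -> ext R ((3 + 3) + (3 + 3))) : ext R (3 + 3) :=
  [ffun S : {set 'I_(3 + 3)} => Cintegral (chart_dom V) (fun w =>
     pull_zeta w (a (cov w))
       ((@lshift (2 + 2) (3 + 3) @: [set: 'I_(2 + 2)]) :|:
        (@rshift (2 + 2) (3 + 3) @: S))%SET
     / vol [set: 'I_(2 + 2)]%SET)].

End Surface.

Section Koppelman.
Variable R : realType.
Local Notation C := (Cplx R).

Definition twopii : C := 2 * (pi : R)%:C%C * 'i%C.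

Definition eta (zeta z : C3 R) (j : 'I_3) : C := zeta ord0 j - z ord0 j.

Definition deta (j : 'I_3) : ext R ((3 + 3) + (3 + 3)) := dzeta R j - dz R j.

Definition deta123 : ext R ((3 + 3) + (3 + 3)) :=
  deta i1 /w\ deta i2 /w\ deta i3.

Definition h : form33 R := fun zeta z =>
  scal (2^-1) (scal (zeta ord0 i2 + z ord0 i2) (deta i1) +
               scal (zeta ord0 i1 + z ord0 i1) (deta i2))
  - scal (zeta ord0 i3 + z ord0 i3) (deta i3).

Definition s : form33 R := fun zeta z =>
  scal (twopii * norm2 (zeta - z))^-1
    (\sum_(j < 3) scal (eta zeta z j)^* (deta j)).

Definition sigma : form33 R := fun zeta z =>
  scal (twopii *
        (norm2 zeta - \sum_(j < 3) (zeta ord0 j)^* * z ord0 j))^-1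
    (\sum_(j < 3) scal (zeta ord0 j)^* (deta j)).

Definition supp (T : topologicalType) (V : nmodType) (f : T -> V) : set T :=
  closure [set p | f p != 0].

Definition cutoff (r r' : R) (chi : C3 R -> C) : Prop :=
  [/\ smooth_on setT chi,
      compact (supp chi),
      supp chi `<=` B r' &
      exists2 U : set (C3 R), open U &
        closedB r `<=` U /\ forall zeta, U zeta -> chi zeta = 1].

Definition is_Ktilde (r r' : R) (chi : C3 R -> C) (K : form33 R) : Prop :=
  forall zeta z, XB r' zeta -> XB r z -> zeta != z ->
    antiholomorphic_1form (K zeta z) /\
    deta123 /w\ K zeta z =
      h zeta z /w\
        (scal (chi zeta) (s zeta z /w\ dbar s zeta z)
         - dbar (fun zeta' _ => scal (chi zeta') (eone R _)) zeta z
             /w\ sigma zeta z /w\ s zeta z).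

Definition omega (zeta : C3 R) : ext R ((3 + 3) + (3 + 3)) :=
  scal (- 2 * zeta ord0 i3)^-1 (dzeta R i1 /w\ dzeta R i2).

(* The operator with kernel [K], from forms on [X_r'] to forms on some [X_r];
   the values outside [X_r] are irrelevant. *)
Definition koppelman_op (r' : R) (K : form33 R) (phi : form3 R) : form3 R :=
  fun z => integral_Z_zeta (XB r')
    (fun zeta => omega zeta /w\ K zeta z /w\ in_zeta (phi zeta)).

Definition smooth_0q (r : R) (q : nat) (xi : form3 R) : Prop :=
  exists2 U : set (C3 R), open U &
    [/\ XB r `<=` U, smooth_form_on U xi &
        forall p, U p -> has_bideg 0 q (xi p)].

(* [composition r q psi]: [psi] is, on [X_r], a (0, q)-form
   [xi_nu /\ K_nu (... xi_1 /\ K_1 xi_0)], where [r] is the last radius.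
   For [q = 0] the predecessor is harmless since [koppelman_op] gives 0. *)
Inductive composition : R -> nat -> form3 R -> Prop :=
| composition0 (r : R) (q : nat) (xi : form3 R) of
    0 < r & smooth_0q r q xi : composition r q xi
| compositionS (r r' : R) (q m : nat) (phi xi : form3 R)
    (chi : C3 R -> C) (K : form33 R) of
    composition r' q phi & 0 < r & r < r' &
    cutoff r r' chi & is_Ktilde r r' chi K & smooth_0q r m xi :
    composition r (m + q.-1)
      (fun z => xi z /w\ koppelman_op r' K phi z).

End Koppelman.

Section Currents.
Variable R : realType.
Local Notation C := (Cplx R).
Implicit Types (V W : set (C3 R)) (tau psi : form3 R).

Definition X : set (C3 R) := XB 1.

Definition open_in_X V : Prop := exists2 U, open U & V = X `&` U.

(* Test forms on [V], of bidegree (2, 2 - q): restrictions to [V] of smooth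
   forms on [C^3].  For [q > 2] the only one is 0. *)
Definition test_form V (q : nat) tau : Prop :=
  [/\ smooth_form_on setT tau,
      compact (supp tau),
      supp tau `&` @Z R `<=` V &
      forall p S, tau p S != 0 ->
        holdeg S = 2%N /\ (q + antideg S)%N = 2%N].

(* (0, q)-currents on [V]: linear functionals on the test forms, which only
   depend on the restrictions to the regular part and are continuous for the
   seminorms of [C^m] on each compact set. *)
Definition is_current V (q : nat) (T : form3 R -> C) : Prop :=
  [/\ forall (c : C) tau tau', test_form V q tau -> test_form V q tau' ->
        T (fun p => scal c (tau p) + tau' p) = c * T tau + T tau',
      forall tau tau', test_form V q tau -> test_form V q tau' ->
        eq_on_reg V tau tau' -> T tau = T tau' &
      forall L : set (C3 R), compact L -> L `&` @Z R `<=` V ->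
        exists (c : R) (m : nat), forall (tau : form3 R) (M : R),
          test_form V q tau -> supp tau `<=` L ->
          (forall p S (ds : seq dir), (size ds <= m)%N ->
             `|pderives ds (fun p => tau p S) p| <= M%:C%C) ->
          `|T tau| <= (c * M)%:C%C].

(* The current [tau |-> \int_V psi /\ tau] on [V]. *)
Definition current_of V psi (tau : form3 R) : C :=
  integral_Z V (fun p => psi p /w\ tau p).

Definition sheafA (q : nat) V : set (form3 R -> C) :=
  [set T | is_current V q T /\
    forall x, V x -> exists W, [/\ open W, W x &
      exists (n : nat) (psi : 'I_n -> form3 R),
        (forall k, exists2 r, V `&` W `<=` XB r & composition r q (psi k)) /\
        forall tau, test_form (V `&` W) q tau ->
          T tau = \sum_(k < n) current_of (V `&` W) (psi k) tau]].

(* Continuity at [a] within [V], for some representation on [V] depending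
   on [a]. *)
Definition continuous_form_at V (q : nat) (phi : form3 R) (a : C3 R) : Prop :=
  exists psi : form3 R,
    [/\ forall p, V p -> has_bideg 0 q (psi p),
        eq_on_reg V phi psi &
        forall S, (fun p => psi p S : C) @ within V (nbhs a) --> psi a S].

(* The continuous (0, q)-forms on [V], as currents. *)
Definition sheafC0 (q : nat) V : set (form3 R -> C) :=
  [set T | is_current V q T /\ exists phi : form3 R,
    (forall a, V a -> continuous_form_at V q phi a) /\
    forall tau, test_form V q tau -> T tau = current_of V phi tau].

End Currents.

(* Main.v *)
Require Import Defs.
From mathcomp Require Import all_boot all_order all_algebra.
From mathcomp Require Import all_classical all_reals all_analysis.
From mathcomp Require Import complex ring lra zify measurable_realfun.

Set Implicit Arguments.
Unset Strict Implicit.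
Unset Printing Implicit Defensive.

Import Order.TTheory GRing.Theory Num.Theory numFieldNormedType.Exports.
Local Open Scope classical_set_scope.
Local Open Scope ring_scope.

(** Sections of the sheaf are locally finite sums of compositions of Koppelman
    operators, so that two things have to be shown: each composition is a
    continuous form, and continuous forms representing a current locally can be
    glued to one that represents it globally.

    Continuity of compositions is proved by induction, from the statement that
    an operator maps continuous forms to continuous forms
    ([koppelman_continuous]). Integrals over [Z] are integrals over half of
    [C^2] through the covering [cov (u, v) = (u^2, v^2, u v)]. The kernel is
    bounded by a multiple of [(|zeta| + |z|) / |zeta - z| ^ 3]
    ([kernel_rhs_bound]). Under the pull-back by [cov], the factors [2 u] and
    [2 v] of [dzeta_1] and [dzeta_2] cancel the poles of [omega], and the two
    factors [dzetabar] contribute [|w| ^ 2] ([pull_koppelman_bound]). Since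
    [|w - v| |w + v| <= 2 |cov w - cov v|] ([cov_dist]), the integrand for
    [zeta = cov w] and [z = cov v] is at most a constant times
    [|w - v| ^- 3 + |w + v| ^- 3] ([cov_kernel_le]), also at the singular point.
    In real dimension four this is integrable, uniformly in [v], and pointwise
    convergence of the kernels off [v] and [- v] gives convergence of the
    integrals ([weakly_singular_cvg]). The bidegree comes from counting
    differentials ([pull_koppelman_bideg]). The coefficients are continuous
    up to and including the singular point of [Z].

    For the gluing, countably many rational cubes cover [V], each inside an
    open set on which the current has a continuous representative. Bump
    functions on these cubes give smooth functions [unity n] with sum 1, and
    the sum of the products of [unity n] with the representatives is a
    continuous form ([glue_cont]) that represents the current
    ([glue_current]), because every test form has compact support. *)

(** * The modulus of complex numbers *)

Section ComplexModulus.
Variable R : realType.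
Local Notation C := (Cplx R).
Implicit Types x y : C.

Definition cmod x : R := Normc.normc x.

Lemma cmodE x : `|x| = (cmod x)%:C%C.
Proof. by []. Qed.

Lemma cmod_ge0 x : 0 <= cmod x.
Proof. by rewrite -lecR -cmodE; exact: (normr_ge0 x). Qed.

Lemma cmodM x y : cmod (x * y) = cmod x * cmod y.
Proof. exact: Normc.normcM. Qed.

Lemma cmodD x y : cmod (x + y) <= cmod x + cmod y.
Proof. exact: le_normcD. Qed.

Lemma cmodV x : cmod x^-1 = (cmod x)^-1.
Proof. exact: Normc.normcV. Qed.

Lemma cmodN x : cmod (- x) = cmod x.
Proof. exact: normcN. Qed.

Lemma cmod0 : cmod 0 = 0.
Proof. exact: Normc.normc0. Qed.

Lemma cmod1 : cmod 1 = 1.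
Proof. exact: Normc.normc1. Qed.

Lemma cmodJ x : cmod x^* = cmod x.
Proof. by have := norm_conjC x; rewrite !cmodE => -[]. Qed.

Lemma cmod_eq0 x : (cmod x == 0) = (x == 0).
Proof.
apply/eqP/eqP => [|->]; [exact: Normc.eq0_normc|exact: cmod0].
Qed.

Lemma cmod_sqr x : cmod x ^+ 2 = complex.Re x ^+ 2 + complex.Im x ^+ 2.
Proof.
have := add_Re2_Im2 x; have -> : `|x : R[i]| = (cmod x)%:C%C by [].
by rewrite -rmorphXn => -[].
Qed.

Lemma cmod_real (r : R) : cmod r%:C%C = `|r|.
Proof. by rewrite /cmod /= expr0n /= addr0 sqrtr_sqr. Qed.

Lemma cmodX x n : cmod (x ^+ n) = cmod x ^+ n.
Proof. by elim: n => [|n IH]; rewrite ?expr0 ?cmod1// !exprS cmodM IH. Qed.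

Lemma cmod_sum (I : Type) (s : seq I) (P : pred I) (F : I -> C) :
  cmod (\sum_(i <- s | P i) F i) <= \sum_(i <- s | P i) cmod (F i).
Proof.
elim/big_ind2: _ => [|a b c d h1 h2|//]; first by rewrite cmod0.
by apply: (le_trans (cmodD _ _)); apply: lerD.
Qed.

Lemma Re_le_cmod x : `|complex.Re x| <= cmod x.
Proof.
rewrite -(@ler_pXn2r _ 2) ?nnegrE ?cmod_ge0// cmod_sqr real_normK ?num_real//.
by rewrite lerDl sqr_ge0.
Qed.

Lemma Im_le_cmod x : `|complex.Im x| <= cmod x.
Proof.
rewrite -(@ler_pXn2r _ 2) ?nnegrE ?cmod_ge0// cmod_sqr real_normK ?num_real//.
by rewrite lerDr sqr_ge0.
Qed.

Lemma cmod_le_ReIm x : cmod x <= `|complex.Re x| + `|complex.Im x|.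
Proof.
rewrite -(@ler_pXn2r _ 2) ?nnegrE ?cmod_ge0 ?addr_ge0// cmod_sqr.
rewrite -[complex.Re x ^+ 2]real_normK ?num_real//.
rewrite -[complex.Im x ^+ 2]real_normK ?num_real//.
have := normr_ge0 (complex.Re x); have := normr_ge0 (complex.Im x).
move: `|complex.Re x| `|complex.Im x| => a b; nra.
Qed.

Lemma cmod_sign n : cmod ((-1) ^+ n) = 1.
Proof. by rewrite cmodX cmodN cmod1 expr1n. Qed.

Lemma ler_cmodB x y : cmod x - cmod y <= cmod (x - y).
Proof. by rewrite lerBlDr -{1}[x](subrK y) cmodD. Qed.

Lemma cmodBC x y : cmod (x - y) = cmod (y - x).
Proof. by rewrite -cmodN opprB. Qed.

Lemma cReB x y : complex.Re (x - y) = complex.Re x - complex.Re y.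
Proof. by case: x y => [a b] [c d]. Qed.

Lemma cImB x y : complex.Im (x - y) = complex.Im x - complex.Im y.
Proof. by case: x y => [a b] [c d]. Qed.

Lemma cReD x y : complex.Re (x + y) = complex.Re x + complex.Re y.
Proof. by case: x y => [a b] [c d]. Qed.

Lemma cImD x y : complex.Im (x + y) = complex.Im x + complex.Im y.
Proof. by case: x y => [a b] [c d]. Qed.

Section Cvg.
Variables (T : Type) (F : set_system T).
Context {FF : Filter F}.
Implicit Types f g : T -> C.

Lemma cvg_cmodP f (l : C) :
  (f @ F --> l) <->
  (forall e : R, 0 < e -> \forall t \near F, cmod (l - f t) < e).
Proof.
split=> [/cvgrPdist_lt h e e0|h].
  have e0' : 0 < e%:C%C :> C by rewrite (ltcR 0 e).
  by have := h _ e0'; apply: filterS => t; rewrite cmodE ltcR.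
apply/cvgrPdist_lt => e e0.
have eR : e = (complex.Re e)%:C%C by rewrite RRe_real// gtr0_real.
have e0' : 0 < complex.Re e by rewrite -(ltcR 0 (complex.Re e)) -eR.
by have := h _ e0'; apply: filterS => t ht; rewrite eR cmodE ltcR.
Qed.

Lemma cvg_Re f (l : C) :
  f @ F --> l -> (fun t => complex.Re (f t)) @ F --> complex.Re l.
Proof.
move=> /cvg_cmodP h; apply/cvgrPdist_lt => e e0.
have := h _ e0; apply: filterS => t; apply: le_lt_trans.
by rewrite -cReB Re_le_cmod.
Qed.

Lemma cvg_Im f (l : C) :
  f @ F --> l -> (fun t => complex.Im (f t)) @ F --> complex.Im l.
Proof.
move=> /cvg_cmodP h; apply/cvgrPdist_lt => e e0.
have := h _ e0; apply: filterS => t; apply: le_lt_trans.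
by rewrite -cImB Im_le_cmod.
Qed.

Lemma cvg_Complex f (l : C) :
  (fun t => complex.Re (f t)) @ F --> complex.Re l ->
  (fun t => complex.Im (f t)) @ F --> complex.Im l -> f @ F --> l.
Proof.
move=> /cvgrPdist_lt h1 /cvgrPdist_lt h2; apply/cvg_cmodP => e e0.
have e2 : 0 < e / 2 by rewrite divr_gt0.
have := h1 _ e2; have := h2 _ e2; apply: filterS2 => t i1 i2.
apply: (le_lt_trans (cmod_le_ReIm _)); rewrite cReB cImB (splitr e).
exact: ltrD.
Qed.

Lemma cvg_conj f (l : C) :
  f @ F --> l -> (fun t => (f t)^*) @ F --> l^*.
Proof.
move=> /cvg_cmodP h; apply/cvg_cmodP => e e0.
by have := h _ e0; apply: filterS => t; rewrite -rmorphB cmodJ.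
Qed.

Lemma cvg_cmod f (l : C) :
  f @ F --> l -> (fun t => cmod (f t)) @ F --> cmod l.
Proof.
move=> /cvg_cmodP h; apply/cvgrPdist_lt => e e0.
have := h _ e0; apply: filterS => t; apply: le_lt_trans.
by rewrite ler_norml ler_cmodB andbT lerNl opprB cmodBC ler_cmodB.
Qed.

Lemma cvg_RtoC (f : T -> R) (l : R) :
  f @ F --> l -> (fun t => (f t)%:C%C : C) @ F --> (l%:C%C : C).
Proof. by move=> h; apply: cvg_Complex => //=; exact: cvg_cst. Qed.

End Cvg.
End ComplexModulus.

Arguments cmod : simpl never.

(** * Exterior algebra *)

Section ExteriorLinear.
Variable R : realType.
Local Notation C := (Cplx R).

Section Fixed.
Variable n : nat.
Implicit Types (a b : ext R n) (c : C) (S A T : {set 'I_n}).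

Lemma scalE c a S : scal c a S = c * a S.
Proof. by rewrite ffunE. Qed.

Lemma addextE a b S : (a + b) S = a S + b S.
Proof. by rewrite ffunE. Qed.

Lemma oppextE a S : (- a) S = - a S.
Proof. by rewrite ffunE. Qed.

Lemma zeroextE S : (0 : ext R n) S = 0.
Proof. by rewrite ffunE. Qed.

Lemma sumextE (I : Type) (s : seq I) (P : pred I) (F : I -> ext R n) S :
  (\sum_(i <- s | P i) F i) S = \sum_(i <- s | P i) F i S.
Proof. by apply: (big_morph (fun a => a S)) => [a b|]; rewrite ffunE. Qed.

Lemma genE i S : gen R i S = (S == [set i]%SET)%:R.
Proof. by rewrite ffunE. Qed.

Lemma wedgeE a b S : (a /w\ b) S = \sum_(A : {set 'I_n} | A \subset S)
  (-1) ^+ inversions A (S :\: A) * a A * b (S :\: A)%SET.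
Proof. by rewrite ffunE. Qed.

Lemma scal0l a : scal 0 a = 0.
Proof. by apply/ffunP => S; rewrite !ffunE mul0r. Qed.

Lemma scal1 a : scal 1 a = a.
Proof. by apply/ffunP => S; rewrite !ffunE mul1r. Qed.

Lemma wedge_suml (I : Type) (s : seq I) (P : pred I) (F : I -> ext R n) a :
  (\sum_(i <- s | P i) F i) /w\ a = \sum_(i <- s | P i) (F i /w\ a).
Proof.
apply/ffunP => S; rewrite sumextE wedgeE.
under [RHS]eq_bigr do rewrite wedgeE.
rewrite exchange_big /=; apply: eq_bigr => A _.
by rewrite sumextE mulr_sumr mulr_suml.
Qed.

Lemma scal_wedgel c a b : scal c a /w\ b = scal c (a /w\ b).
Proof.
apply/ffunP => S; rewrite scalE !wedgeE mulr_sumr; apply: eq_bigr => A _.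
by rewrite scalE; ring.
Qed.

Lemma scal_wedger c a b : a /w\ scal c b = scal c (a /w\ b).
Proof.
apply/ffunP => S; rewrite scalE !wedgeE mulr_sumr; apply: eq_bigr => A _.
by rewrite scalE; ring.
Qed.

Lemma wedge0l a : 0 /w\ a = 0.
Proof. by rewrite -(scal0l 0) scal_wedgel !scal0l. Qed.

Lemma wedge0r a : a /w\ 0 = 0.
Proof. by rewrite -(scal0l 0) scal_wedger !scal0l. Qed.

Lemma wedge_neq0 a b S : (a /w\ b) S != 0 ->
  exists A, [/\ A \subset S, a A != 0 & b (S :\: A) != 0].
Proof.
rewrite wedgeE => h.
have [/fintype.existsP[A /and3P[? ? ?]]|/fintype.existsPn h'] :=
  boolP [exists A : {set 'I_n}, [&& A \subset S, a A != 0 & b (S :\: A) != 0]].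
  by exists A.
move: h; rewrite big1 ?eqxx// => A AS; have := h' A; rewrite AS /=.
by rewrite negb_and !negbK => /orP[]/eqP->; rewrite ?(mulr0, mul0r).
Qed.

Lemma wedge_single a b A S : A \subset S ->
  (forall A', A' \subset S -> a A' != 0 -> b (S :\: A') != 0 -> A' = A) ->
  (a /w\ b) S = (-1) ^+ inversions A (S :\: A) * a A * b (S :\: A).
Proof.
move=> AS h; rewrite wedgeE (bigD1 A)//= big1 ?addr0// => A' /andP[A'S nA].
have [->|a0] := eqVneq (a A') 0; first by rewrite mulr0 mul0r.
have [->|b0] := eqVneq (b (S :\: A')) 0; first by rewrite mulr0.
by rewrite (h A') ?eqxx in nA.
Qed.

End Fixed.

Section Subst.
Variables (n m : nat) (g : 'I_n -> ext R m).
Implicit Types (a b : ext R n).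

Definition monomial (S : {set 'I_n}) : ext R m :=
  \big[@wedge R m/@eone R m]_(i in S) g i.

Lemma substE a T : subst g a T = \sum_S a S * monomial S T.
Proof. by rewrite /subst sumextE; apply: eq_bigr => S _; rewrite scalE. Qed.

Lemma subst_sum (I : Type) (s : seq I) (P : pred I) (F : I -> ext R n) :
  subst g (\sum_(i <- s | P i) F i) = \sum_(i <- s | P i) subst g (F i).
Proof.
apply/ffunP => S; rewrite [RHS]sumextE substE.
under [RHS]eq_bigr do rewrite substE.
rewrite [RHS]exchange_big /=; apply: eq_bigr => A _.
by rewrite sumextE mulr_suml.
Qed.

Lemma subst_scal c a : subst g (scal c a) = scal c (subst g a).
Proof.
apply/ffunP => S; rewrite [RHS]scalE !substE mulr_sumr; apply: eq_bigr => A _.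
by rewrite scalE mulrA.
Qed.

Lemma subst0 : subst g 0 = 0.
Proof. by rewrite -(scal0l 0) subst_scal !scal0l. Qed.

Lemma subst_neq0 a T : subst g a T != 0 ->
  exists S, a S != 0 /\ monomial S T != 0.
Proof.
rewrite substE => h.
have [/fintype.existsP[A /andP[? ?]]|/fintype.existsPn h'] :=
  boolP [exists A : {set 'I_n}, (a A != 0) && (monomial A T != 0)].
  by exists A.
move: h; rewrite big1 ?eqxx// => A _; have := h' A.
by rewrite negb_and !negbK => /orP[]/eqP->; rewrite ?(mulr0, mul0r).
Qed.

End Subst.

(** A weight that detects one kind of differential counts its occurrences in
    each monomial, so that homogeneity turns degree counts into equations
    between natural numbers. *)
Section Grading.

Definition weight n (wt : 'I_n -> nat) (S : {set 'I_n}) : nat := (\sum_(i in S) wt i)%N.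

Definition homogeneous n (wt : 'I_n -> nat) (k : nat) (a : ext R n) : Prop :=
  forall S, a S != 0 -> weight wt S = k.

Section Fixed.
Variables (n : nat) (wt : 'I_n -> nat).
Implicit Types (a b : ext R n) (S A : {set 'I_n}).

Lemma weightD A S : A \subset S -> weight wt S = (weight wt A + weight wt (S :\: A))%N.
Proof.
move=> AS; rewrite /weight (big_setID A) /=; congr (_ + _)%N.
by apply: eq_bigl => i; rewrite (finset.setIidPr AS).
Qed.

Lemma homogeneous_gen i : homogeneous wt (wt i) (gen R i).
Proof.
move=> S; rewrite genE; have [->|_] := eqVneq S [set i]%SET.
  by move=> _; rewrite /weight big_set1.
by rewrite eqxx.
Qed.

Lemma homogeneous_eone : homogeneous wt 0 (eone R n).
Proof.
move=> S; rewrite ffunE; have [->|_] := eqVneq S finset.set0.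
  by move=> _; rewrite /weight big_set0.
by rewrite eqxx.
Qed.

Lemma homogeneous_scal k c a : homogeneous wt k a -> homogeneous wt k (scal c a).
Proof.
move=> ha S; rewrite scalE mulf_eq0 negb_or => /andP[_]; exact: ha.
Qed.

Lemma homogeneousD k a b :
  homogeneous wt k a -> homogeneous wt k b -> homogeneous wt k (a + b).
Proof.
move=> ha hb S; rewrite addextE.
have [a0|/ha//] := eqVneq (a S) 0.
have [b0|/hb//] := eqVneq (b S) 0.
by rewrite a0 b0 addr0 eqxx.
Qed.

Lemma homogeneous_wedge k l a b :
  homogeneous wt k a -> homogeneous wt l b -> homogeneous wt (k + l) (a /w\ b).
Proof.
by move=> ha hb S /wedge_neq0[A [AS /ha <- /hb <-]]; exact: weightD.
Qed.

End Fixed.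

Lemma homogeneous_monomial n m (wt : 'I_n -> nat) (wt' : 'I_m -> nat)
    (g : 'I_n -> ext R m) :
  (forall i, homogeneous wt' (wt i) (g i)) ->
  forall S, homogeneous wt' (weight wt S) (monomial g S).
Proof.
move=> h S; rewrite /weight /monomial.
elim/big_rec2: _ => [|i k a _ ha]; first exact: homogeneous_eone.
exact: homogeneous_wedge.
Qed.

Lemma homogeneous_subst n m (wt : 'I_n -> nat) (wt' : 'I_m -> nat)
    (g : 'I_n -> ext R m) k a :
  (forall i, homogeneous wt' (wt i) (g i)) ->
  homogeneous wt k a -> homogeneous wt' k (subst g a).
Proof.
move=> h ha T /subst_neq0[S [/ha <- /(homogeneous_monomial h)]].
by [].
Qed.

End Grading.

(** A submultiplicative norm on the exterior algebra lets the kernel be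
    estimated factor by factor. *)
Section ExteriorNorm.

Definition enorm n (a : ext R n) : R := \sum_S cmod (a S).

Section Fixed.
Variable n : nat.
Implicit Types (a b : ext R n) (S A : {set 'I_n}).

Lemma enorm_ge0 a : 0 <= enorm a.
Proof. by apply: sumr_ge0 => S _; exact: cmod_ge0. Qed.

Lemma cmod_le_enorm a S : cmod (a S) <= enorm a.
Proof.
by rewrite /enorm (bigD1 S)//= lerDl; apply: sumr_ge0 => ? _; exact: cmod_ge0.
Qed.

Lemma enorm0 : enorm (0 : ext R n) = 0.
Proof. by rewrite /enorm big1// => S _; rewrite zeroextE cmod0. Qed.

Lemma enormD a b : enorm (a + b) <= enorm a + enorm b.
Proof.
rewrite /enorm -big_split /=; apply: ler_sum => S _.
by rewrite addextE cmodD.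
Qed.

Lemma enormN a : enorm (- a) = enorm a.
Proof. by apply: eq_bigr => S _; rewrite oppextE cmodN. Qed.

Lemma enorm_sum (I : Type) (s : seq I) (P : pred I) (F : I -> ext R n) :
  enorm (\sum_(i <- s | P i) F i) <= \sum_(i <- s | P i) enorm (F i).
Proof.
elim/big_ind2: _ => [|a b c d h1 h2|//]; first by rewrite enorm0.
by apply: (le_trans (enormD _ _)); apply: lerD.
Qed.

Lemma enorm_scal c a : enorm (scal c a) = cmod c * enorm a.
Proof. by rewrite /enorm mulr_sumr; apply: eq_bigr => S _; rewrite scalE cmodM. Qed.

Lemma enorm_gen i : enorm (gen R i : ext R n) = 1.
Proof.
rewrite /enorm (bigD1 [set i]%SET)//= big1 => [|S nS].
  by rewrite addr0 genE eqxx cmod1.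
by rewrite genE (negPf nS) cmod0.
Qed.

Lemma enorm_eone : enorm (eone R n) = 1.
Proof.
rewrite /enorm (bigD1 finset.set0)//= big1 => [|S nS].
  by rewrite addr0 ffunE eqxx cmod1.
by rewrite ffunE (negPf nS) cmod0.
Qed.

(** The pairs (A, B) of disjoint index sets are among all pairs, and the signs
    disappear in the moduli. *)
Lemma enorm_wedge a b : enorm (a /w\ b) <= enorm a * enorm b.
Proof.
have -> : enorm a * enorm b = \sum_A cmod (a A) * enorm b.
  by rewrite /enorm mulr_suml.
have h1 : enorm (a /w\ b) <= \sum_(S : {set 'I_n}) \sum_(A : {set 'I_n} | A \subset S)
    cmod (a A) * cmod (b (S :\: A)).
  apply: ler_sum => S _; rewrite wedgeE; apply: (le_trans (cmod_sum _ _ _)).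
  by apply: ler_sum => A _; rewrite !cmodM cmod_sign mul1r.
apply: (le_trans h1); rewrite (exchange_big_dep xpredT)//=; apply: ler_sum => A _.
rewrite -mulr_sumr ler_wpM2l ?cmod_ge0//.
rewrite (reindex_onto (fun B => A :|: B) (fun S => S :\: A)) /=; last first.
  move=> S AS; rewrite finset.setDE finset.setUIr finset.setUCr finset.setIT.
  exact/finset.setUidPr.
rewrite /enorm big_mkcond /=; apply: ler_sum => B _.
by case: ifP => [/andP[_ /eqP->]//|_]; exact: cmod_ge0.
Qed.

Lemma enorm_wedge_le a b (x y : R) :
  enorm a <= x -> enorm b <= y -> enorm (a /w\ b) <= x * y.
Proof.
move=> h1 h2; apply: (le_trans (enorm_wedge _ _)).
by apply: ler_pM => //; exact: enorm_ge0.
Qed.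

End Fixed.

Lemma enorm_monomial n m (g : 'I_n -> ext R m) S :
  enorm (monomial g S) <= \prod_(i in S) enorm (g i).
Proof.
rewrite /monomial; elim/big_rec2: _ => [|i x a _ h]; first by rewrite enorm_eone.
exact: enorm_wedge_le.
Qed.

Lemma enorm_subst_le1 n m (g : 'I_n -> ext R m) a :
  (forall i, enorm (g i) <= 1) -> enorm (subst g a) <= enorm a.
Proof.
move=> h; rewrite /subst; apply: (le_trans (enorm_sum _ _ _)).
apply: ler_sum => S _; rewrite enorm_scal ler_piMr ?cmod_ge0//.
apply: (le_trans (enorm_monomial _ _)).
have : 0 <= \prod_(i in S) enorm (g i) <= 1; last by case/andP.
elim/big_ind: _ => [|x y /andP[x0 x1] /andP[y0 y1]|i _].
- by rewrite ler01 lexx.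
- by rewrite mulr_ge0// mulr_ile1.
- by rewrite enorm_ge0 h.
Qed.

End ExteriorNorm.

(** Regularity of forms is regularity of their coefficients: any class of
    scalar functions closed under sums and products is inherited by the
    operations on forms. *)
Record subalgebra (T : Type) (P : (T -> C) -> Prop) : Prop := Subalgebra {
  sub_cst : forall c, P (fun=> c);
  subD : forall f g, P f -> P g -> P (fun t => f t + g t);
  subM : forall f g, P f -> P g -> P (fun t => f t * g t) }.

Section Coefficientwise.
Variables (T : Type) (P : (T -> C) -> Prop).
Hypothesis hP : subalgebra P.
Let Pcst := sub_cst hP.
Let PD := subD hP.
Let PM := subM hP.

Definition coefs n (a : T -> ext R n) := forall S, P (fun t => a t S).

Lemma closed_sum (I : Type) (s : seq I) (Q : pred I) (F : I -> T -> C) :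
  (forall i, Q i -> P (F i)) -> P (fun t => \sum_(i <- s | Q i) F i t).
Proof.
move=> h; elim: s => [|i s IH].
  rewrite (_ : (fun _ => _) = fun=> 0); first exact: Pcst.
  by apply/funext => t; rewrite big_nil.
have [Qi|nQi] := boolP (Q i); last first.
  rewrite (_ : (fun _ => _) = fun t => \sum_(i <- s | Q i) F i t)//.
  by apply/funext => t; rewrite big_cons (negPf nQi).
rewrite (_ : (fun _ => _) = fun t => F i t + \sum_(i <- s | Q i) F i t).
  by apply: PD => //; exact: h.
by apply/funext => t; rewrite big_cons Qi.
Qed.

Lemma closed_prod (I : Type) (s : seq I) (Q : pred I) (F : I -> T -> C) :
  (forall i, Q i -> P (F i)) -> P (fun t => \prod_(i <- s | Q i) F i t).
Proof.
move=> h; elim: s => [|i s IH].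
  rewrite (_ : (fun _ => _) = fun=> 1); first exact: Pcst.
  by apply/funext => t; rewrite big_nil.
have [Qi|nQi] := boolP (Q i); last first.
  rewrite (_ : (fun _ => _) = fun t => \prod_(i <- s | Q i) F i t)//.
  by apply/funext => t; rewrite big_cons (negPf nQi).
rewrite (_ : (fun _ => _) = fun t => F i t * \prod_(i <- s | Q i) F i t).
  by apply: PM => //; exact: h.
by apply/funext => t; rewrite big_cons Qi.
Qed.

Lemma coefs_cst n (a : ext R n) : coefs (fun=> a).
Proof. by move=> S; exact: Pcst. Qed.

Lemma coefsD n (a b : T -> ext R n) :
  coefs a -> coefs b -> coefs (fun t => a t + b t).
Proof.
move=> ha hb S; rewrite (_ : (fun _ => _) = fun t => a t S + b t S).
  exact: PD.
by apply/funext => t; rewrite addextE.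
Qed.

Lemma coefs_scal n (c : T -> C) (a : T -> ext R n) :
  P c -> coefs a -> coefs (fun t => scal (c t) (a t)).
Proof.
move=> hc ha S; rewrite (_ : (fun _ => _) = fun t => c t * a t S).
  exact: PM.
by apply/funext => t; rewrite scalE.
Qed.

Lemma coefsN n (a : T -> ext R n) : coefs a -> coefs (fun t => - a t).
Proof.
move=> ha S; rewrite (_ : (fun _ => _) = fun t => -1 * a t S).
  exact: PM.
by apply/funext => t; rewrite oppextE mulN1r.
Qed.

Lemma coefs_sum n (I : Type) (s : seq I) (Q : pred I) (F : I -> T -> ext R n) :
  (forall i, Q i -> coefs (F i)) -> coefs (fun t => \sum_(i <- s | Q i) F i t).
Proof.
move=> h S; rewrite (_ : (fun _ => _) = fun t => \sum_(i <- s | Q i) F i t S).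
  by apply: closed_sum => i Qi; exact: h.
by apply/funext => t; rewrite sumextE.
Qed.

Lemma coefs_wedge n (a b : T -> ext R n) :
  coefs a -> coefs b -> coefs (fun t => a t /w\ b t).
Proof.
move=> ha hb S; rewrite (_ : (fun _ => _) = fun t =>
  \sum_(A : {set 'I_n} | A \subset S)
    (-1) ^+ inversions A (S :\: A) * a t A * b t (S :\: A)%SET).
  by apply: closed_sum => A _; apply: PM => //; exact: PM.
by apply/funext => t; rewrite wedgeE.
Qed.

Lemma coefs_monomial n m (g : T -> 'I_n -> ext R m) S :
  (forall i, coefs (fun t => g t i)) -> coefs (fun t => monomial (g t) S).
Proof.
move=> h; rewrite /monomial; elim: (index_enum _) => [|i s IH].
  rewrite (_ : (fun _ => _) = fun=> eone R m); first exact: coefs_cst.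
  by apply/funext => t; rewrite big_nil.
have [Qi|nQi] := boolP (i \in S); last first.
  rewrite (_ : (fun _ => _) = fun t =>
    \big[@wedge R m/@eone R m]_(i <- s | i \in S) g t i)//.
  by apply/funext => t; rewrite big_cons (negPf nQi).
rewrite (_ : (fun _ => _) = fun t => g t i /w\
    \big[@wedge R m/@eone R m]_(i <- s | i \in S) g t i).
  exact: coefs_wedge.
by apply/funext => t; rewrite big_cons Qi.
Qed.

Lemma coefs_subst n m (g : T -> 'I_n -> ext R m) (a : T -> ext R n) :
  (forall i, coefs (fun t => g t i)) -> coefs a ->
  coefs (fun t => subst (g t) (a t)).
Proof.
move=> hg ha S; rewrite (_ : (fun _ => _) = fun t =>
  \sum_A a t A * monomial (g t) A S).
  by apply: closed_sum => A _; apply: PM => //; exact: coefs_monomial.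
by apply/funext => t; rewrite substE.
Qed.

End Coefficientwise.
End ExteriorLinear.

(** * Degrees in the Koppelman kernel *)

Section KernelAlgebra.
Variable R : realType.
Local Notation C := (Cplx R).

Local Notation N12 := ((3 + 3) + (3 + 3))%N.
Local Notation zI j := (lshift (3 + 3) (lshift 3 j)).
Local Notation zbI j := (lshift (3 + 3) (rshift 3 j)).
Local Notation wI j := (rshift (3 + 3) (lshift 3 j)).
Local Notation wbI j := (rshift (3 + 3) (rshift 3 j)).

Lemma split_lshift m n (i : 'I_m) : fintype.split (lshift n i) = inl i.
Proof. exact: (unsplitK (inl i)). Qed.

Lemma split_rshift m n (i : 'I_n) : fintype.split (rshift m i) = inr i.
Proof. exact: (unsplitK (inr i)). Qed.

Lemma index12P (x : 'I_N12) :
  exists j : 'I_3, [\/ x = zI j, x = zbI j, x = wI j | x = wbI j].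
Proof.
case: (splitP x) => k hk; case: (splitP k) => j hj; exists j.
- by constructor 1; apply: val_inj; rewrite /= hk hj.
- by constructor 2; apply: val_inj; rewrite /= hk hj.
- by constructor 3; apply: val_inj; rewrite /= hk hj.
- by constructor 4; apply: val_inj; rewrite /= hk hj.
Qed.

(** With parameters 0 and 1, the weight counts the differentials of [zeta],
    [zetabar], [z] and [zbar] selected by [a], [b], [c] and [d]. *)
Definition wt_product (a b c d : nat) (x : 'I_N12) : nat :=
  match fintype.split x with
  | inl k => match fintype.split k with inl _ => a | inr _ => b end
  | inr k => match fintype.split k with inl _ => c | inr _ => d end
  end.

Lemma wt_productE a b c d : ((forall j, wt_product a b c d (zI j) = a) *
  (forall j, wt_product a b c d (zbI j) = b) * (forall j, wt_product a b c d (wI j) = c) *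
  (forall j, wt_product a b c d (wbI j) = d))%type.
Proof. by split; first (split; first split); move=> j;
  rewrite /wt_product ?split_lshift ?split_rshift// ?split_lshift ?split_rshift. Qed.

Definition anti (x : 'I_N12) : bool := wt_product 0 1 0 1 x == 1%N.

Lemma antiholomorphic_neq0 (a : ext R N12) B :
  antiholomorphic_1form a -> a B != 0 -> exists2 x, anti x & B = [set x]%SET.
Proof.
case=> b [c ->]; rewrite sumextE => h.
suff [j] : exists j, (B == [set (zbI j)]%SET) || (B == [set (wbI j)]%SET).
  case/orP => /eqP ->; [exists (zbI j)|exists (wbI j)] => //;
  by rewrite /anti wt_productE.
apply: contrapT => /forallNP h'; move: h; rewrite big1 ?eqxx// => j _.
have /negP := h' j; rewrite negb_or => /andP[n1 sqnorm].
by rewrite addextE !scalE !genE (negPf n1) (negPf sqnorm) !mulr0 addr0.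
Qed.

Definition zset : {set 'I_N12} := [set zI i1; zI i2; zI i3]%SET.

Lemma deta_neq0 j (S : {set 'I_N12}) : deta R j S != 0 ->
  S = [set zI j]%SET \/ S = [set wI j]%SET.
Proof.
rewrite /deta addextE oppextE !genE.
have [->|_] := eqVneq S [set zI j]%SET; first by left.
have [->|_] := eqVneq S [set wI j]%SET; first by right.
by rewrite subr0 eqxx.
Qed.

Lemma deta_z j : deta R j [set zI j]%SET = 1.
Proof.
rewrite /deta addextE oppextE !genE eqxx (inj_eq finset.set1_inj).
by rewrite eq_shift subr0.
Qed.

Lemma setD_eqD (T : finType) (A A' S : {set T}) : A \subset S -> A' \subset S ->
  S :\: A' = S :\: A -> A' = A.
Proof.
move=> /fintype.subsetP AS /fintype.subsetP A'S /finset.setP h; apply/finset.setP => i.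
move: (h i) (AS i) (A'S i); rewrite !inE.
by case: (i \in A); case: (i \in A'); case: (i \in S) => //= _ h1 h2;
  (by move: (h1 isT)) || by move: (h2 isT).
Qed.

Lemma deta123_zset : cmod (deta123 R zset) = 1.
Proof.
have nz (j k : 'I_3) : (zI j == zI k) = (j == k) by rewrite !eq_shift.
have nw (j k : 'I_3) : (wI j == zI k) = false by rewrite eq_shift.
have s12 : [set zI i1; zI i2]%SET :\: [set zI i1] = [set zI i2 : 'I_N12]%SET.
  apply/finset.setP => x; rewrite !inE.
  have [->|] := eqVneq x (zI i1) => /=; last by [].
  by rewrite nz.
have s123 : zset :\: [set zI i1; zI i2] = [set zI i3 : 'I_N12]%SET.
  apply/finset.setP => x; rewrite !inE.
  have [->|/=] := eqVneq x (zI i1) => /=; first by rewrite nz.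
  by have [->|/=] := eqVneq x (zI i2) => /=; first by rewrite nz.
rewrite /deta123 (@wedge_single _ _ _ _ [set zI i1; zI i2]%SET); first last.
- move=> A' A's _ /deta_neq0 [] h.
    by apply: (@setD_eqD _ _ _ zset); rewrite ?h ?s123// finset.subsetUl.
  have : (wI i3 : 'I_N12) \in zset :\: A' by rewrite h inE.
  by rewrite !inE !nw andbF.
- exact: finset.subsetUl.
rewrite s123 deta_z mulr1 cmodM cmod_sign mul1r.
rewrite (@wedge_single _ _ _ _ [set zI i1]%SET); first last.
- move=> A' A's _ /deta_neq0 [] h.
    by apply: (@setD_eqD _ _ _ [set zI i1; zI i2]%SET); rewrite ?h ?s12// finset.subsetUl.
  have : (wI i2 : 'I_N12) \in [set zI i1; zI i2]%SET :\: A' by rewrite h inE.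
  by rewrite !inE !nw andbF.
- exact: finset.subsetUl.
by rewrite s12 !deta_z mulr1 cmodM cmod_sign mul1r cmod1.
Qed.

(** Multiplication by [deta123] is injective on antiholomorphic 1-forms, with
    an inverse that reads off single coefficients: the equation defining the
    kernel determines it, and every bound or continuity property of the
    right-hand side passes to the kernel. *)
Lemma kernel_coef : exists c : {set 'I_N12} -> C,
  (forall B, cmod (c B) <= 1 /\ (c B != 0 -> exists2 x, anti x & B = [set x]%SET)) /\
  forall (a rhs : ext R N12), antiholomorphic_1form a -> deta123 R /w\ a = rhs ->
  forall B, a B = c B * rhs (zset :|: B).
Proof.
pose c B : C := if [exists x, anti x && (B == [set x]%SET)] then
  ((-1) ^+ inversions zset ((zset :|: B) :\: zset) * deta123 R zset)^-1 else 0.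
exists c; split=> [B|a rhs ha <- B].
  rewrite /c; case: ifPn => [/fintype.existsP[x /andP[ax /eqP Bx]]|_].
    by rewrite cmodV cmodM cmod_sign deta123_zset mulr1 invr1; split=> // _; exists x.
  by rewrite cmod0 ler01 eqxx.
rewrite /c; case: ifPn => [/fintype.existsP[x /andP[ax /eqP ->]]|/fintype.existsPn nx]; last first.
  rewrite mul0r; apply/eqP; apply: contraT => /(antiholomorphic_neq0 ha)[x ax Bx].
  by have := nx x; rewrite ax Bx eqxx.
have zx y : anti y -> y \notin zset.
  by move=> ay; apply/negP; rewrite !inE => /orP[/orP[]|] /eqP yE; move: ay; rewrite yE /anti wt_productE.
have sx : (zset :|: [set x]) :\: zset = [set x]%SET.
  apply/finset.setP => y; rewrite finset.in_setD finset.in_setU !finset.in_set1.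
  by have [->|] := eqVneq y x; [rewrite (zx _ ax) orbT|case: (y \in zset)].
rewrite (@wedge_single _ _ _ _ zset); first last.
- move=> A' A's _ /(antiholomorphic_neq0 ha)[y ay yE].
  apply: (@setD_eqD _ _ _ (zset :|: [set x])) => //; first exact: finset.subsetUl.
  rewrite sx yE; congr [set _]%SET; apply/eqP; move: (finset.set11 y).
  rewrite -yE finset.in_setD finset.in_setU finset.in_set1 => /andP[_ /orP[|//]].
  by rewrite (negPf (zx _ ay)).
- exact: finset.subsetUl.
rewrite sx mulrA mulVf ?mul1r// -cmod_eq0 cmodM cmod_sign deta123_zset.
by rewrite mulr1 oner_neq0.
Qed.

Definition pull_gen (w : R4 R) (i : 'I_N12) : ext R ((2 + 2) + (3 + 3)) :=
  match fintype.split i with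
  | inl k => subst (fun l => gen R (lshift (3 + 3) l)) (cov_diff w k)
  | inr k => gen R (rshift (2 + 2) k)
  end.

Lemma pull_zetaE w (a : ext R N12) T :
  pull_zeta w a T = \sum_S a S * monomial (pull_gen w) S T.
Proof. exact: substE. Qed.

(** The monomials whose coefficients the integration over [Z] in [zeta]
    extracts. *)
Definition topset (S : {set 'I_(3 + 3)}) : {set 'I_((2 + 2) + (3 + 3))} :=
  ((@lshift (2 + 2) (3 + 3) @: [set: 'I_(2 + 2)]) :|:
   (@rshift (2 + 2) (3 + 3) @: S))%SET.

(** The counterpart of [wt_product] after the pull-back, which preserves
    bidegrees. *)
Definition wt_pulled (a b c d : nat) (x : 'I_((2 + 2) + (3 + 3))) : nat :=
  match fintype.split x with
  | inl k => match fintype.split k with inl _ => a | inr _ => b end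
  | inr k => match fintype.split k with inl _ => c | inr _ => d end
  end.

Lemma pull_gen_homogeneous a b c d w i :
  homogeneous (wt_pulled a b c d) (wt_product a b c d i) (pull_gen w i).
Proof.
rewrite /pull_gen /wt_product; case: (fintype.split i) => k; last first.
  suff -> : (match fintype.split k with inl _ => c | inr _ => d end)
    = wt_pulled a b c d (rshift (2 + 2) k) by exact: homogeneous_gen.
  by rewrite /wt_pulled split_rshift.
pose wt (l : 'I_(2 + 2)) := match fintype.split l with inl _ => a | inr _ => b end.
apply: (@homogeneous_subst _ _ _ wt).
  move=> l; suff -> : wt l = wt_pulled a b c d (lshift (3 + 3) l) by exact: homogeneous_gen.
  by rewrite /wt_pulled split_lshift.
have hg (l : 'I_(2 + 2)) m : wt l = m -> homogeneous wt m (gen R l).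
  by move=> <-; exact: homogeneous_gen.
rewrite /cov_diff; case: (fintype.split k) => j; apply: homogeneousD;
  apply: homogeneous_scal; apply: hg; rewrite /wt ?split_lshift ?split_rshift//.
Qed.

Lemma weight_topset a b c d S : weight (wt_pulled a b c d) (topset S) =
  (2 * a + 2 * b + holdeg S * c + antideg S * d)%N.
Proof.
rewrite /weight big_split_ord /=.
have inl (k : 'I_(2 + 2)) : lshift (3 + 3) k \in topset S.
  by rewrite /topset finset.in_setU imset_f.
have inr (k : 'I_(3 + 3)) : (rshift (2 + 2) k \in topset S) = (k \in S).
  rewrite /topset finset.in_setU (mem_imset _ _ (@rshift_inj _ _)).
  case: (k \in S); rewrite ?orbT ?orbF//.
  by apply/negbTE/negP => /imsetP[i _ /eqP]; rewrite eq_shift.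
under eq_bigl do rewrite inl.
under [X in (_ + X)%N]eq_bigl do rewrite inr.
rewrite big_split_ord /= [X in (_ + X)%N]big_split_ord /=.
under eq_bigr do rewrite /wt_pulled !split_lshift.
under [X in (_ + X + _)%N]eq_bigr do rewrite /wt_pulled !split_lshift split_rshift.
under [X in (_ + (X + _))%N]eq_bigr do rewrite /wt_pulled !split_rshift split_lshift.
under [X in (_ + (_ + X))%N]eq_bigr do rewrite /wt_pulled !split_rshift.
by rewrite !sum_nat_const /holdeg /antideg !card_ord !cardsE addnA.
Qed.

Lemma weight_monomial a b c d w S S' : monomial (pull_gen w) S (topset S') != 0 ->
  weight (wt_product a b c d) S = (2 * a + 2 * b + holdeg S' * c + antideg S' * d)%N.
Proof.
rewrite -weight_topset => h.
apply/esym; apply: (@homogeneous_monomial R _ _ _ _ (pull_gen w)) h => i.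
exact: pull_gen_homogeneous.
Qed.

Lemma omega_neq0 zeta (S : {set 'I_N12}) : omega zeta S != 0 :> C ->
  S = [set zI i1; zI i2]%SET.
Proof.
rewrite /omega scalE mulf_eq0 negb_or => /andP[_ /wedge_neq0[A [AS]]].
rewrite !genE; have [A1|] := eqVneq A [set zI i1]%SET; last by rewrite eqxx.
have [A2|] := eqVneq (S :\: A) [set zI i2]%SET; last by rewrite eqxx.
by move=> _ _; rewrite -(finset.setID S A) A2 (finset.setIidPr AS) A1.
Qed.

(** Differentials of each kind are counted on both sides of the pull-back. A
    top coefficient needs two [dzetabar], the form [f] provides [q] of them and
    the single antiholomorphic factor [k] is [dzetabar] or [dzbar]; in the
    former case nothing is left for [z] and [q] is 1, in the latter one [dzbar]
    is left and [q] is 2. *)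
Lemma pull_koppelman_bideg (w : R4 R) (k : ext R N12) (f : ext R (3 + 3)) q S' :
  (forall B, k B != 0 -> exists2 x, anti x & B = [set x]%SET) -> has_bideg 0 q f ->
  pull_zeta w (omega (cov w) /w\ k /w\ in_zeta f) (topset S') != 0 ->
  holdeg S' = 0%N /\ antideg S' = q.-1.
Proof.
move=> hk hf /subst_neq0[S [/wedge_neq0[A [AS /wedge_neq0[B [BA oB kB]] fA]] hm]].
have hgen wt m (i : 'I_N12) : wt i = m -> homogeneous wt m (gen R i).
  by move=> <-; exact: homogeneous_gen.
have wS a b c d : weight (wt_product a b c d) S =
   (weight (wt_product a b c d) B + weight (wt_product a b c d) (A :\: B)
    + weight (wt_product a b c d) (S :\: A))%N.
  by rewrite (weightD _ AS) (weightD _ BA).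
have oB' a b c d : weight (wt_product a b c d) B = (2 * a)%N.
  rewrite (omega_neq0 oB) /weight big_setU1 ?big_set1 /=.
    by rewrite !wt_productE addnn mul2n.
  by rewrite inE eq_shift.
have [x ax xE] := hk _ kB.
have fA' a b : weight (wt_product 0 a 0 b) (S :\: A) = (q * a)%N.
  have hq : homogeneous (fun i => match fintype.split i with inl _ => 0 | inr _ => a end)%N
     (q * a) f.
    move=> T /hf[_ <-]; rewrite /weight big_split_ord /= big1 => [|i _].
      under eq_bigr do rewrite split_rshift.
      by rewrite sum_nat_const add0n /antideg cardsE.
    by rewrite split_lshift.
  apply: (homogeneous_subst (wt' := wt_product 0 a 0 b) _ hq fA) => i.
  by apply: hgen; rewrite /wt_product split_lshift.
have wx a b c d : weight (wt_product a b c d) (A :\: B) = wt_product a b c d x.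
  by rewrite xE /weight big_set1.
have fA1 : weight (wt_product 0 0 1 0) (S :\: A) = 0%N.
  have hq : homogeneous (fun=> 0%N) 0 f.
    by move=> T _; rewrite /weight big1.
  apply: (homogeneous_subst (wt' := wt_product 0 0 1 0) _ hq fA) => i.
  by apply: hgen; rewrite /wt_product split_lshift; case: (fintype.split i).
have e1 := weight_monomial 0 0 1 0 hm.
have e2 := weight_monomial 0 1 0 1 hm.
have e3 := weight_monomial 0 1 0 0 hm.
move: e1 e2 e3; rewrite !wS !oB' !wx !fA' fA1.
move: ax; rewrite /anti.
have [j [->|->|->|->]] := index12P x; rewrite !wt_productE //= => _; lia.
Qed.

End KernelAlgebra.

(** * The pull-back to the covering *)

Section KernelBound.
Variable R : realType.
Local Notation C := (Cplx R).

Local Notation N12 := ((3 + 3) + (3 + 3))%N.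
Local Notation zI j := (lshift (3 + 3) (lshift 3 j)).
Local Notation zbI j := (lshift (3 + 3) (rshift 3 j)).
Local Notation wI j := (rshift (3 + 3) (lshift 3 j)).
Local Notation wbI j := (rshift (3 + 3) (rshift 3 j)).

Lemma I3P (j : 'I_3) : [\/ j = i1, j = i2 | j = i3].
Proof.
case: j => [[|[|[|//]]] h]; [constructor 1|constructor 2|constructor 3];
  exact: val_inj.
Qed.

Definition wsize (w : R4 R) : R := cmod (ucoord w) + cmod (vcoord w).

Lemma wsize_ge0 w : 0 <= wsize w.
Proof. by rewrite addr_ge0 ?cmod_ge0. Qed.

Lemma cmod_natr k : cmod (k%:R : C) = k%:R.
Proof.
rewrite (_ : k%:R = (k%:R : R)%:C%C); first by rewrite cmod_real normr_nat.
by rewrite rmorph_nat.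
Qed.

Lemma enorm_cov_diff (w : R4 R) k : enorm (cov_diff w k) <=
  match fintype.split k with inl j | inr j => cmod (cov_du w j) + cmod (cov_dv w j) end.
Proof.
rewrite /cov_diff; case: (fintype.split k) => j; apply: (le_trans (enormD _ _)).
  by rewrite !enorm_scal !enorm_gen !mulr1.
by rewrite !enorm_scal !enorm_gen !mulr1 !cmodJ.
Qed.

Lemma enorm_pull_gen (w : R4 R) x : enorm (pull_gen w x) <=
  match fintype.split x with
  | inl k => match fintype.split k with
     inl j | inr j => cmod (cov_du w j) + cmod (cov_dv w j) end
  | inr _ => 1 end.
Proof.
rewrite /pull_gen; case: (fintype.split x) => k; last by rewrite enorm_gen.
apply: le_trans (enorm_cov_diff w k).
by apply: enorm_subst_le1 => i; rewrite enorm_gen.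
Qed.

Lemma cov_duE (w : R4 R) : (cov_du w i1 = 2 * ucoord w) *
  (cov_du w i2 = 0) * (cov_du w i3 = vcoord w).
Proof. by []. Qed.

Lemma cov_dvE (w : R4 R) : (cov_dv w i1 = 0) *
  (cov_dv w i2 = 2 * vcoord w) * (cov_dv w i3 = ucoord w).
Proof. by []. Qed.

Lemma covE (w : R4 R) : (cov w ord0 i1 = ucoord w ^+ 2) *
  (cov w ord0 i2 = vcoord w ^+ 2) * (cov w ord0 i3 = ucoord w * vcoord w).
Proof. by rewrite /cov !mxE. Qed.

Lemma cov_d_le (w : R4 R) j : cmod (cov_du w j) + cmod (cov_dv w j) <= 2 * wsize w.
Proof.
have u0 := cmod_ge0 (ucoord w); have v0 := cmod_ge0 (vcoord w).
by case: (I3P j) => ->; rewrite !(cov_duE, cov_dvE) ?cmodM ?cmod_natr ?cmod0 /wsize; lra.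
Qed.

(** [dzeta_1] and [dzeta_2] pull back to [2 u du] and [2 v dv], there is no
    further [dzeta], and each [dzetabar] is of the order of [|w|]. *)
Lemma enorm_monomial_pull (w : R4 R) (S : {set 'I_N12}) :
  zI i1 \in S -> zI i2 \in S -> weight (wt_product 1 0 0 0) S = 2%N ->
  weight (wt_product 0 1 0 0) S = 2%N ->
  enorm (monomial (pull_gen w) S) <=
   (2 * cmod (ucoord w)) * (2 * cmod (vcoord w)) * (2 * wsize w) ^+ 2.
Proof.
move=> S1 S2 hol hanti.
have n12 : zI i2 != zI i1 :> 'I_N12 by rewrite !eq_shift.
apply: (le_trans (enorm_monomial _ _)).
rewrite (bigD1 (zI i1))//= (bigD1 (zI i2)) /=; last by rewrite S2.
rewrite mulrA; apply: ler_pM.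
- by rewrite mulr_ge0// enorm_ge0.
- by apply: prodr_ge0 => i _; exact: enorm_ge0.
- apply: ler_pM; rewrite ?enorm_ge0//; apply: (le_trans (enorm_pull_gen _ _));
  by rewrite ?split_lshift ?split_lshift !(cov_duE, cov_dvE) cmod0 ?addr0 ?add0r cmodM cmod_natr.
move: hol hanti; rewrite /weight (bigD1 (zI i1))//= (bigD1 (zI i2)) /=; last by rewrite S2.
rewrite !wt_productE addnA => /(@addnI 2 _ 0) /eqP; rewrite sum_nat_eq0 => /forallP hz.
rewrite (bigD1 (zI i1))//= (bigD1 (zI i2)) /=; last by rewrite S2.
rewrite !wt_productE !add0n => h2; rewrite -[X in _ <= _ ^+ X]h2.
rewrite -prodrXr; apply: ler_prod => x /andP[/andP[xS x1] x2].
rewrite enorm_ge0 /=; apply: (le_trans (enorm_pull_gen _ _)).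
have [j [xE|xE|xE|xE]] := index12P x; move: (xE) => ->;
  rewrite ?split_lshift ?split_rshift ?split_lshift ?split_rshift wt_productE ?expr0//.
- have := hz x; rewrite xS x1 x2 xE wt_productE.
  by [].
- by rewrite expr1; exact: cov_d_le.
Qed.

(** The poles of [omega] along [u v = 0] cancel against the pull-back of
    [dzeta_1] and [dzeta_2], and the two factors [dzetabar] give the square
    that tames the kernel at the singular point. *)
Lemma pull_koppelman_bound (w : R4 R) k (f : ext R (3 + 3)) S' :
  cmod (pull_zeta w (omega (cov w) /w\ k /w\ in_zeta f) (topset S')) <=
  8 * wsize w ^+ 2 * enorm k * enorm f.
Proof.
set c := omega (cov w) /w\ k /w\ in_zeta f.
pose U := cmod (ucoord w); pose V := cmod (vcoord w).
have U0 : 0 <= U := cmod_ge0 _; have V0 : 0 <= V := cmod_ge0 _.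
have W0 := wsize_ge0 w.
have h1 : cmod (pull_zeta w c (topset S')) <=
    enorm c * ((2 * U) * (2 * V) * (2 * wsize w) ^+ 2).
  rewrite pull_zetaE; apply: (le_trans (cmod_sum _ _ _)).
  rewrite /enorm mulr_suml; apply: ler_sum => S _; rewrite cmodM.
  have [->|cS] := eqVneq (c S) 0; first by rewrite cmod0 !mul0r.
  rewrite ler_wpM2l ?cmod_ge0//.
  have [->|mS] := eqVneq (monomial (pull_gen w) S (topset S')) 0.
    by rewrite cmod0 !mulr_ge0// exprn_ge0// mulr_ge0.
  apply: (le_trans (cmod_le_enorm _ _)).
  have [A [AS /wedge_neq0[B [BA oB _]] _]] := wedge_neq0 cS.
  have BS := fintype.subset_trans BA AS.
  apply: enorm_monomial_pull.
  - by apply: (fintype.subsetP BS); rewrite (omega_neq0 oB) !inE eqxx.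
  - by apply: (fintype.subsetP BS); rewrite (omega_neq0 oB) !inE eqxx orbT.
  - by rewrite (weight_monomial 1 0 0 0 mS); lia.
  - by rewrite (weight_monomial 0 1 0 0 mS); lia.
have h2 : enorm c <= (2 * (U * V))^-1 * enorm k * enorm f.
  apply: enorm_wedge_le; last by apply: enorm_subst_le1 => i; rewrite enorm_gen.
  apply: enorm_wedge_le => //; rewrite /omega enorm_scal cmodV cmodM cmodN cmod_natr.
  rewrite !covE cmodM ler_piMr ?invr_ge0 ?mulr_ge0//.
  by apply: (le_trans (enorm_wedge _ _)); rewrite !enorm_gen mulr1.
apply: (le_trans h1).
(* On [u v = 0] the inverse in [omega] is the inverse of 0, which is 0. *)
have [UV0|UV0] := eqVneq (U * V) 0.
  have -> : enorm c = 0.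
    apply/le_anti; rewrite enorm_ge0 andbT; apply: (le_trans h2).
    by rewrite UV0 mulr0 invr0 !mul0r.
  by rewrite mul0r !mulr_ge0 ?enorm_ge0// ?exprn_ge0// ler0n.
apply: (@le_trans _ _ ((2 * (U * V))^-1 * enorm k * enorm f *
    ((2 * U) * (2 * V) * (2 * wsize w) ^+ 2))).
  by rewrite ler_wpM2r// !mulr_ge0// exprn_ge0// mulr_ge0.
rewrite le_eqVlt; apply/orP; left; apply/eqP.
by field; move: UV0; rewrite mulf_eq0 negb_or => /andP[-> ->].
Qed.

End KernelBound.

(** * Smooth plateaus on the line *)

Section RealSmooth.
Variable R : realType.
Implicit Types f g : R -> R.

Lemma is_derive_to f (x df df' : R) :
  is_derive x 1 f df -> df = df' -> is_derive x 1 f df'.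
Proof. by move=> h <-. Qed.

Lemma is_derive_ext f g (x l l' : R) : is_derive x 1 f l ->
  (forall t, f t = g t) -> l = l' -> is_derive x 1 g l'.
Proof. by move=> h /funext <- <-. Qed.

(** Differentiability of order [n] by recursion on [n], the form suited to
    inductive proofs of the product and chain rules. *)
Fixpoint rCk (n : nat) (f : R -> R) : Prop :=
  match n with
  | 0 => continuous f
  | n'.+1 => exists f', (forall x : R, is_derive x (1 : R) f (f' x)) /\ rCk n' f'
  end.

Definition real_smooth f := forall n, rCk n f.

Lemma is_derive_continuous f (x d : R) : is_derive x 1 f d -> {for x, continuous f}.
Proof. by move=> [h _]; apply: differentiable_continuous; exact/derivable1_diffP. Qed.

Lemma rCk_continuous n f : rCk n f -> continuous f.
Proof.
by case: n => [//|n [f' [h _]]] x; exact: is_derive_continuous (h x).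
Qed.

Lemma rCkW n f : rCk n.+1 f -> rCk n f.
Proof.
elim: n f => [|n IH] f; first exact: rCk_continuous.
by move=> [f' [h hf']]; exists f'; split=> //; exact: IH.
Qed.

Lemma rCk_cst n (c : R) : rCk n (fun=> c).
Proof.
elim: n c => [|n IH] c; first by move=> x; exact: cst_continuous.
by exists (fun=> 0); split=> // x; exact: is_derive_cst.
Qed.

Lemma rCkD n f g : rCk n f -> rCk n g -> rCk n (fun x => f x + g x).
Proof.
elim: n f g => [|n IH] f g.
  by move=> hf hg x; apply: cvgD; [exact: hf|exact: hg].
move=> [f' [h hf']] [g' [k hg']]; exists (fun x => f' x + g' x); split.
  by move=> x; exact: (is_deriveD (h x) (k x)).
exact: IH.
Qed.

Lemma rCkM n f g : rCk n f -> rCk n g -> rCk n (fun x => f x * g x).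
Proof.
elim: n f g => [|n IH] f g.
  by move=> hf hg x; apply: cvgM; [exact: hf|exact: hg].
move=> hf hg; move: (hf) (hg) => [f' [h hf']] [g' [k hg']].
exists (fun x => f x * g' x + g x * f' x); split.
  by move=> x; exact: (is_deriveM (h x) (k x)).
by apply: rCkD; apply: IH => //; exact: rCkW.
Qed.

Lemma rCk_comp n f g : rCk n f -> rCk n g -> rCk n (fun x => f (g x)).
Proof.
elim: n f g => [|n IH] f g.
  by move=> hf hg x; apply: continuous_comp; [exact: hg|exact: hf].
move=> hf hg; move: (hf) (hg) => [f' [h hf']] [g' [k hg']].
exists (fun x => f' (g x) * g' x); split.
  by move=> x; exact: (is_derive1_comp (h (g x)) (k x)).
by apply: rCkM => //; apply: IH => //; exact: rCkW.
Qed.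

Lemma rCk_id n : rCk n id.
Proof.
case: n => [|n]; first by move=> x; exact: cvg_id.
by exists (fun=> 1); split=> [x|]; [exact: is_derive_id|exact: rCk_cst].
Qed.

(** The functions [t ^- k * exp (- 1 / t)], extended by 0; their derivatives
    are combinations of functions of the same family, so that all of them are
    smooth. *)
Definition flat (k : nat) (t : R) : R := if 0 < t then t ^- k * expR (- t^-1) else 0.

Lemma flat_ge0 k t : 0 <= flat k t.
Proof.
by rewrite /flat; case: ifP => // t0; rewrite mulr_ge0 ?expR_ge0// invr_ge0 exprn_ge0// ltW.
Qed.

(** The exponential series dominates its term of degree [k + 2]; the bound by a
    square gives the derivative 0 at the origin. *)
Lemma flat_le k t : flat k t <= (k.+2`!)%:R * t ^+ 2.
Proof.
rewrite /flat; case: ifPn => [t0|_]; last by rewrite mulr_ge0 ?sqr_ge0.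
have ti0 : 0 <= t^-1 by rewrite invr_ge0 ltW.
have h := expR_ge1Dxn k.+1 ti0.
have f0 : 0 < (k.+2`!)%:R :> R by rewrite ltr0n fact_gt0.
have h2 : t^-1 ^+ k.+2 / (k.+2`!)%:R <= expR t^-1.
  by apply: le_trans h; rewrite lerDr.
rewrite expRN ler_pdivrMr ?expR_gt0//.
apply: le_trans (ler_wpM2l _ h2); last by rewrite mulr_ge0 ?sqr_ge0 ?ltW.
rewrite le_eqVlt; apply/orP; left; apply/eqP.
rewrite -addn2 exprVn exprD; field.
by rewrite expf_neq0 ?gt_eqF.
Qed.

Lemma is_derive_flat k (t : R) :
  is_derive t 1 (flat k) (- k%:R * flat k.+1 t + flat k.+2 t).
Proof.
have [t0|t0|t0] := ltrgtP t 0.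
- have : is_derive t 1 (fun=> 0 : R) (- k%:R * flat k.+1 t + flat k.+2 t).
    rewrite /flat ltNge ltW//= mulr0 addr0; exact: is_derive_cst.
  apply: near_eq_is_derive.
  have : \forall x \near t, x < 0 by exact: lt_nbhsl.
  by apply: filterS => x x0; rewrite /flat ltNge ltW.
- have : is_derive t 1 (fun x : R => (x ^+ k)^-1 * expR (- x^-1))
      (- k%:R * flat k.+1 t + flat k.+2 t).
    have tn0 : t != 0 by rewrite gt_eqF.
    have tk0 : t ^+ k != 0 by rewrite expf_neq0.
    have d1 : is_derive t 1 (fun x : R => x^-1) (- t ^- 2).
      have := @is_deriveV _ id t 1 1 tn0 (is_derive_id t 1).
      by move=> h; apply: (is_derive_to h); rewrite /GRing.scale /= mulr1.
    have d2 : is_derive t 1 (fun x : R => (x ^+ k)^-1) (- (k%:R * t ^- k.+1)).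
      have hX := @is_deriveX _ _ id k t 1 1 (is_derive_id t 1).
      rewrite exprfctE in hX.
      have := @is_deriveV _ (fun x => x ^+ k) t _ 1 tk0 hX.
      move=> h; apply: (is_derive_to h).
      rewrite /GRing.scale /= mulr1; case: (k) => [|m]; first by rewrite !(mul0r,mulr0) oppr0.
      by rewrite /= !exprS; field; rewrite expf_neq0.
    have d3 : is_derive t 1 (fun x : R => expR (- x^-1)) (expR (- t^-1) * t ^- 2).
      have d1N : is_derive t 1 (fun x : R => - x^-1) (t ^- 2).
        exact: (is_derive_to (is_deriveN d1) (opprK _)).
      exact: (@is_derive1_comp _ (@expR R) (fun x => - x^-1) t _ _
        (is_derive_expR _) d1N).
    have := is_deriveM d2 d3 => h; apply: (is_derive_to h).
    by rewrite /GRing.scale /= /flat t0 !exprS; field; rewrite tk0.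
  apply: near_eq_is_derive.
  have : \forall x \near t, 0 < x by exact: lt_nbhsr.
  by apply: filterS => x x0; rewrite /flat x0.
- rewrite t0 /flat ltxx mulr0 addr0 -/(flat k).
  have h : h^-1 *: ((flat k \o shift 0) (h *: (1 : R)) - flat k 0) @[h --> (0:R)^'] --> (0 : R).
    apply/cvgrPdist_le => e e0.
    pose M : R := (k.+2`!)%:R.
    have M0 : 0 < M by rewrite ltr0n fact_gt0.
    have : \forall h \near (0:R)^', `|h| < e / M.
      apply: nbhs_dnbhs; have := @nbhs0_lt R R (e / M); apply.
      by rewrite divr_gt0.
    apply: filter_app; near=> h => hlt.
    have h0 : h != 0 by near: h; exact: nbhs_dnbhs_neq.
    rewrite sub0r normrN /= addr0 /GRing.scale /= mulr1.
    rewrite {2}/flat ltxx subr0 normrM normfV ger0_norm ?flat_ge0//.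
    rewrite mulrC ler_pdivrMr ?normr_gt0//; apply: (le_trans (flat_le _ _)).
    rewrite -/M -[h ^+ 2]real_normK ?num_real// expr2 mulrA ler_wpM2r//.
    by rewrite mulrC -ler_pdivlMr// ltW.
  apply: DeriveDef; first by apply/cvg_ex; exists 0.
  by apply/cvg_lim => //; exact: norm_hausdorff.
Unshelve. all: by end_near. Qed.

Lemma rCk_flat n k : rCk n (flat k).
Proof.
elim: n k => [|n IH] k.
  by move=> t; exact: is_derive_continuous (is_derive_flat k t).
exists (fun t => - k%:R * flat k.+1 t + flat k.+2 t); split.
  exact: is_derive_flat.
by apply: rCkD => //; apply: rCkM => //; exact: rCk_cst.
Qed.

(** [1 - e * flat 0 t] is 1 for [t <= 0] and nonpositive for [t >= 1]; applying
    [flat 0] once more makes the result constant on both sides. *)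
Definition step (t : R) : R := 1 - expR 1 * flat 0 (1 - expR 1 * flat 0 t).

Lemma flat0_pos t : 0 < t -> flat 0 t = expR (- t^-1).
Proof. by move=> t0; rewrite /flat t0 expr0 invr1 mul1r. Qed.

Lemma flat0_neg k t : t <= 0 -> flat k t = 0.
Proof. by move=> t0; rewrite /flat ltNge t0. Qed.

Lemma step_le0 t : t <= 0 -> step t = 0.
Proof.
move=> t0; rewrite /step (flat0_neg _ t0) mulr0 subr0 flat0_pos// invr1.
by rewrite -expRD subrr expR0 subrr.
Qed.

Lemma step_ge1 t : 1 <= t -> step t = 1.
Proof.
move=> t1; have t0 : 0 < t by apply: lt_le_trans t1.
rewrite /step (flat0_pos t0) [flat 0 (1 - _)]flat0_neg ?mulr0 ?subr0//.
rewrite -expRD subr_le0 -[leLHS]expR0 ler_expR subr_ge0.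
by rewrite invf_le1.
Qed.

Definition plateau (t : R) : R := step (2 - t) * step (2 + t).

Lemma plateau1 t : `|t| <= 1 -> plateau t = 1.
Proof.
by rewrite ler_norml => /andP[h1 h2]; rewrite /plateau !step_ge1 ?mulr1//; lra.
Qed.

Lemma plateau0 t : 2 <= `|t| -> plateau t = 0.
Proof.
rewrite ler_normr => /orP[] h; rewrite /plateau.
  by rewrite [step (2 - t)]step_le0 ?mul0r//; lra.
by rewrite [step (2 + t)]step_le0 ?mulr0//; lra.
Qed.

Lemma rCk_step n : rCk n step.
Proof.
rewrite (_ : step = fun t => 1 + (- expR 1) * flat 0 (1 + (- expR 1) * flat 0 t)); last first.
  by apply/funext => t; rewrite /step !mulNr.
apply: rCkD; first exact: rCk_cst.
apply: rCkM; first exact: rCk_cst.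
apply: (rCk_comp (rCk_flat _ _)); apply: rCkD; first exact: rCk_cst.
by apply: rCkM; [exact: rCk_cst|exact: rCk_flat].
Qed.

Lemma plateau_smooth : real_smooth plateau.
Proof.
move=> n; apply: rCkM; apply: (rCk_comp (rCk_step _)); last first.
  by apply: rCkD; [exact: rCk_cst|exact: rCk_id].
rewrite (_ : (fun _ => _) = fun t => 2 + (-1) * t).
  by apply: rCkD; [exact: rCk_cst|apply: rCkM; [exact: rCk_cst|exact: rCk_id]].
by apply/funext => t; rewrite mulN1r.
Qed.

End RealSmooth.

(** * Partial derivatives and bump functions *)

Section PartialDerivatives.
Variable R : realType.
Local Notation C := (Cplx R).
Implicit Types (f g : C3 R -> C) (p : C3 R) (d : dir).

Definition dirv (d : dir) : C3 R :=
  (if d.2 then 'i%C else 1) *: delta_mx ord0 d.1.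

(** Partial derivatives as a relation, so that calculus rules compose without
    separate proofs of differentiability. *)
Definition is_pd d f p (l : C) : Prop :=
  is_derive (0 : R) (1 : R) (fun t => complex.Re (on_line f p d t)) (complex.Re l) /\
  is_derive (0 : R) (1 : R) (fun t => complex.Im (on_line f p d t)) (complex.Im l).

Lemma on_lineE f p d t : on_line f p d t = f (p + t%:C%C *: dirv d).
Proof. by rewrite /on_line /dirv scalerA. Qed.

Lemma on_line0 f p d : on_line f p d 0 = f p.
Proof. by rewrite on_lineE scale0r addr0. Qed.

Lemma is_pdP d f p l : is_pd d f p l -> pderivable d f p /\ pderive d f p = l.
Proof.
move=> [[h1 e1] [h2 e2]]; split; first by split; [exact: h1|exact: h2].
by rewrite /pderive !derive1E e1 e2; case: l {e1 e2}.
Qed.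

Lemma pderivable_is_pd d f p : pderivable d f p -> is_pd d f p (pderive d f p).
Proof.
move=> [h1 h2]; split; constructor.
- exact: h1.
- by rewrite -derive1E.
- exact: h2.
- by rewrite -derive1E.
Qed.

Lemma is_pd_to d f p l l' : is_pd d f p l -> l = l' -> is_pd d f p l'.
Proof. by move=> h <-. Qed.

Lemma is_pd_cst d (c : C) p : is_pd d (fun=> c) p 0.
Proof. by split; rewrite /on_line; exact: is_derive_cst. Qed.

Lemma is_pdD d f g p l m : is_pd d f p l -> is_pd d g p m ->
  is_pd d (fun x => f x + g x) p (l + m).
Proof.
move=> [h1 h2] [k1 k2]; split.
  by apply: (is_derive_ext (is_deriveD h1 k1)) => [t|]; rewrite /on_line cReD.
by apply: (is_derive_ext (is_deriveD h2 k2)) => [t|]; rewrite /on_line cImD.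
Qed.

Lemma cReM (x y : C) : complex.Re (x * y) =
  complex.Re x * complex.Re y - complex.Im x * complex.Im y.
Proof. by case: x y => [a b] [c d]. Qed.

Lemma cImM (x y : C) : complex.Im (x * y) =
  complex.Re x * complex.Im y + complex.Im x * complex.Re y.
Proof. by case: x y => [a b] [c d]. Qed.

Lemma is_pdM d f g p l m : is_pd d f p l -> is_pd d g p m ->
  is_pd d (fun x => f x * g x) p (l * g p + f p * m).
Proof.
move=> [h1 h2] [k1 k2]; split.
  apply: (is_derive_ext (is_deriveB (is_deriveM h1 k1) (is_deriveM h2 k2))) => [t|].
    by rewrite /on_line cReM.
  by rewrite !on_line0 cReD !cReM /GRing.scale /=; ring.
apply: (is_derive_ext (is_deriveD (is_deriveM h1 k2) (is_deriveM h2 k1))) => [t|].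
  by rewrite /on_line cImM.
by rewrite !on_line0 cImD !cImM /GRing.scale /=; ring.
Qed.

Lemma is_pdZ d f p (c l : C) : is_pd d f p l -> is_pd d (fun x => c * f x) p (c * l).
Proof.
move=> h; apply: (is_pd_to (is_pdM (is_pd_cst d c p) h)).
by rewrite mul0r add0r.
Qed.

Lemma is_pd_sum d (I : Type) (s : seq I) (F : I -> C3 R -> C) p (l : I -> C) :
  (forall i, is_pd d (F i) p (l i)) ->
  is_pd d (fun x => \sum_(i <- s) F i x) p (\sum_(i <- s) l i).
Proof.
move=> h; elim: s => [|i s IH].
  rewrite big_nil (_ : (fun _ => _) = fun=> 0); first exact: is_pd_cst.
  by apply/funext => x; rewrite big_nil.
rewrite big_cons (_ : (fun _ => _) = fun x => F i x + \sum_(i <- s) F i x).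
  exact: is_pdD.
by apply/funext => x; rewrite big_cons.
Qed.

Lemma cReJ (x : C) : complex.Re x^* = complex.Re x.
Proof. by case: x. Qed.

Lemma cImJ (x : C) : complex.Im x^* = - complex.Im x.
Proof. by case: x. Qed.

Lemma is_pdJ d f p l : is_pd d f p l -> is_pd d (fun x => (f x)^*) p l^*.
Proof.
move=> [h1 h2]; split.
  by apply: (is_derive_ext h1) => [t|]; rewrite /on_line cReJ.
by apply: (is_derive_ext (is_deriveN h2)) => [t|]; rewrite /on_line cImJ.
Qed.

Lemma cReV (x : C) : complex.Re x^-1 =
  complex.Re x * (complex.Re x ^+ 2 + complex.Im x ^+ 2)^-1.
Proof. by case: x => a b. Qed.

Lemma cImV (x : C) : complex.Im x^-1 =
  - complex.Im x * (complex.Re x ^+ 2 + complex.Im x ^+ 2)^-1.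
Proof. by case: x => a b; rewrite /= mulNr. Qed.

Lemma ReIm_NdivX (a x : C) : complex.Re x ^+ 2 + complex.Im x ^+ 2 != 0 ->
  complex.Re (- a * x^-1 ^+ 2) =
    (- complex.Re a * (complex.Re x ^+ 2 - complex.Im x ^+ 2)
     - complex.Im a * (2 * complex.Re x * complex.Im x)) * (complex.Re x ^+ 2 + complex.Im x ^+ 2) ^- 2 /\
  complex.Im (- a * x^-1 ^+ 2) =
    (complex.Re a * (2 * complex.Re x * complex.Im x)
     - complex.Im a * (complex.Re x ^+ 2 - complex.Im x ^+ 2)) * (complex.Re x ^+ 2 + complex.Im x ^+ 2) ^- 2.
Proof.
by case: a x => [a b] [x y] /= h; split; field; move: h; rewrite !expr2.
Qed.

Lemma is_pdV d f p l : f p != 0 -> is_pd d f p l ->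
  is_pd d (fun x => (f x)^-1) p (- l * (f p)^-1 ^+ 2).
Proof.
move=> fp0 [h1 h2].
pose n t := complex.Re (on_line f p d t) ^+ 2 + complex.Im (on_line f p d t) ^+ 2.
have n0 : n 0 != 0.
  by rewrite /n on_line0 -cmod_sqr expf_neq0// cmod_eq0.
have dn : is_derive (0 : R) (1 : R) n
   (2 * (complex.Re (f p) * complex.Re l + complex.Im (f p) * complex.Im l)).
  apply: (is_derive_ext (is_deriveD (is_deriveM h1 h1) (is_deriveM h2 h2))) => [//|].
  by rewrite !on_line0 /GRing.scale /=; ring.
have dV := is_deriveV n0 dn.
have npE : n 0 = complex.Re (f p) ^+ 2 + complex.Im (f p) ^+ 2 by rewrite /n on_line0.
set x := complex.Re (f p) in npE dn *; set y := complex.Im (f p) in npE dn *.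
have x2 : x ^+ 2 + y ^+ 2 != 0 by rewrite -npE.
have [e1 e2] := ReIm_NdivX l x2; rewrite -/x -/y in e1 e2.
split.
  apply: (is_derive_ext (is_deriveM h1 dV)) => [t|].
    by rewrite /on_line cReV.
  by rewrite on_line0 e1 npE /GRing.scale /= -/x -/y; field.
apply: (is_derive_ext (is_deriveM (is_deriveN h2) dV)) => [t|].
  by rewrite /on_line cImV.
have -> : (- (fun t => complex.Im (on_line f p d t))) 0 = - complex.Im (f p).
  by rewrite -[in RHS](on_line0 f p d).
by rewrite e2 npE /GRing.scale /= -/x -/y; field.
Qed.

Lemma is_pd_coord d j p : is_pd d (fun x => x ord0 j) p (dirv d ord0 j).
Proof.
have e t : on_line (fun x => x ord0 j) p d t = p ord0 j + t%:C%C * dirv d ord0 j.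
  by rewrite on_lineE !mxE.
split.
  have := is_deriveD (is_derive_cst (complex.Re (p ord0 j)) (0 : R) (1 : R))
    (is_deriveM (is_derive_id (0 : R) 1) (is_derive_cst (complex.Re (dirv d ord0 j)) (0 : R) (1 : R))).
  move=> h; apply: (is_derive_ext h) => [t|]; last first.
    by rewrite /GRing.scale /= mulr0 !add0r mulr1.
  by rewrite e cReD cReM /= mul0r subr0.
have := is_deriveD (is_derive_cst (complex.Im (p ord0 j)) (0 : R) (1 : R))
  (is_deriveM (is_derive_id (0 : R) 1) (is_derive_cst (complex.Im (dirv d ord0 j)) (0 : R) (1 : R))).
move=> h; apply: (is_derive_ext h) => [t|]; last first.
  by rewrite /GRing.scale /= mulr0 !add0r mulr1.
by rewrite e cImD cImM /= mul0r addr0.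
Qed.

(** Unlike [smooth_on], which quantifies over all sequences of directions at
    once, this is set up for induction on the order. *)
Fixpoint Ck (n : nat) f : Prop :=
  continuous f /\
  match n with
  | 0 => True
  | n'.+1 => exists df : dir -> C3 R -> C,
      (forall d p, is_pd d f p (df d p)) /\ forall d, Ck n' (df d)
  end.

Lemma Ck_continuous n f : Ck n f -> continuous f.
Proof. by case: n => [|n] []. Qed.

Lemma CkW n f : Ck n.+1 f -> Ck n f.
Proof.
elim: n f => [|n IH] f; first by case.
by move=> [cf [df [h hd]]]; split=> //; exists df; split=> // d; exact: IH.
Qed.

Lemma smooth_onP f : smooth_on setT f <-> forall n, Ck n f.
Proof.
split=> [h n|h].
  suff h' : forall m ds, Ck m (pderives ds f) by exact: (h' n [::]).
  elim=> [|m IH] ds /=; (split; first by move=> p; have [] := h ds p I).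
    exact: I.
  exists (fun d => pderive d (pderives ds f)).
  split=> [d p|d]; last exact: (IH (d :: ds)).
  by apply: pderivable_is_pd; have [_] := h ds p I; apply.
move=> ds p _; suff {p} : forall n, Ck n (pderives ds f).
  move=> hh; have [c [df [h1 _]]] := hh 1%N.
  by split=> [|d]; [exact: c|exact: (is_pdP (h1 d p)).1].
elim: ds => [//|d ds IH] n /=.
have [c [df [h1 h2]]] := IH n.+1.
suff -> : pderive d (pderives ds f) = df d by exact: h2.
by apply/funext => p; exact: (is_pdP (h1 d p)).2.
Qed.

Lemma Ck_cst n (c : C) : Ck n (fun=> c).
Proof.
elim: n c => [|n IH] c; split=> //; try by move=> x; exact: cst_continuous.
by exists (fun _ _ => 0); split=> [d p|d]; [exact: is_pd_cst|exact: IH].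
Qed.

Lemma continuous_addC f g : continuous f -> continuous g ->
  continuous (fun x => f x + g x).
Proof. by move=> cf cg x; exact: cvgD (cf x) (cg x). Qed.

Lemma continuous_mulC f g : continuous f -> continuous g ->
  continuous (fun x => f x * g x).
Proof. by move=> cf cg x; exact: cvgM (cf x) (cg x). Qed.

Lemma CkD n f g : Ck n f -> Ck n g -> Ck n (fun x => f x + g x).
Proof.
elim: n f g => [|n IH] f g [cf hf] [cg hg]; (split; first exact: continuous_addC).
  exact: I.
move: hf hg => [df [h hf]] [dg [k hg]]; exists (fun d p => df d p + dg d p).
by split=> [d p|d]; [exact: is_pdD|exact: (IH _ _ (hf d) (hg d))].
Qed.

Lemma CkM n f g : Ck n f -> Ck n g -> Ck n (fun x => f x * g x).
Proof.
elim: n f g => [|n IH] f g Hf Hg; have cf := Ck_continuous Hf;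
  have cg := Ck_continuous Hg; (split; first exact: continuous_mulC).
  exact: I.
have [_ [df [h hf]]] := Hf; have [_ [dg [k hg]]] := Hg.
exists (fun d p => df d p * g p + f p * dg d p).
split=> [d p|d]; first exact: is_pdM.
by apply: CkD; [exact: (IH _ _ (hf d) (CkW Hg))|exact: (IH _ _ (CkW Hf) (hg d))].
Qed.

Lemma smooth_onM f g : smooth_on setT f -> smooth_on setT g ->
  smooth_on setT (fun x => f x * g x).
Proof. by move=> /smooth_onP hf /smooth_onP hg; apply/smooth_onP => n; exact: CkM. Qed.

Lemma smooth_onD f g : smooth_on setT f -> smooth_on setT g ->
  smooth_on setT (fun x => f x + g x).
Proof. by move=> /smooth_onP hf /smooth_onP hg; apply/smooth_onP => n; exact: CkD. Qed.

Lemma smooth_on_cst (c : C) : smooth_on setT (fun=> c : C).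
Proof. by apply/smooth_onP => n; exact: Ck_cst. Qed.

Lemma smooth_subalgebra : subalgebra (@smooth_on R setT).
Proof. by split; [exact: smooth_on_cst|exact: smooth_onD|exact: smooth_onM]. Qed.

Lemma smooth_on_sum (I : Type) (s : seq I) (F : I -> C3 R -> C) :
  (forall i, smooth_on setT (F i)) -> smooth_on setT (fun p => \sum_(i <- s) F i p).
Proof.
by move=> h; apply: (closed_sum smooth_subalgebra) => i _; exact: h.
Qed.

Lemma smooth_on_prod (I : Type) (s : seq I) (F : I -> C3 R -> C) :
  (forall i, smooth_on setT (F i)) -> smooth_on setT (fun p => \prod_(i <- s) F i p).
Proof.
by move=> h; apply: (closed_prod smooth_subalgebra) => i _; exact: h.
Qed.

Lemma cvg_coord (j : 'I_3) p : (fun x : C3 R => x ord0 j : C) @ p --> (p ord0 j : C).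
Proof. exact: coord_continuous. Qed.

Definition rcoord (d : dir) (p : C3 R) : R :=
  if d.2 then complex.Im (p ord0 d.1) else complex.Re (p ord0 d.1).

Lemma rcoord_continuous d : continuous (rcoord d).
Proof.
move=> p; rewrite /rcoord; case: d.2.
  exact: (cvg_Im (@cvg_coord d.1 p)).
exact: (cvg_Re (@cvg_coord d.1 p)).
Qed.

Lemma is_derive_rcoord d e p :
  is_derive (0 : R) (1 : R) (fun t => rcoord d (p + t%:C%C *: dirv e)) (rcoord d (dirv e)).
Proof.
have [h1 h2] := is_pd_coord e d.1 p; rewrite /rcoord; case: d.2.
  by apply: (is_derive_ext h2) => [t|//]; rewrite on_lineE.
by apply: (is_derive_ext h1) => [t|//]; rewrite on_lineE.
Qed.

Lemma continuous_rcoord (b : R -> R) d : continuous b ->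
  continuous (fun p => (b (rcoord d p))%:C%C : C).
Proof.
move=> cb p.
have h : {for p, continuous (b \o rcoord d)}.
  by apply: continuous_comp; [exact: rcoord_continuous|exact: cb].
exact: (cvg_RtoC h).
Qed.

Lemma Ck_rcoord n (b : R -> R) d : rCk n b -> Ck n (fun p => (b (rcoord d p))%:C%C).
Proof.
elim: n b => [|n IH] b hb; have cb := rCk_continuous hb; (split;
  first exact: continuous_rcoord).
  exact: I.
have [b' [h hb']] := hb.
exists (fun e p => (b' (rcoord d p))%:C%C * (rcoord d (dirv e))%:C%C).
split=> [e p|e]; last by apply: CkM; [exact: (IH _ hb')|exact: Ck_cst].
split; rewrite ?cReM ?cImM /= ?mulr0 ?mul0r ?subr0 ?addr0.
  have e0 : p + (0 : R)%:C%C *: dirv e = p by rewrite scale0r addr0.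
  have hp : is_derive (rcoord d (p + (0 : R)%:C%C *: dirv e)) 1 b (b' (rcoord d p)).
    by rewrite e0; exact: h.
  apply: (is_derive_ext (is_derive1_comp hp (is_derive_rcoord d e p))) => [t|//].
  by rewrite /= /dirv scalerA.
exact: is_derive_cst.
Qed.

Definition cube (c : dir -> R) (e : R) : set (C3 R) :=
  [set p | forall d, `|rcoord d p - c d| < e].

Definition cube_bump (c : dir -> R) (e : R) (p : C3 R) : C :=
  \prod_(d : dir) (plateau ((rcoord d p - c d) / e))%:C%C.

Lemma cube_bump_smooth c e : smooth_on setT (cube_bump c e).
Proof.
apply: smooth_on_prod => d; apply/smooth_onP => n.
apply: (@Ck_rcoord n (fun t => plateau ((t - c d) / e)) d).
apply: (rCk_comp (@plateau_smooth R n)); apply: rCkM; last exact: rCk_cst.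
by apply: rCkD; [exact: rCk_id|exact: rCk_cst].
Qed.

Lemma cube_bump1 c e p : 0 < e -> cube c e p -> cube_bump c e p = 1.
Proof.
move=> e0 h; rewrite /cube_bump big1// => d _; rewrite plateau1//.
by rewrite normrM normfV (gtr0_norm e0) ler_pdivrMr// mul1r ltW.
Qed.

Lemma cube_bump_neq0 c e p : 0 < e -> cube_bump c e p != 0 -> cube c (2 * e) p.
Proof.
move=> e0 h d; rewrite ltNge; apply/negP => hd; move/eqP: h; apply.
rewrite /cube_bump (bigD1 d)//= plateau0 ?mul0r//.
by rewrite normrM normfV (gtr0_norm e0) ler_pdivlMr.
Qed.

End PartialDerivatives.

(** * Convergence of integrals with small tails *)

Section Vitali.
Context d (T : measurableType d) (R : realType).
Variable mu : {measure set T -> \bar R}.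
Variables (D : set T) (mD : measurable D) (muD : (mu D < +oo)%E).
Implicit Types f : T -> R.

Definition clamp (N x : R) : R := Num.max (- N) (Num.min N x).

Lemma normr_clamp N x : 0 <= N -> `|clamp N x| <= N.
Proof.
move=> N0; rewrite /clamp ler_norml le_max lexx /= ge_max ge_min lexx andbT.
by rewrite (le_trans _ N0)// oppr_le0.
Qed.

Lemma clampB_le N x : 0 <= N -> `|x - clamp N x| <= if N < `|x| then `|x| else 0.
Proof.
move=> N0; rewrite /clamp.
have [hx|hx] := leP `|x| N.
  move: hx; rewrite ler_norml => /andP[h1 h2].
  by rewrite (min_idPr h2) (max_idPr h1) subrr normr0.
have [x0|x0] := leP 0 x.
  rewrite ger0_norm// in hx *.
  rewrite (min_idPl (ltW hx)); have /max_idPr -> : - N <= N by lra.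
  by rewrite ger0_norm; lra.
rewrite ltr0_norm// in hx *.
have /min_idPr -> : x <= N by lra.
have /max_idPl -> : x <= - N by lra.
by rewrite ler0_norm; lra.
Qed.

Lemma measurable_clamp N f : measurable_fun D f -> measurable_fun D (fun x => clamp N (f x)).
Proof.
by move=> mf; apply: measurable_maxr => //; apply: measurable_minr.
Qed.

Lemma cvg_clamp (F : set_system nat) {FF : Filter F} N (u : nat -> R) l :
  u n @[n --> F] --> l -> clamp N (u n) @[n --> F] --> clamp N l.
Proof.
move=> h.
have c : continuous (clamp N).
  move=> x; apply: (@continuous_max _ _ (fun=> - N) (fun y => Num.min N y)).
    exact: cvg_cst.
  by apply: (@continuous_min _ _ (fun=> N) id); [exact: cvg_cst|exact: cvg_id].
exact: continuous_cvg (c l) h.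
Qed.

(** Uniform integrability of a family is expressed by a common pair [N], [e].
    *)
Definition uniform_tail (f : T -> R) (N e : R) :=
  (\int[mu]_(x in D) (`|f x - clamp N (f x)|)%:E <= e%:E)%E.

Lemma integrable_bounded f (M : R) : measurable_fun D f ->
  (forall x, D x -> `|f x| <= M) -> mu.-integrable D (EFin \o f).
Proof.
move=> mf h; apply: measurable_bounded_integrable => //.
by exists M; split; [exact: num_real|move=> x Mx y Dy /=; apply: (le_trans (h y Dy)); exact: ltW].
Qed.

Lemma tail_integrable f N e : 0 <= N -> measurable_fun D f -> uniform_tail f N e ->
  [/\ mu.-integrable D (EFin \o f),
      mu.-integrable D (EFin \o (fun x => clamp N (f x))) &
      `|Rintegral mu D f - Rintegral mu D (fun x => clamp N (f x))| <= e].
Proof.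
move=> N0 mf ut.
have ic : mu.-integrable D (EFin \o (fun x => clamp N (f x))).
  apply: (@integrable_bounded _ N); first exact: measurable_clamp.
  by move=> x _; exact: normr_clamp.
have mr : measurable_fun D (fun x => f x - clamp N (f x)).
  by apply: measurable_funB => //; exact: measurable_clamp.
have ir : mu.-integrable D (EFin \o (fun x => f x - clamp N (f x))).
  apply/integrableP; split; first exact/measurable_EFinP.
  by apply: le_lt_trans ut _; rewrite ltry.
have if_ : mu.-integrable D (EFin \o f).
  apply: (@eq_integrable _ _ _ _ _ mD
    (fun x => (clamp N (f x))%:E + (f x - clamp N (f x))%:E)%E).
    by move=> x _ /=; rewrite -EFinD addrC subrK.
  exact: integrableD.
split=> //.
rewrite -RintegralB//; apply: (le_trans (le_normr_Rintegral _ _)) => //.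
rewrite -lee_fin; apply: le_trans ut.
rewrite /Rintegral fineK//.
have := integrable_norm ir => /integrable_fin_num; exact.
Qed.

(** The clamped functions are bounded by [N] on a set of finite measure, where
    dominated convergence applies, and clamping changes each integral by at
    most [e]. *)
Lemma vitali_cvg (f_ : nat -> T -> R) f :
  (forall n, measurable_fun D (f_ n)) -> measurable_fun D f ->
  {ae mu, forall x, D x -> f_ n x @[n --> \oo] --> f x} ->
  (forall e, 0 < e -> exists2 N, 0 <= N &
    (forall n, uniform_tail (f_ n) N e) /\ uniform_tail f N e) ->
  Rintegral mu D (f_ n) @[n --> \oo] --> Rintegral mu D f.
Proof.
move=> mf_ mf aef tails; apply/cvgrPdist_lt => e e0.
have e4 : 0 < e / 4 by rewrite divr_gt0.
have [N N0 [t_ t]] := tails _ e4.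
have [_ ic d1] := tail_integrable N0 mf t.
have : Rintegral mu D (fun x => clamp N (f_ n x)) @[n --> \oo] -->
    Rintegral mu D (fun x => clamp N (f x)).
  have [] := @dominated_convergence _ T R mu D mD
    (fun n x => (clamp N (f_ n x))%:E) (fun x => (clamp N (f x))%:E) (fun=> N%:E).
  - by move=> n; apply/measurable_EFinP; exact: measurable_clamp.
  - by apply/measurable_EFinP; exact: measurable_clamp.
  - apply: filterS aef => x h Dx; apply: cvg_EFin; first by apply: nearW.
    exact: (cvg_clamp (h Dx)).
  - by apply: (@integrable_bounded (fun=> N) N) => // x _; rewrite ger0_norm.
  - by apply: aeW => x n Dx; rewrite /= lee_fin normr_clamp.
  move=> _ _ h.
  apply: fine_cvg; rewrite /Rintegral fineK//.
  exact: (integrable_fin_num mD ic).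
move=> /cvgrPdist_lt /(_ _ e4); apply: filterS => n dn.
have [_ _ d2] := tail_integrable N0 (mf_ n) (t_ n).
move: d1 d2 dn; set a := Rintegral _ _ _; set b := Rintegral _ _ _.
set c := Rintegral _ _ _; set a' := Rintegral _ _ _ => d1 d2 d3.
move: d1 d2 d3; rewrite !ler_distl !ltr_distl => /andP[? ?] /andP[? ?] /andP[? ?].
by apply/andP; split; lra.
Qed.

End Vitali.

(** * Lebesgue measure on the four-dimensional space *)

Section FourSpace.
Variable R : realType.
Local Notation M1 := (measurableTypeR R).
Local Notation M4 := ((M1 * M1) * (M1 * M1))%type.
Local Notation mu4 := (@leb2 R \x @leb2 R)%E.

Definition box (c : R4 R) (e : R) : set (R4 R) :=
  [set w | [/\ `|c.1.1 - w.1.1| < e, `|c.1.2 - w.1.2| < e,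
               `|c.2.1 - w.2.1| < e & `|c.2.2 - w.2.2| < e]].

Lemma boxE c e : box c e =
  ((ball c.1.1 e `*` ball c.1.2 e) `*` (ball c.2.1 e `*` ball c.2.2 e)).
Proof.
apply/seteqP; split => -[[a b] [a' b']] /=.
  by move=> [h1 h2 h3 h4]; split; split; rewrite -ball_normE.
by move=> [[h1 h2] [h3 h4]]; split; move: h1 h2 h3 h4; rewrite -ball_normE.
Qed.

Lemma measurable_box c e : measurable (box c e : set M4).
Proof.
rewrite boxE; apply: measurableX; apply: measurableX; exact: measurable_ball.
Qed.

Lemma mu4X (A B : set (M1 * M1)) : measurable A -> measurable B ->
  mu4 (A `*` B) = (@leb2 R A * @leb2 R B)%E.
Proof.
exact: (@product_measure1E _ _ (M1 * M1)%type (M1 * M1)%type R (@leb2 R) (@leb2 R)).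
Qed.

Lemma leb2X (A B : set M1) : measurable A -> measurable B ->
  @leb2 R (A `*` B) = (@lebesgue_measure R A * @lebesgue_measure R B)%E.
Proof.
exact: (@product_measure1E _ _ M1 M1 R (@lebesgue_measure R) (@lebesgue_measure R)).
Qed.

Lemma measure_box c e : 0 <= e -> mu4 (box c e) = ((e *+ 2) ^+ 4)%:E.
Proof.
move=> e0; rewrite boxE.
have mb (x : R) : measurable (ball x e : set M1) by exact: measurable_ball.
rewrite mu4X; [|exact: measurableX|exact: measurableX].
rewrite !leb2X// !lebesgue_measure_ball// -!EFinM.
by rewrite !exprS expr0 mulr1 !mulrA.
Qed.

Lemma open_box (A : set (R4 R)) w : open A -> A w ->
  exists2 e, 0 < e & box w e `<=` A.
Proof.
move=> oA Aw; have : nbhs w A by exact: open_nbhs_nbhs.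
move=> /nbhs_ballP[e /= e0 h]; exists e => // y; rewrite boxE => hy; apply: h.
exact: hy.
Qed.

Definition ratbox (i : (rat * rat) * (rat * rat) * rat) : set (R4 R) :=
  box ((ratr i.1.1.1, ratr i.1.1.2), (ratr i.1.2.1, ratr i.1.2.2)) (ratr i.2).

Lemma rat_near (x e : R) : 0 < e -> exists q, `|ratr q - x| < e.
Proof.
move=> e0; have /rat_in_itvoo[q] : x - e < x + e by lra.
by rewrite in_itv /= => /andP[? ?]; exists q; rewrite ltr_distl; apply/andP; split; lra.
Qed.

(** Open sets are countable unions of boxes, hence measurable for the product
    sigma-algebra, which is generated by rectangles. *)
Lemma open_bigcup_ratbox (A : set (R4 R)) : open A ->
  A = \bigcup_i (if `[< ratbox i `<=` A >] then ratbox i else set0).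
Proof.
move=> oA; apply/seteqP; split=> [w Aw|w [i _]]; last by case: asboolP => // h; exact: h.
have [e e0 he] := open_box oA Aw.
have e4 : 0 < e / 4 by lra.
have /rat_in_itvoo[r] : e / 4 < e / 2 by lra.
rewrite in_itv /= => /andP[r1 r2].
have [q1 h1] := rat_near w.1.1 e4; have [q2 h2] := rat_near w.1.2 e4.
have [q3 h3] := rat_near w.2.1 e4; have [q4 h4] := rat_near w.2.2 e4.
have tri (a b c : R) : `|a - b| < e / 4 -> `|a - c| < ratr r -> `|b - c| < e.
  by rewrite !ltr_distl => /andP[? ?] /andP[? ?]; apply/andP; split; lra.
exists ((q1, q2), (q3, q4), r) => //; case: asboolP => [_|[]].
  by rewrite /ratbox; split=> /=; exact: lt_trans r1.
move=> y [/= k1 k2 k3 k4]; apply: he; split.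
- exact: tri h1 k1.
- exact: tri h2 k2.
- exact: tri h3 k3.
- exact: tri h4 k4.
Qed.

Lemma open_measurable4 (A : set (R4 R)) : open A -> measurable (A : set M4).
Proof.
move=> /open_bigcup_ratbox ->; apply: countable_bigcupT_measurable => // i.
case: asboolP => _; last exact: measurable0.
exact: measurable_box.
Qed.

Lemma continuous_measurable4 (D : set (R4 R)) (f : R4 R -> R) : open D ->
  (forall w, D w -> {for w, continuous f}) -> measurable_fun (D : set M4) f.
Proof.
move=> oD cf; apply: (measurability _ (RGenOpens.measurableE R)).
move=> _ [_ [a [b ->] <-]]; apply: open_measurable4.
rewrite openE => w [Dw fw]; apply: filterI; first exact: open_nbhs_nbhs.
apply: (cf _ Dw); apply: open_nbhs_nbhs; split=> //.
Qed.

Lemma measure_point (w : R4 R) : measurable ([set w] : set M4) /\ mu4 [set w] = 0%E.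
Proof.
have -> : [set w] = ([set w.1.1] `*` [set w.1.2]) `*` ([set w.2.1] `*` [set w.2.2]).
  apply/seteqP; split=> [_ ->|[[a b] [c d]]] //= [[-> ->] [-> ->]].
  by case: w => -[? ?] [? ?].
split; first by apply: measurableX; apply: measurableX; exact: measurable_set1.
rewrite mu4X; [|by apply: measurableX; exact: measurable_set1..].
rewrite leb2X; [|exact: measurable_set1..].
by rewrite lebesgue_measure_set1 !mul0e.
Qed.

(** The balls of the sup norm are the boxes, whose measure is explicit. *)
Definition mnorm (w : R4 R) : R :=
  Num.max (Num.max `|w.1.1| `|w.1.2|) (Num.max `|w.2.1| `|w.2.2|).

Lemma mnorm_lt (c w : R4 R) e : mnorm (c - w) < e -> box c e w.
Proof.
rewrite /mnorm !gt_max => /andP[/andP[? ?] /andP[? ?]].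
by split.
Qed.

Lemma mnorm_ge0 w : 0 <= mnorm w.
Proof. by rewrite /mnorm !le_max normr_ge0. Qed.

Lemma mnorm_eq0 w : mnorm w = 0 -> w = 0.
Proof.
move=> h; have : mnorm w <= 0 by rewrite h.
rewrite /mnorm !ge_max !normr_le0 => /andP[/andP[/eqP h1 /eqP h2] /andP[/eqP h3 /eqP h4]].
by case: w h1 h2 h3 h4 {h} => -[a b] [c d] /= -> -> -> ->.
Qed.

(** A majorant of the inverse cube of the distance to [c]: on the shell [2 ^-
    k.+1 <= mnorm (c - w) < 2 ^- k] the inverse cube is at most [8 ^+ k.+1],
    and the boxes have measure [16 * 16 ^- k], so that the integrals form a
    geometric series. *)
Definition dyadic (K : nat) (c w : R4 R) : \bar R :=
  (\sum_(k <oo) ((8 ^+ (K + k).+1)%:E * (\1_(box c (2 ^- (K + k))) w)%:E))%E.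

Lemma dyadic_ge0 K c w : (0 <= dyadic K c w)%E.
Proof. by apply: nneseries_ge0 => k _ _; rewrite mule_ge0// lee_fin// exprn_ge0. Qed.

Lemma measurable_dyadic K c (D : set M4) : measurable D -> measurable_fun D (dyadic K c).
Proof.
move=> mD; apply: ge0_emeasurable_sum => [k w _ _|k _].
  by rewrite mule_ge0// lee_fin// exprn_ge0.
apply: emeasurable_funM; first exact: measurable_cst.
by apply/measurable_EFinP/measurable_indic; exact: measurable_box.
Qed.

Lemma dyadic_scale (x : R) : 0 < x -> x < 1 ->
  exists k, 2 ^- k.+1 <= x /\ x < 2 ^- k :> R.
Proof.
move=> x0 x1.
have ex : exists n, 2 ^- n.+1 <= x :> R.
  have [n hn] : exists n : nat, x^-1 < n%:R.
    by exists (Num.truncn x^-1).+1; exact: truncnS_gt.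
  exists n; rewrite -[leRHS]invrK lef_pV2 ?posrE ?exprn_gt0 ?invr_gt0//.
  apply: (le_trans (ltW hn)); rewrite -natrX ler_nat.
  by apply: (leq_trans (ltnW (ltn_expl n (isT : 1 < 2)%N))); rewrite leq_exp2l.
exists (ex_minn ex); case: ex_minnP => -[|m] hm hmin; split=> //.
  by rewrite expr0 invr1.
rewrite ltNge; apply/negP => /hmin.
by rewrite ltnn.
Qed.

Lemma dyadic_le K c w : w != c -> mnorm (c - w) < 2 ^- K ->
  (((mnorm (c - w)) ^- 3)%:E <= dyadic K c w)%E.
Proof.
move=> wc mK; set x := mnorm (c - w) in mK *.
have x0 : 0 < x.
  rewrite lt_neqAle mnorm_ge0 andbT eq_sym; apply: contra wc => /eqP/mnorm_eq0/eqP.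
  by rewrite subr_eq0 eq_sym.
have x1 : x < 1.
  by apply: (lt_le_trans mK); rewrite invf_le1 ?exprn_gt0// exprn_ege1// ler1n.
have [k [k1 k2]] := dyadic_scale x0 x1.
have Kk : (K <= k)%N.
  rewrite leqNgt; apply/negP => kK.
  suff : 2 ^- K <= (2 ^- k.+1 : R) by move=> h; have := lt_le_trans mK (le_trans h k1); rewrite ltxx.
  by rewrite lef_pV2 ?posrE ?exprn_gt0// ler_eXn2l// ltr1n.
apply: (@le_trans _ _ ((8 ^+ (K + (k - K)).+1)%:E * (\1_(box c (2 ^- (K + (k - K)))) w)%:E)%E).
  rewrite subnKC// indicE mem_set ?mule1; last exact: mnorm_lt.
  rewrite lee_fin -[leRHS]invrK lef_pV2 ?posrE ?exprn_gt0 ?invr_gt0 ?exprn_gt0//.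
  have -> : (8 ^+ k.+1)^-1 = (2 ^- k.+1) ^+ 3 :> R.
    by rewrite exprVn -exprM mulnC exprM; congr (_ ^- _); rewrite -natrX.
  by rewrite ler_pXn2r// nnegrE ?invr_ge0 ?exprn_ge0// ltW.
set u := fun k : nat => ((8 ^+ (K + k).+1)%:E * (\1_(box c (2 ^- (K + k))) w)%:E)%E : \bar R.
have u0 n : (0 <= u n)%E by rewrite mule_ge0// lee_fin// exprn_ge0.
apply: le_trans (nneseries_lim_ge (k - K).+1 (fun n _ _ => u0 n)).
rewrite big_nat_recr//= leeDr//.
by apply: sume_ge0.
Qed.

Lemma integral_dyadic K c (D : set M4) : measurable D ->
  (\int[mu4]_(w in D) dyadic K c w <= (256 / 2 ^+ K)%:E)%E.
Proof.
move=> mD; rewrite /dyadic integral_nneseries//; last first.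
  move=> k; apply: emeasurable_funM; first exact: measurable_cst.
  by apply/measurable_EFinP/measurable_indic; exact: measurable_box.
apply: lime_le.
  by apply: is_cvg_nneseries => k _ _; apply: integral_ge0 => w _; rewrite mule_ge0// lee_fin// exprn_ge0.
apply: nearW => n.
have Q0 : 0 <= 256 / 2 ^+ K :> R by apply: divr_ge0; [exact: ler0n|exact: exprn_ge0].
apply: (@le_trans _ _ (256 / 2 ^+ K * (1 - 2 ^- n))%:E); last first.
  rewrite lee_fin; apply: ler_piMr; first exact: Q0.
  by rewrite lerBlDr lerDl invr_ge0 exprn_ge0.
elim: n => [|n IH]; first by rewrite big_geq ?leqnn ?expr0 ?invr1 ?subrr ?mulr0 ?lexx.
rewrite big_nat_recr//=; apply: (le_trans (leeD IH (_ : _ <= (128 * 2 ^- (K + n))%:E)%E)).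
  rewrite ge0_integralZl//; last first.
    by apply/measurable_EFinP/measurable_indic; exact: measurable_box.
  rewrite integral_indic//; last exact: measurable_box.
  have -> : 128 * 2 ^- (K + n) = 8 ^+ (K + n).+1 * ((2 ^- (K + n) *+ 2) ^+ 4) :> R.
    rewrite -[X in X ^+ 4]mulr_natr; set m := (K + n)%N.
    have -> : 8 ^+ m.+1 = 8 * (2 ^+ m) ^+ 3 :> R.
      by rewrite exprS; congr (_ * _); rewrite -exprM mulnC exprM; congr (_ ^+ _); rewrite -natrX.
    have : 2 ^+ m != 0 :> R by rewrite expf_neq0// pnatr_eq0.
    by move: (2 ^+ m) => y y0; field.
  rewrite EFinM lee_pmul2l//.
  have e0 : 0 <= 2 ^- (K + n) :> R by rewrite invr_ge0 exprn_ge0.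
  have mb := measure_box c e0; rewrite -mb {mb}.
  apply: le_measure; rewrite ?inE.
  - by apply: measurableI => //; exact: measurable_box.
  - exact: measurable_box.
  - by move=> ? [].
rewrite -EFinD lee_fin exprD exprS.
have : 0 < 2 ^+ K :> R by rewrite exprn_gt0.
have : 0 < 2 ^+ n :> R by rewrite exprn_gt0.
move: (2 ^+ K) (2 ^+ n) => a b b0 a0; rewrite le_eqVlt; apply/orP; left; apply/eqP; field.
by rewrite !gt_eqF.
Qed.

End FourSpace.

(** * Weakly singular integrals *)

Section WeaklySingular.
Variable R : realType.
Local Notation M1 := (measurableTypeR R).
Local Notation M4 := ((M1 * M1) * (M1 * M1))%type.
Local Notation mu4 := (@leb2 R \x @leb2 R)%E.

(** The pull-back of the kernel is singular over both preimages [c] and [- c]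
    of a point of [Z]. *)
Definition inv_cubes (c w : R4 R) : R := mnorm (c - w) ^- 3 + mnorm (- c - w) ^- 3.

Definition weakly_singular (D : set (R4 R)) (M : R) (c : R4 R) (f : R4 R -> R) : Prop :=
  forall w, D w -> w != c -> w != - c -> `|f w| <= M * inv_cubes c w.

Lemma ae_neq (c : R4 R) : {ae mu4, forall w : M4, w != c}.
Proof.
have [mc c0] := measure_point c.
exists [set c]; split=> //= w /= /negP; rewrite negbK => /eqP.
by [].
Qed.

(** Where [|f|] exceeds [2 * M * 8 ^+ K], one of the two inverse cubes exceeds
    [8 ^+ K], so that [w] is at distance less than [2 ^- K] from [c] or [- c],
    where the dyadic majorants apply. *)
Lemma weak_tail (D : set M4) M c (f : M4 -> R) K : measurable D -> 0 <= M ->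
  measurable_fun D f -> weakly_singular D M c f ->
  uniform_tail mu4 D f (2 * M * 8 ^+ K) (4 * M * (256 / 2 ^+ K)).
Proof.
move=> mD M0 mf wf; rewrite /uniform_tail.
have N0 : 0 <= 2 * M * 8 ^+ K by rewrite mulr_ge0 ?exprn_ge0// mulr_ge0.
pose g w := ((2 * M)%:E * (dyadic K c w + dyadic K (- c)%R w))%E.
have M20 : 0 <= 2 * M by rewrite mulr_ge0.
have dd0 w : (0 <= dyadic K c w + dyadic K (- c)%R w)%E by rewrite adde_ge0 ?dyadic_ge0.
have mdd : measurable_fun D (fun w => dyadic K c w + dyadic K (- c)%R w)%E.
  by apply: emeasurable_funD; exact: measurable_dyadic.
apply: (@le_trans _ _ (\int[mu4]_(w in D) g w)%E).
  apply: ae_ge0_le_integral; first exact: mD.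
  - by move=> w _; rewrite lee_fin.
  - apply/measurable_EFinP; apply: measurableT_comp => //.
    by apply: measurable_funB => //; exact: measurable_clamp.
  - by move=> w _; rewrite mule_ge0.
  - by apply: emeasurable_funM => //; exact: measurable_cst.
  have [n1 sqnorm] := (ae_neq c, ae_neq (- c)).
  apply: filterS2 n1 sqnorm => w wc wc' Dw.
  have := clampB_le (f w) N0; case: ifPn => [fN|_] h; last first.
    by apply: (@le_trans _ _ 0%:E); [rewrite lee_fin|rewrite mule_ge0].
  apply: (@le_trans _ _ (`|f w|)%:E); first by rewrite lee_fin.
  have := wf _ Dw wc wc'; rewrite /inv_cubes.
  set x := mnorm (c - w); set y := mnorm (- c - w) => hf.
  have key (a b : R4 R) : w != a -> mnorm (a - w) ^- 3 >= mnorm (b - w) ^- 3 ->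
      `|f w| <= M * (mnorm (a - w) ^- 3 + mnorm (b - w) ^- 3) ->
      ((`|f w|)%:E <= (2 * M)%:E * dyadic K a w)%E.
    move=> wa; set p := mnorm (a - w) ^- 3; set q := mnorm (b - w) ^- 3 => qp hf'.
    have fp : `|f w| <= 2 * M * p.
      apply: (le_trans hf'); rewrite -mulrA mulrCA ler_wpM2l//.
      have -> : 2 * p = p + p by ring.
      by rewrite lerD2l.
    apply: (@le_trans _ _ ((2 * M)%:E * p%:E)%E).
      by rewrite -EFinM lee_fin.
    rewrite lee_wpmul2l// ?lee_fin//; apply: dyadic_le => //.
    have hp : 8 ^+ K < p.
      have := lt_le_trans fN fp; have [M00|Mp] := eqVneq M 0.
        by rewrite M00 mulr0 !mul0r ltxx.
      by rewrite ltr_pM2l// mulr_gt0// lt_neqAle eq_sym Mp.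
    rewrite ltNge; apply/negP => mge.
    have : p <= 8 ^+ K.
      rewrite /p -[leRHS]invrK lef_pV2 ?posrE ?invr_gt0 ?exprn_gt0//; last first.
        by apply: lt_le_trans mge; rewrite invr_gt0 exprn_gt0.
      have -> : (8 ^+ K)^-1 = (2 ^- K) ^+ 3 :> R.
        by rewrite exprVn -exprM mulnC exprM; congr (_ ^- _); rewrite -natrX.
      by rewrite ler_pXn2r// nnegrE ?mnorm_ge0 ?invr_ge0 ?exprn_ge0.
    by move/(lt_le_trans hp); rewrite ltxx.
  have [xy|xy] := leP (x ^- 3) (y ^- 3).
    apply: (le_trans (key (- c) c wc' xy _)); first by rewrite addrC.
    by rewrite lee_wpmul2l ?lee_fin// leeDr// dyadic_ge0.
  apply: (le_trans (key c (- c) wc (ltW xy) _)); first by [].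
  by rewrite lee_wpmul2l ?lee_fin// leeDl// dyadic_ge0.
rewrite /g ge0_integralZl//.
rewrite ge0_integralD//; last first.
- exact: measurable_dyadic.
- by move=> w _; exact: dyadic_ge0.
- exact: measurable_dyadic.
- by move=> w _; exact: dyadic_ge0.
have -> : 4 * M * (256 / 2 ^+ K) = 2 * M * (256 / 2 ^+ K + 256 / 2 ^+ K) by ring.
rewrite [leRHS]EFinM; apply: lee_wpmul2l; first by rewrite lee_fin.
rewrite EFinD.
by apply: leeD; exact: integral_dyadic.
Qed.

(** The bound of [weak_tail] does not depend on the centre, so that the tails
    are uniformly small along the whole sequence. *)
Lemma weakly_singular_cvg (D : set M4) M (c_ : nat -> R4 R) c
    (f_ : nat -> M4 -> R) (f : M4 -> R) :
  measurable D -> (mu4 D < +oo)%E -> 0 <= M ->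
  (forall n, measurable_fun D (f_ n)) -> measurable_fun D f ->
  (forall n, weakly_singular D M (c_ n) (f_ n)) -> weakly_singular D M c f ->
  (forall w, D w -> w != c -> w != - c -> f_ n w @[n --> \oo] --> f w) ->
  Rintegral mu4 D (f_ n) @[n --> \oo] --> Rintegral mu4 D f.
Proof.
move=> mD fD M0 mf_ mf wf_ wf h; apply: vitali_cvg => //.
  have [n1 sqnorm] := (ae_neq c, ae_neq (- c)).
  by apply: filterS2 n1 sqnorm => w wc wc' Dw; exact: h.
move=> e e0.
have [K hK] : exists K : nat, 4 * M * (256 / 2 ^+ K) <= e.
  have [k h1] : exists k : nat, 1024 * M / e < k%:R.
    by exists (Num.truncn (1024 * M / e)).+1; exact: truncnS_gt.
  exists k.
  have h2 : k%:R <= 2 ^+ k :> R.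
    by rewrite -natrX ler_nat ltnW// ltn_expl.
  have -> : 4 * M * (256 / 2 ^+ k) = 1024 * M / 2 ^+ k by ring.
  rewrite ler_pdivrMr ?exprn_gt0//; apply: (@le_trans _ _ (e * k%:R)).
    by rewrite [e * _]mulrC -ler_pdivrMr// ltW.
  by rewrite ler_wpM2l// ltW.
exists (2 * M * 8 ^+ K); first by rewrite mulr_ge0 ?exprn_ge0// mulr_ge0.
split=> [n|]; (apply: le_trans (weak_tail K mD M0 _ _) _; last by rewrite lee_fin).
- exact: mf_.
- exact: wf_.
- exact: mf.
- exact: wf.
Qed.

End WeaklySingular.

(** * The kernel with its derivatives carried out *)

Section KernelFormula.
Variable R : realType.
Local Notation C := (Cplx R).
Local Notation N12 := ((3 + 3) + (3 + 3))%N.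
Implicit Types (p q zeta z e : C3 R).
Local Opaque scal wedge.

Definition sqnorm p : R := \sum_(j < 3) cmod (p ord0 j) ^+ 2.

Lemma sqnorm_ge0 p : 0 <= sqnorm p.
Proof. by apply: sumr_ge0 => j _; exact: sqr_ge0. Qed.

Lemma norm2E p : norm2 p = (sqnorm p)%:C%C.
Proof.
rewrite /norm2 /sqnorm rmorph_sum; apply: eq_bigr => j _.
by rewrite rmorphXn cmodE.
Qed.

Lemma norm2_conj p : norm2 p = \sum_(j < 3) p ord0 j * (p ord0 j)^*.
Proof. by apply: eq_bigr => j _; rewrite normCK. Qed.

Lemma coord_le_sqnorm p j : cmod (p ord0 j) ^+ 2 <= sqnorm p.
Proof.
by rewrite /sqnorm (bigD1 j)//= lerDl; apply: sumr_ge0 => k _; exact: sqr_ge0.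
Qed.

Lemma sqnorm_eq0 p : (sqnorm p == 0) = (p == 0).
Proof.
apply/eqP/eqP => [h|->]; last first.
  by rewrite /sqnorm big1// => j _; rewrite mxE cmod0 expr0n.
apply/rowP => j; rewrite mxE; apply/eqP; rewrite -cmod_eq0 -sqrf_eq0.
by rewrite eq_le sqr_ge0 andbT -h coord_le_sqnorm.
Qed.

Lemma sqnorm_gt0 p : (0 < sqnorm p) = (p != 0).
Proof. by rewrite lt_neqAle sqnorm_ge0 andbT eq_sym sqnorm_eq0. Qed.

Lemma norm2_neq0 p : p != 0 -> norm2 p != 0.
Proof. by move=> p0; rewrite norm2E -cmod_eq0 cmod_real normr_eq0 sqnorm_eq0. Qed.

Lemma BE r p : B r p <-> sqnorm p < r ^+ 2.
Proof. by rewrite /B /= norm2E ltcR. Qed.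

Lemma closedBE r p : closedB r p <-> sqnorm p <= r ^+ 2.
Proof. by rewrite /closedB /= norm2E lecR. Qed.

Definition len p : R := Num.sqrt (sqnorm p).

Lemma len_ge0 p : 0 <= len p.
Proof. exact: sqrtr_ge0. Qed.

Lemma len_sqr p : len p ^+ 2 = sqnorm p.
Proof. by rewrite sqr_sqrtr// sqnorm_ge0. Qed.

Lemma len_gt0 p : (0 < len p) = (p != 0).
Proof. by rewrite sqrtr_gt0 sqnorm_gt0. Qed.

Lemma coord_le_len p j : cmod (p ord0 j) <= len p.
Proof.
by rewrite -(@ler_pXn2r _ 2) ?nnegrE ?cmod_ge0 ?len_ge0// len_sqr coord_le_sqnorm.
Qed.

Lemma twopii_neq0 : twopii R != 0.
Proof.
have h2 : (2 : C) != 0 by rewrite pnatr_eq0.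
have hpi : ((pi : R)%:C%C : C) != 0.
  by rewrite -cmod_eq0 cmod_real normr_eq0 gt_eqF// pi_gt0.
have hi : ('i%C : C) != 0 by apply/eqP => -[/eqP]; rewrite oner_eq0.
exact: mulf_neq0 (mulf_neq0 h2 hpi) hi.
Qed.

(** The numerators of [s] and [sigma]. *)
Definition cform p : ext R N12 := \sum_(j < 3) scal (p ord0 j)^* (deta R j).

Lemma sE zeta z : s zeta z = scal (twopii R * norm2 (zeta - z))^-1 (cform (zeta - z)).
Proof. by congr (scal _ _); apply: eq_bigr => j _; rewrite /eta !mxE. Qed.

(** The derivative of [s] in a direction along which [eta] moves by [e]. *)
Definition ds (eta e : C3 R) : ext R N12 :=
  scal (- (twopii R * \sum_(j < 3) (e ord0 j * (eta ord0 j)^* + eta ord0 j * (e ord0 j)^*))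
     * (twopii R * norm2 eta)^-1 ^+ 2) (cform eta)
  + scal (twopii R * norm2 eta)^-1 (cform e).

Lemma is_pd_cform (f : C3 R -> C3 R) d p e S :
  (forall j, is_pd d (fun x => f x ord0 j) p (e ord0 j)) ->
  is_pd d (fun x => cform (f x) S) p (cform e S).
Proof.
move=> h; rewrite /cform.
have -> : (fun x => (\sum_(j < 3) scal (f x ord0 j)^* (deta R j)) S) =
   (fun x => \sum_(j < 3) (deta R j S * (f x ord0 j)^*)).
  by apply/funext => x; rewrite sumextE; apply: eq_bigr => j _; rewrite scalE mulrC.
have -> : (\sum_(j < 3) scal (e ord0 j)^* (deta R j)) S = \sum_(j < 3) (deta R j S * (e ord0 j)^*).
  by rewrite sumextE; apply: eq_bigr => j _; rewrite scalE mulrC.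
by apply: is_pd_sum => j; apply: is_pdZ; apply: is_pdJ.
Qed.

Lemma is_pd_s (f : C3 R -> C3 R) d p e S : f p != 0 ->
  (forall j, is_pd d (fun x => f x ord0 j) p (e ord0 j)) ->
  is_pd d (fun x => (scal (twopii R * norm2 (f x))^-1 (cform (f x))) S) p (ds (f p) e S).
Proof.
move=> fp0 h.
have hn : is_pd d (fun x => norm2 (f x)) p
    (\sum_(j < 3) (e ord0 j * (f p ord0 j)^* + f p ord0 j * (e ord0 j)^*)).
  have -> : (fun x => norm2 (f x)) = (fun x => \sum_(j < 3) f x ord0 j * (f x ord0 j)^*).
    by apply/funext => x; exact: norm2_conj.
  by apply: is_pd_sum => j; apply: is_pdM => //; exact: is_pdJ.
have n0 : twopii R * norm2 (f p) != 0 by rewrite mulf_neq0 ?twopii_neq0 ?norm2_neq0.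
have := is_pdM (is_pdV n0 (is_pdZ (twopii R) hn)) (is_pd_cform S h).
have -> : (fun x => (scal (twopii R * norm2 (f x))^-1 (cform (f x))) S) =
   (fun x => (twopii R * norm2 (f x))^-1 * cform (f x) S).
  by apply/funext => x; rewrite scalE.
by move=> hh; apply: (is_pd_to hh); rewrite /ds addextE !scalE.
Qed.

(** The Wirtinger derivative with respect to [zbar_j] of a function whose
    derivative in the direction [e] is [F e]. *)
Definition wirt (F : C3 R -> ext R N12) (j : 'I_3) : ext R N12 :=
  scal 2^-1 (F (dirv R (j, false)) + scal 'i%C (F (dirv R (j, true)))).

Lemma wirtE F j S : wirt F j S =
  2^-1 * (F (dirv R (j, false)) S + 'i%C * F (dirv R (j, true)) S).
Proof. by rewrite scalE addextE scalE. Qed.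

(** [dbar s]: since [s] depends on [zeta - z] only, [z] moving by [e] acts as
    [zeta] moving by [- e]. *)
Definition dbars zeta z : ext R N12 := \sum_(j < 3)
  (dzetabar R j /w\ wirt (ds (zeta - z)) j +
   dzbar R j /w\ wirt (fun e => ds (zeta - z) (- e)) j).

Lemma dbar_eq (F : form33 R) zeta z (A D : 'I_3 -> ext R N12) :
  (forall j S, dzbar_deriv j (fun zeta' => F zeta' z S) zeta = A j S) ->
  (forall j S, dzbar_deriv j (fun z' => F zeta z' S) z = D j S) ->
  dbar F zeta z = \sum_(j < 3) (dzetabar R j /w\ A j + dzbar R j /w\ D j).
Proof.
move=> hA hD; apply: eq_bigr => j _.
have -> : [ffun S => dzbar_deriv j (fun zeta' => F zeta' z S) zeta] = A j.
  by apply/ffunP => S; rewrite ffunE hA.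
have -> // : [ffun S => dzbar_deriv j (fun z' => F zeta z' S) z] = D j.
by apply/ffunP => S; rewrite ffunE hD.
Qed.

Lemma dzbar_deriv_eq j (f : C3 R -> C) p (a : dir -> C) :
  (forall d, pderive d f p = a d) ->
  dzbar_deriv j f p = 2^-1 * (a (j, false) + 'i%C * a (j, true)).
Proof. by move=> h; rewrite /dzbar_deriv !h. Qed.

Lemma dbar_sE zeta z : zeta != z -> dbar (@s R) zeta z = dbars zeta z.
Proof.
rewrite -subr_eq0 => zz.
have h1 d S : pderive d (fun zeta' => s zeta' z S) zeta = ds (zeta - z) (dirv R d) S.
  have -> : (fun zeta' => s zeta' z S) = (fun x => (scal (twopii R * norm2 (x - z))^-1 (cform (x - z))) S).
    by apply/funext => x; rewrite sE.
  apply: (is_pdP (@is_pd_s (fun x => x - z) d zeta (dirv R d) S zz _)).2 => k.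
  have -> : (fun x : C3 R => (x - z) ord0 k) = (fun x => x ord0 k + - z ord0 k).
    by apply/funext => x; rewrite !mxE.
  have := is_pdD (is_pd_coord d k zeta) (is_pd_cst d (- z ord0 k) zeta).
  by rewrite addr0.
have h2 d S : pderive d (fun z' => s zeta z' S) z = ds (zeta - z) (- dirv R d) S.
  have -> : (fun z' => s zeta z' S) = (fun x => (scal (twopii R * norm2 (zeta - x))^-1 (cform (zeta - x))) S).
    by apply/funext => x; rewrite sE.
  apply: (is_pdP (@is_pd_s (fun x => zeta - x) d z (- dirv R d) S zz _)).2 => k.
  have -> : (fun x : C3 R => (zeta - x) ord0 k) = (fun x => zeta ord0 k + (-1) * x ord0 k).
    by apply/funext => x; rewrite !mxE mulN1r.
  have := is_pdD (is_pd_cst d (zeta ord0 k) z) (is_pdZ (-1) (is_pd_coord d k z)).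
  by rewrite add0r mulN1r [(- _ : C3 R) _ _]mxE.
apply: dbar_eq => j S.
  by rewrite wirtE; exact: dzbar_deriv_eq (fun d => h1 d S).
by rewrite wirtE; exact: dzbar_deriv_eq (fun d => h2 d S).
Qed.

Definition dbarchi (chi : C3 R -> C) zeta : ext R N12 :=
  \sum_(j < 3) scal (dzbar_deriv j chi zeta) (dzetabar R j /w\ eone R N12).

Lemma dbar_chiE (chi : C3 R -> C) zeta z : smooth_on setT chi ->
  dbar (fun zeta' _ => scal (chi zeta') (eone R _)) zeta z = dbarchi chi zeta.
Proof.
move=> hchi.
have hd d : is_pd d chi zeta (pderive d chi zeta).
  by apply: pderivable_is_pd; have [_] := hchi [::] zeta I; apply.
have h1 d S : pderive d (fun zeta' => scal (chi zeta') (eone R N12) S) zeta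
    = pderive d chi zeta * eone R N12 S.
  have -> : (fun zeta' => scal (chi zeta') (eone R N12) S) = (fun x => eone R N12 S * chi x).
    by apply/funext => x; rewrite scalE mulrC.
  by rewrite (is_pdP (is_pdZ _ (hd d))).2 mulrC.
have h2 d (c : C) : pderive d (fun=> c) z = 0 by rewrite (is_pdP (is_pd_cst d c z)).2.
rewrite (@dbar_eq _ _ _ (fun j => scal (dzbar_deriv j chi zeta) (eone R N12)) (fun=> 0)).
- by apply: eq_bigr => j _; rewrite wedge0r addr0 scal_wedger.
- move=> j S; rewrite (dzbar_deriv_eq _ (fun d => h1 d S)) scalE /dzbar_deriv.
  by rewrite -mulrA; congr (_ * _); rewrite mulrDl mulrA.
- move=> j S; rewrite (dzbar_deriv_eq _ (fun d => h2 d _)) zeroextE.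
  by rewrite mulr0 addr0 mulr0.
Qed.

(** The right-hand side of the equation defining the kernel, with the
    derivatives carried out. *)
Definition kernel_rhs (chi : C3 R -> C) zeta z : ext R N12 :=
  h zeta z /w\ (scal (chi zeta) (s zeta z /w\ dbars zeta z)
    - dbarchi chi zeta /w\ sigma zeta z /w\ s zeta z).

(** Off the diagonal one formula with constant coefficients describes all
    kernels. *)
Lemma Ktilde_coef : exists c : {set 'I_N12} -> C,
  (forall B, cmod (c B) <= 1 /\ (c B != 0 -> exists2 x, anti x & B = [set x]%SET)) /\
  forall r r' chi K zeta z, smooth_on setT chi -> is_Ktilde r r' chi K ->
  XB r' zeta -> XB r z -> zeta != z ->
  forall B, K zeta z B = c B * kernel_rhs chi zeta z (zset :|: B)%SET.
Proof.
have [c [c1 hc]] := kernel_coef R; exists c; split=> // r r' chi K zeta z hchi hK h1 h2 hz B.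
have [ha hd] := hK zeta z h1 h2 hz.
move: hd; rewrite dbar_sE// dbar_chiE// => hd.
exact: hc ha hd B.
Qed.

End KernelFormula.

(** * The size of the kernel *)

Section KernelEstimate.
Variable R : realType.
Local Notation C := (Cplx R).
Local Notation N12 := ((3 + 3) + (3 + 3))%N.
Implicit Types (p q zeta z e : C3 R).
Local Opaque scal wedge.

Lemma compact_bound (A : set (C3 R)) (f : C3 R -> R) : compact A ->
  (forall p, A p -> f @ within A (nbhs p) --> f p) ->
  exists2 M, 0 <= M & forall p, A p -> `|f p| <= M.
Proof.
move=> cA cf; have cf' : {within A, continuous f} by apply/subspace_continuousP.
have /compact_bounded [M [_ hM]] := continuous_compact cf' cA.
exists (`|M| + 1); first by rewrite addr_ge0.
move=> p Ap; apply: (hM (`|M| + 1)); first by rewrite ltr_pwDr// ler_norm.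
by exists p.
Qed.

Lemma cvg_line p d : (fun t : R => p + t%:C%C *: dirv R d) @ (0 : R) --> p.
Proof.
have hc : (fun t : R => t%:C%C : C) @ (0 : R) --> ((0 : R)%:C%C : C).
  by apply: cvg_RtoC; exact: cvg_id.
have hz : (fun t : R => t%:C%C *: dirv R d) @ (0 : R) --> (0 : C3 R).
  by have hh := cvgZr_tmp (a := dirv R d) hc; rewrite scale0r in hh; exact: hh.
rewrite -[X in _ --> X]addr0.
exact: (cvgD (cvg_cst p) hz).
Qed.

Lemma near_pderive0 d (f : C3 R -> C) p (c : C) :
  (\forall x \near p, f x = c) -> pderive d f p = 0.
Proof.
move=> h; suff hp : is_pd d f p 0 by exact: (is_pdP hp).2.
have hn : \forall t \near (0 : R), on_line f p d t = c.
  have hl : \forall t \near (0 : R), f (p + t%:C%C *: dirv R d) = c by exact: (@cvg_line p d _ h).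
  by apply: filterS hl => t; rewrite on_lineE.
split.
  apply: (near_eq_is_derive _ (is_derive_cst (complex.Re c) (0 : R) (1 : R))).
  by apply: filterS hn => t ->.
apply: (near_eq_is_derive _ (is_derive_cst (complex.Im c) (0 : R) (1 : R))).
by apply: filterS hn => t ->.
Qed.

Lemma near_dzbar_deriv0 j (f : C3 R -> C) p (c : C) :
  (\forall x \near p, f x = c) -> dzbar_deriv j f p = 0.
Proof. by move=> h; rewrite /dzbar_deriv !(near_pderive0 _ h) mulr0 addr0 mulr0. Qed.

Lemma supp_off (T : topologicalType) (M : nmodType) (f : T -> M) (p : T) :
  ~ supp f p -> f p = 0.
Proof.
move=> h; apply/eqP; apply: contrapT => /negP t0; apply: h.
exact: subset_closure.
Qed.

Lemma off_supp (f : C3 R -> C) p : ~ supp f p -> \forall x \near p, f x = 0.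
Proof.
move=> np; have : nbhs p (~` supp f).
  by apply: open_nbhs_nbhs; split=> //; apply: closed_openC; exact: closed_closure.
apply: filterS => x nx; apply/eqP; apply: contrapT => /negP fx; apply: nx.
exact: subset_closure.
Qed.

Lemma dzbar_deriv_continuous j (f : C3 R -> C) : smooth_on setT f ->
  continuous (dzbar_deriv j f).
Proof.
move=> hf; have c d : continuous (pderive d f).
  by move=> p; have [] := hf [:: d] p I.
have k (a : C) : continuous (fun _ : C3 R => a) by exact: cst_continuous.
apply: (@continuous_mulC _ (fun=> 2^-1)); first exact: k.
apply: (@continuous_addC _ _ (fun p => 'i%C * pderive (j, true) f p)); first exact: c.
by apply: continuous_mulC; [exact: k|exact: c].
Qed.

Lemma compact_supp_bound (f g : C3 R -> C) : compact (supp f) -> continuous g ->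
  (forall p, ~ supp f p -> g p = 0) -> exists2 M, 0 <= M & forall p, cmod (g p) <= M.
Proof.
move=> cf cg g0.
have [p _|M M0 hM] := @compact_bound _ (fun p => cmod (g p)) cf.
  by apply: cvg_within_filter; exact: (cvg_cmod (cg p)).
exists M => // p; have [/hM|/g0 ->] := pselect (supp f p); last by rewrite cmod0.
by rewrite ger0_norm ?cmod_ge0.
Qed.

Lemma chi_bound (chi : C3 R -> C) : smooth_on setT chi -> compact (supp chi) ->
  exists2 M, 0 <= M & forall p, cmod (chi p) <= M /\ enorm (dbarchi chi p) <= M.
Proof.
move=> hchi cchi.
have [||M0 M00 hM0] := @compact_supp_bound chi chi cchi.
- by move=> p; have [] := hchi [::] p I.
- by move=> p nsp; exact: nbhs_singleton (off_supp nsp).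
have hj j : exists M, 0 <= M /\ forall p, cmod (dzbar_deriv j chi p) <= M.
  suff [M M0' hM] : exists2 M, 0 <= M & forall p, cmod (dzbar_deriv j chi p) <= M by exists M.
  apply: (@compact_supp_bound chi _ cchi); first exact: dzbar_deriv_continuous.
  by move=> p /off_supp /near_dzbar_deriv0; apply.
have [M hM] := choice hj.
exists (M0 + \sum_j M j); first by rewrite addr_ge0// sumr_ge0// => j _; have [] := hM j.
have S0 : 0 <= \sum_j M j by rewrite sumr_ge0// => j _; have [] := hM j.
move=> p; split; first by apply: (le_trans (hM0 p)); rewrite lerDl.
apply: (@le_trans _ _ (\sum_j M j)); last by rewrite lerDr.
apply: (le_trans (enorm_sum _ _ _)); apply: ler_sum => j _.
rewrite enorm_scal -[leRHS]mulr1; apply: ler_pM; rewrite ?cmod_ge0 ?enorm_ge0//.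
  by have [_] := hM j; apply.
by apply: (le_trans (enorm_wedge _ _)); rewrite enorm_gen enorm_eone mulr1.
Qed.

Definition l1norm p : R := \sum_(j < 3) cmod (p ord0 j).

Lemma l1norm_ge0 p : 0 <= l1norm p.
Proof. by apply: sumr_ge0 => j _; exact: cmod_ge0. Qed.

Lemma coord_le_l1norm p j : cmod (p ord0 j) <= l1norm p.
Proof. by rewrite /l1norm (bigD1 j)//= lerDl; apply: sumr_ge0 => ? _; exact: cmod_ge0. Qed.

Lemma l1norm_le_len p : l1norm p <= 3 * len p.
Proof.
apply: (@le_trans _ _ (\sum_(j < 3) len p)).
  by apply: ler_sum => j _; exact: coord_le_len.
by rewrite sumr_const card_ord mulr_natl.
Qed.

Lemma enorm_deta j : enorm (deta R j) <= 2.
Proof. by apply: (le_trans (enormD _ _)); rewrite enormN !enorm_gen. Qed.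

Lemma enorm_cform p : enorm (cform p) <= 2 * l1norm p.
Proof.
apply: (le_trans (enorm_sum _ _ _)); rewrite /l1norm mulr_sumr; apply: ler_sum => j _.
by rewrite enorm_scal cmodJ mulrC ler_wpM2r ?cmod_ge0// enorm_deta.
Qed.

Let tau : R := cmod (twopii R).

Let tau_gt0 : 0 < tau.
Proof. by rewrite lt_neqAle cmod_ge0 andbT eq_sym cmod_eq0 twopii_neq0. Qed.

Lemma cmod_norm2 p : cmod (norm2 p) = len p ^+ 2.
Proof. by rewrite norm2E cmod_real ger0_norm ?sqnorm_ge0// len_sqr. Qed.

Lemma enorm_s zeta z : zeta != z -> enorm (s zeta z) <= 6 / tau / len (zeta - z).
Proof.
move=> zz; rewrite sE enorm_scal cmodV cmodM cmod_norm2 -/tau.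
have l0 : 0 < len (zeta - z) by rewrite len_gt0 subr_eq0.
rewrite mulrC ler_pdivrMr ?mulr_gt0 ?exprn_gt0//.
apply: (le_trans (enorm_cform _)).
have -> : 6 / tau / len (zeta - z) * (tau * len (zeta - z) ^+ 2) = 6 * len (zeta - z).
  by field; rewrite !gt_eqF.
by have := l1norm_le_len (zeta - z); lra.
Qed.

Lemma enorm_ds eta e : eta != 0 -> (forall j, cmod (e ord0 j) <= 1) ->
  enorm (ds eta e) <= 42 / tau / len eta ^+ 2.
Proof.
move=> eta0 he; have l0 : 0 < len eta by rewrite len_gt0.
have le3 : l1norm e <= 3.
  apply: (@le_trans _ _ (\sum_(j < 3) 1)); first by apply: ler_sum => j _; exact: he.
  by rewrite sumr_const card_ord.
have h1 : cmod (\sum_(j < 3) (e ord0 j * (eta ord0 j)^* + eta ord0 j * (e ord0 j)^*)) <= 6 * len eta.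
  apply: (le_trans (cmod_sum _ _ _)).
  apply: (@le_trans _ _ (\sum_(j < 3) 2 * len eta)); last by rewrite sumr_const card_ord -mulrnAl -mulrnA.
  apply: ler_sum => j _; apply: (le_trans (cmodD _ _)); rewrite !cmodM !cmodJ.
  have a0 := cmod_ge0 (e ord0 j); have a1 := he j.
  have b0 := cmod_ge0 (eta ord0 j); have b1 := coord_le_len eta j.
  by nra.
apply: (le_trans (enormD _ _)); rewrite !enorm_scal.
rewrite cmodM cmodN cmodX !cmodV ![cmod (twopii R * _)]cmodM cmod_norm2 -/tau.
set N := cmod (\sum_(j < 3) _) in h1 *.
have N0 : 0 <= N := cmod_ge0 _.
have c1 : enorm (cform eta) <= 6 * len eta.
  by apply: (le_trans (enorm_cform _)); have := l1norm_le_len eta; lra.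
have c2 : enorm (cform e) <= 6 by apply: (le_trans (enorm_cform _)); lra.
set t2 := (tau * len eta ^+ 2)^-1.
have t20 : 0 < t2 by rewrite invr_gt0 mulr_gt0// exprn_gt0.
have p1 := mulr_ge0 (ltW tau_gt0) N0.
have p2 : 0 <= t2 ^+ 2 by exact: sqr_ge0.
apply: (@le_trans _ _ (tau * (6 * len eta) * t2 ^+ 2 * (6 * len eta) + t2 * 6)).
  apply: lerD; last by rewrite ler_wpM2l// ltW.
  apply: (ler_pM (mulr_ge0 p1 p2) (enorm_ge0 _) _ c1).
  apply: (ler_pM p1 p2 _ (lexx _)).
  by rewrite ler_wpM2l// ltW.
rewrite /t2 le_eqVlt; apply/orP; left; apply/eqP; field.
by rewrite !gt_eqF.
Qed.

Lemma dirv_le1 d j : cmod (dirv R d ord0 j) <= 1.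
Proof.
rewrite /dirv !mxE cmodM; apply: mulr_ile1; rewrite ?cmod_ge0//.
  case: d.2; rewrite ?cmod1//.
  by rewrite /cmod /Normc.normc expr0n add0r expr1n sqrtr1.
by rewrite cmod_natr; case: (_ && _).
Qed.

Lemma cmod_i : cmod ('i%C : C) = 1.
Proof. by rewrite /cmod /Normc.normc expr0n add0r expr1n sqrtr1. Qed.

Lemma enorm_wirt F j (M : R) : (forall d, enorm (F (dirv R d)) <= M) ->
  enorm (wirt F j) <= M.
Proof.
move=> h; rewrite /wirt enorm_scal cmodV cmod_natr.
rewrite mulrC ler_pdivrMr// mulrC mulr_natl mulr2n.
apply: (le_trans (enormD _ _)); rewrite enorm_scal cmod_i mul1r.
exact: lerD.
Qed.

Lemma enorm_dbars zeta z : zeta != z ->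
  enorm (dbars zeta z) <= 252 / tau / len (zeta - z) ^+ 2.
Proof.
move=> zz; have e0 : zeta - z != 0 by rewrite subr_eq0.
set M : R := 42 / tau / len (zeta - z) ^+ 2.
have -> : 252 / tau / len (zeta - z) ^+ 2 = \sum_(j < 3) (M + M).
  by rewrite sumr_const card_ord /M -mulr_natl; ring.
apply: (le_trans (enorm_sum _ _ _)); apply: ler_sum => j _.
have hM1 : enorm (wirt (ds (zeta - z)) j) <= M.
  by apply: enorm_wirt => d; apply: enorm_ds => // k; exact: dirv_le1.
have hM2 : enorm (wirt (fun e => ds (zeta - z) (- e)) j) <= M.
  by apply: enorm_wirt => d; apply: enorm_ds => // k; rewrite mxE cmodN; exact: dirv_le1.
by apply: (le_trans (enormD _ _)); apply: lerD; apply: (le_trans (enorm_wedge _ _));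
  rewrite enorm_gen mul1r.
Qed.

Lemma enorm_h zeta z : enorm (h zeta z) <= 4 * (l1norm zeta + l1norm z).
Proof.
have b (j k : 'I_3) : enorm (scal (zeta ord0 j + z ord0 j) (deta R k)) <=
    2 * (l1norm zeta + l1norm z).
  rewrite enorm_scal mulrC; apply: ler_pM; rewrite ?enorm_ge0 ?cmod_ge0 ?enorm_deta//.
  by apply: (le_trans (cmodD _ _)); apply: lerD; exact: coord_le_l1norm.
have b12 := le_trans (enormD _ _) (lerD (b i2 i1) (b i1 i2)).
have b3 := b i3 i3.
rewrite /h; apply: (le_trans (enormD _ _)); rewrite enormN enorm_scal cmodV cmod_natr.
by move: b12 b3; set u := enorm _; set v := enorm _ => h1 h2; lra.
Qed.

(** The inequality [2 |a b| <= |a| ^ 2 + |b| ^ 2] in each coordinate. *)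
Lemma sigma_den zeta z : (sqnorm zeta - sqnorm z) / 2 <=
  cmod (norm2 zeta - \sum_(j < 3) (zeta ord0 j)^* * z ord0 j).
Proof.
apply: le_trans (ler_cmodB _ _).
have -> : cmod (norm2 zeta) = sqnorm zeta by rewrite cmod_norm2 len_sqr.
have : cmod (\sum_(j < 3) (zeta ord0 j)^* * z ord0 j) <= (sqnorm zeta + sqnorm z) / 2.
  apply: (le_trans (cmod_sum _ _ _)); rewrite /sqnorm -big_split /= mulr_suml.
  apply: ler_sum => j _; rewrite cmodM cmodJ.
  by have := sqr_ge0 (cmod (zeta ord0 j) - cmod (z ord0 j)); nra.
by lra.
Qed.

Lemma enorm_sigma zeta z : sqnorm z < sqnorm zeta ->
  enorm (sigma zeta z) <= 4 / tau * l1norm zeta / (sqnorm zeta - sqnorm z).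
Proof.
move=> hz; have := sigma_den zeta z; set d := cmod _ => hd.
have e0 : 0 < sqnorm zeta - sqnorm z by rewrite subr_gt0.
have d0 : 0 < d by apply: lt_le_trans hd; lra.
rewrite /sigma enorm_scal cmodV cmodM -/tau -/d.
have hc : enorm (\sum_(j < 3) scal (zeta ord0 j)^* (deta R j)) <= 2 * l1norm zeta.
  exact: enorm_cform.
rewrite mulrC ler_pdivrMr ?mulr_gt0//; apply: (le_trans hc).
have -> : 4 / tau * l1norm zeta / (sqnorm zeta - sqnorm z) * (tau * d) =
    4 * l1norm zeta * (d / (sqnorm zeta - sqnorm z)) by field; rewrite !gt_eqF.
have : 2^-1 <= d / (sqnorm zeta - sqnorm z) by rewrite ler_pdivlMr// mulrC.
have := l1norm_ge0 zeta; move: (l1norm zeta) (d / _) => x y; nra.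
Qed.

(** [chi] is constant near the closed ball of radius [r]. *)
Lemma dbarchi_near r r' chi zeta : cutoff r r' chi ->
  dbarchi chi zeta = 0 \/ r ^+ 2 < sqnorm zeta.
Proof.
move=> [hchi cchi _ [U oU [BU chiU]]]; have [Uz|nUz] := pselect (U zeta).
  left; rewrite /dbarchi big1// => j _; rewrite (@near_dzbar_deriv0 _ _ _ 1) ?scal0l//.
  by apply: filterS (open_nbhs_nbhs (conj oU Uz)).
by right; rewrite ltNge; apply/negP => /closedBE /BU.
Qed.

Lemma dbarchi_supp (chi : C3 R -> C) zeta : ~ supp chi zeta -> dbarchi chi zeta = 0.
Proof.
move=> /off_supp h; rewrite /dbarchi big1// => j _.
by rewrite (@near_dzbar_deriv0 _ _ _ 0) ?scal0l.
Qed.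

(** The kernel is of size [|h| / |zeta - z| ^ 3]; the terms involving [sigma]
    are less singular, [zeta] staying away from the ball of radius [r] on the
    support of [dbar chi]. *)
Lemma kernel_rhs_bound r r' chi (rho L : R) : cutoff r r' chi -> rho < r ^+ 2 ->
  exists2 A, 0 <= A & forall zeta z, sqnorm z <= rho -> sqnorm zeta <= L -> zeta != z ->
    enorm (kernel_rhs chi zeta z) <= A * (l1norm zeta + l1norm z) / len (zeta - z) ^+ 3.
Proof.
move=> cut hrho; have [hchi cchi _ _] := cut.
have [M M0 hM] := chi_bound hchi cchi.
pose Ls := Num.max L (Num.max rho 0).
have Ls0 : 0 <= Ls by rewrite /Ls !le_max lexx !orbT.
pose A1 := (6 / tau) * (252 / tau) * M.
(* The last factor of [A2] bounds [l ^+ 2], so that the term with [sigma], of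
   order [l ^- 1], fits under [l ^- 3]. *)
pose A2 := M * (4 / tau * (3 * Num.sqrt Ls) / (r ^+ 2 - rho)) * (6 / tau) * (12 * Ls).
have r0 : 0 < r ^+ 2 - rho by rewrite subr_gt0.
have tau0 : 0 <= tau by exact: ltW.
have div0 (k : nat) : 0 <= k%:R / tau by apply: divr_ge0 => //; exact: ler0n.
have A10 : 0 <= A1 := mulr_ge0 (mulr_ge0 (div0 _) (div0 _)) M0.
have A20 : 0 <= A2.
  rewrite /A2 !mulr_ge0 ?invr_ge0 ?sqrtr_ge0//; exact: ltW.
exists (4 * (A1 + A2)); first by rewrite mulr_ge0// addr_ge0.
move=> zeta z hz hzeta zz.
have l0 : 0 < len (zeta - z) by rewrite len_gt0 subr_eq0.
set l := len (zeta - z) in l0 *.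
have lL : l ^+ 2 <= 12 * Ls.
  rewrite len_sqr /sqnorm.
  have : sqnorm zeta <= Ls by rewrite /Ls le_max hzeta.
  have : sqnorm z <= Ls by rewrite /Ls !le_max hz !orbT.
  have : sqnorm (zeta - z) <= 2 * (sqnorm zeta + sqnorm z).
    rewrite /sqnorm -big_split /= mulr_sumr; apply: ler_sum => j _; rewrite !mxE.
    have := cmodD (zeta ord0 j) (- z ord0 j); rewrite cmodN.
    have := cmod_ge0 (zeta ord0 j - z ord0 j).
    move: (cmod (_ - _)) (cmod (zeta _ _)) (cmod (z _ _)) => a b c a0 h.
    have := sqr_ge0 (b - c).
    have : a ^+ 2 <= (b + c) ^+ 2 by rewrite ler_sqr ?nnegrE//; apply: le_trans h.
    nra.
  by rewrite /sqnorm; lra.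
rewrite /kernel_rhs.
have -> : 4 * (A1 + A2) * (l1norm zeta + l1norm z) / l ^+ 3 =
   4 * (l1norm zeta + l1norm z) * ((A1 + A2) / l ^+ 3) by field; rewrite gt_eqF.
apply: enorm_wedge_le; first exact: enorm_h.
have -> : (A1 + A2) / l ^+ 3 = A1 / l ^+ 3 + A2 / l ^+ 3 by field; rewrite gt_eqF.
apply: (le_trans (enormD _ _)); rewrite enormN; apply: lerD.
  have -> : A1 / l ^+ 3 = M * (6 / tau / l * (252 / tau / l ^+ 2)).
    by rewrite /A1; field; rewrite !gt_eqF.
  rewrite enorm_scal; apply: ler_pM; rewrite ?cmod_ge0 ?enorm_ge0//.
    by have [] := hM zeta.
  by apply: enorm_wedge_le; [exact: enorm_s|exact: enorm_dbars].
have [->|rz] := dbarchi_near zeta cut.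
  by rewrite !wedge0l enorm0 mulr_ge0 ?invr_ge0 ?exprn_ge0 ?len_ge0.
have hs : enorm (sigma zeta z) <= 4 / tau * (3 * Num.sqrt Ls) / (r ^+ 2 - rho).
  apply: (le_trans (enorm_sigma _)); first by apply: (le_lt_trans hz); lra.
  have d1 : 0 < sqnorm zeta - sqnorm z by lra.
  have h1 : l1norm zeta <= 3 * Num.sqrt Ls.
    apply: (le_trans (l1norm_le_len _)); rewrite ler_wpM2l// /len ler_wsqrtr//.
    by rewrite /Ls le_max hzeta.
  have d1V : 0 <= (sqnorm zeta - sqnorm z)^-1 by rewrite invr_ge0 ltW.
  apply: (ler_pM (mulr_ge0 (div0 _) (l1norm_ge0 _)) d1V).
    by rewrite ler_wpM2l// div0.
  by rewrite lef_pV2 ?posrE//; lra.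
apply: (@le_trans _ _ (M * (4 / tau * (3 * Num.sqrt Ls) / (r ^+ 2 - rho)) * (6 / tau / l))).
  apply: enorm_wedge_le; last exact: enorm_s.
  by apply: enorm_wedge_le => //; have [] := hM zeta.
have -> : A2 / l ^+ 3 = M * (4 / tau * (3 * Num.sqrt Ls) / (r ^+ 2 - rho)) *
    (6 / tau / l) * ((12 * Ls) / l ^+ 2).
  by rewrite /A2; field; rewrite !gt_eqF.
rewrite ler_peMr//.
  rewrite !mulr_ge0 ?invr_ge0 ?sqrtr_ge0//; exact: ltW.
by rewrite ler_pdivlMr ?exprn_gt0// mul1r.
Qed.

End KernelEstimate.

(** * Distances on the covering *)

Section CovGeometry.
Variable R : realType.
Local Notation C := (Cplx R).
Implicit Types (w v : R4 R).

Lemma cov_surj (z : C3 R) : Z z -> exists w, cov w = z.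
Proof.
rewrite /Z /= => /eqP; rewrite subr_eq0 => /eqP hz.
pose mk (u v : C) : R4 R := ((complex.Re u, complex.Im u), (complex.Re v, complex.Im v)).
have mku (u v : C) : ucoord (mk u v) = u by rewrite /ucoord /=; case: u.
have mkv (u v : C) : vcoord (mk u v) = v by rewrite /vcoord /=; case: v.
have rowE (w : R4 R) : ucoord w ^+ 2 = z ord0 i1 -> vcoord w ^+ 2 = z ord0 i2 ->
    ucoord w * vcoord w = z ord0 i3 -> cov w = z.
  move=> h1 h2 h3; apply/rowP => j.
  by case: (I3P j) => ->; rewrite covE.
pose u : C := sqrtc (z ord0 i1); have uE : u ^+ 2 = z ord0 i1 by exact: sqr_sqrtc.
have [u0|u0] := eqVneq u 0.
  pose v : C := sqrtc (z ord0 i2); have vE : v ^+ 2 = z ord0 i2 by exact: sqr_sqrtc.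
  exists (mk u v); apply: rowE; rewrite ?mku ?mkv//.
  move: hz; rewrite -uE u0 expr0n mul0r /= mul0r => /esym/eqP.
  by rewrite expf_eq0 /= => /eqP ->.
exists (mk u (z ord0 i3 / u)); apply: rowE; rewrite ?mku ?mkv//.
  by rewrite expr_div_n -hz -uE mulrAC divff ?mul1r// expf_neq0.
by rewrite mulrCA divff// mulr1.
Qed.

Lemma ucoordD w v : ucoord (w + v) = ucoord w + ucoord v.
Proof. by []. Qed.

Lemma vcoordD w v : vcoord (w + v) = vcoord w + vcoord v.
Proof. by []. Qed.

Lemma ucoordN w : ucoord (- w) = - ucoord w.
Proof. by []. Qed.

Lemma vcoordN w : vcoord (- w) = - vcoord w.
Proof. by []. Qed.

Lemma mnorm_sqr_le w : mnorm w ^+ 2 <= cmod (ucoord w) ^+ 2 + cmod (vcoord w) ^+ 2.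
Proof.
rewrite !cmod_sqr /=.
have h (x a b c d : R) : x = `|a| \/ x = `|b| \/ x = `|c| \/ x = `|d| ->
   x ^+ 2 <= a ^+ 2 + b ^+ 2 + (c ^+ 2 + d ^+ 2).
  have := sqr_ge0 a; have := sqr_ge0 b; have := sqr_ge0 c; have := sqr_ge0 d.
  by move=> ? ? ? ? [->|[->|[->|->]]]; rewrite real_normK ?num_real//; lra.
apply: h; rewrite /mnorm.
by case: (leP `|w.1.1| `|w.1.2|) => _; case: (leP `|w.2.1| `|w.2.2|) => _;
  case: leP => _; tauto.
Qed.

Lemma wsize_le w : wsize w <= 4 * mnorm w.
Proof.
have h (x : C) (m : R) : `|complex.Re x| <= m -> `|complex.Im x| <= m -> cmod x <= 2 * m.
  by move=> h1 h2; apply: (le_trans (cmod_le_ReIm x)); lra.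
have : cmod (ucoord w) <= 2 * mnorm w.
  by apply: h; rewrite /= /mnorm !le_max lexx ?orbT.
have : cmod (vcoord w) <= 2 * mnorm w.
  by apply: h; rewrite /= /mnorm !le_max lexx ?orbT.
by rewrite /wsize; lra.
Qed.

Lemma l1norm_cov w : l1norm (cov w) <= wsize w ^+ 2.
Proof.
rewrite /l1norm !big_ord_recl big_ord0 addr0.
have e1 : ord0 = i1 by apply: val_inj.
have e2 : lift ord0 ord0 = i2 by apply: val_inj.
have e3 : lift ord0 (lift ord0 ord0) = i3 by apply: val_inj.
rewrite e2 e3 [X in cmod (cov w ord0 X)]e1 !covE !cmodX cmodM /wsize.
have := cmod_ge0 (ucoord w); have := cmod_ge0 (vcoord w).
by move: (cmod _) (cmod _) => a b; nra.
Qed.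

Lemma sqnormE (p : C3 R) : sqnorm p = cmod (p ord0 i1) ^+ 2 + cmod (p ord0 i2) ^+ 2 + cmod (p ord0 i3) ^+ 2.
Proof.
rewrite /sqnorm !big_ord_recl big_ord0 addr0.
have e1 : ord0 = i1 by apply: val_inj.
have e2 : lift ord0 ord0 = i2 by apply: val_inj.
have e3 : lift ord0 (lift ord0 ord0) = i3 by apply: val_inj.
by rewrite e2 e3 [X in cmod (p ord0 X)]e1 addrA.
Qed.

Lemma mnorm_cov w : mnorm w ^+ 2 <= 2 * len (cov w).
Proof.
apply: (le_trans (mnorm_sqr_le w)).
have := coord_le_len (cov w) i1; have := coord_le_len (cov w) i2.
by rewrite !covE !cmodX; lra.
Qed.

(** The coordinates of [cov w - cov v] are [a1 * b1], [a2 * b2] and [(a1 * b2 +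
    a2 * b1) / 2], where [a = w - v] and [b = w + v]: their norm controls the
    product of the norms of [a] and [b], that is, of the distances of [v] and
    [- v] to [w]. *)
Lemma cov_dist w v : mnorm (w - v) * mnorm (w + v) <= 2 * len (cov w - cov v).
Proof.
rewrite -(@ler_pXn2r _ 2) ?nnegrE ?mulr_ge0 ?mnorm_ge0 ?len_ge0//.
rewrite !exprMn len_sqr sqnormE.
have hA := mnorm_sqr_le (w - v); have hB := mnorm_sqr_le (w + v).
rewrite !ucoordD !vcoordD !ucoordN !vcoordN in hA hB.
set a1 := ucoord w - ucoord v in hA; set a2 := vcoord w - vcoord v in hA.
set b1 := ucoord w + ucoord v in hB; set b2 := vcoord w + vcoord v in hB.
have e1 : (cov w - cov v) ord0 i1 = a1 * b1.
  by rewrite !mxE -!/(cov _ _ _) /a1 /b1 /=; ring.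
have e2 : (cov w - cov v) ord0 i2 = a2 * b2.
  by rewrite !mxE -!/(cov _ _ _) /a2 /b2 /=; ring.
have e3 : (cov w - cov v) ord0 i3 = (a1 * b2 + a2 * b1) / 2.
  by rewrite !mxE -!/(cov _ _ _) /a1 /b2 /b1 /a2 /=; field.
rewrite e1 e2 e3 [cmod (_ / 2)]cmodM cmodV cmod_natr.
have : (cmod (a1 * b2) - cmod (a2 * b1)) ^+ 2 <= cmod (a1 * b2 + a2 * b1) ^+ 2.
  have h : `|cmod (a1 * b2) - cmod (a2 * b1)| <= cmod (a1 * b2 + a2 * b1).
    have h1 := ler_cmodB (a1 * b2) (- (a2 * b1)).
    have h2 := ler_cmodB (a2 * b1) (- (a1 * b2)).
    rewrite !cmodN !opprK [a2 * b1 + _]addrC in h1 h2.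
    by rewrite ler_norml h1 andbT; lra.
  by rewrite -[leLHS]real_normK ?num_real// ler_sqr ?nnegrE ?cmod_ge0.
rewrite !cmodM.
have := mulr_ge0 (sqr_ge0 (mnorm (w - v))) (sqr_ge0 (mnorm (w + v))).
have : mnorm (w - v) ^+ 2 * mnorm (w + v) ^+ 2 <=
    (cmod a1 ^+ 2 + cmod a2 ^+ 2) * (cmod b1 ^+ 2 + cmod b2 ^+ 2).
  by apply: ler_pM; rewrite ?sqr_ge0.
move: (mnorm _ ^+ 2 * _) => X.
move: (cmod (a1 * b2 + a2 * b1)) => t hX X0.
move: (cmod a1) (cmod a2) (cmod b1) (cmod b2) hX => p q x y hX ht.
have := sqr_ge0 (p * x - q * y).
have e : 2 ^+ 2 * ((p * x) ^+ 2 + (q * y) ^+ 2 + (t * 2^-1) ^+ 2) =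
   4 * ((p * x) ^+ 2 + (q * y) ^+ 2) + t ^+ 2 by field.
by rewrite e; nra.
Qed.

Lemma cov_eq w v : cov w = cov v -> w = v \/ w = - v.
Proof.
move=> h; have := cov_dist w v; rewrite h subrr.
have -> : len (0 : C3 R) = 0 by apply/eqP; rewrite sqrtr_eq0 sqnormE !mxE cmod0 expr0n /= !addr0.
rewrite mulr0 => h0.
have : mnorm (w - v) * mnorm (w + v) == 0.
  by rewrite eq_le h0 mulr_ge0 ?mnorm_ge0.
rewrite mulf_eq0 => /orP[] /eqP/mnorm_eq0/eqP.
  by rewrite subr_eq0 => /eqP; left.
by rewrite addr_eq0 => /eqP; right.
Qed.

(** This bounds [w] and [v], which up to signs are half sums of [v - w] and [-
    v - w]. *)
Lemma mnorm_half (a b : R4 R) m : mnorm a <= m -> mnorm b <= m ->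
  forall w, w + w = a + b -> mnorm w <= m.
Proof.
rewrite /mnorm !ge_max => /andP[/andP[a1 a2] /andP[a3 a4]] /andP[/andP[b1 b2] /andP[b3 b4]] w hw.
have k (x y z : R) : `|x| <= m -> `|y| <= m -> z + z = x + y -> `|z| <= m.
  by rewrite !ler_norml => /andP[? ?] /andP[? ?] ?; apply/andP; split; lra.
have [h1 h2 h3 h4] : [/\ w.1.1 + w.1.1 = a.1.1 + b.1.1, w.1.2 + w.1.2 = a.1.2 + b.1.2,
    w.2.1 + w.2.1 = a.2.1 + b.2.1 & w.2.2 + w.2.2 = a.2.2 + b.2.2].
  by case: w a b hw {a1 a2 a3 a4 b1 b2 b3 b4} => [[? ?] [? ?]] [[? ?] [? ?]] [[? ?] [? ?]] /= [-> -> -> ->].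
by rewrite !ge_max; apply/andP; split; apply/andP; split;
  [exact: k h1|exact: k h2|exact: k h3|exact: k h4].
Qed.

Lemma mnormN w : mnorm (- w) = mnorm w.
Proof. by rewrite /mnorm /= !normrN. Qed.

(** Let [a] be the smaller and [b] the larger of the distances of [w] to [v]
    and [- v], and [l] the distance of their images. Then [b] dominates [w] and
    [v], so that the numerator is of order [b ^ 4], and [a * b <= 2 * l] by
    [cov_dist], so that the quotient is of order [b * a ^- 3]. *)
Lemma cov_kernel_le W w v : 0 <= W -> mnorm w <= W -> mnorm v <= W ->
  w != v -> w != - v ->
  wsize w ^+ 2 * (l1norm (cov w) + l1norm (cov v)) / len (cov w - cov v) ^+ 3 <=
  512 * (8 * (2 * W)) * inv_cubes v w.
Proof.
move=> W0 hw hv wv wNv; rewrite /inv_cubes.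
have key a b : 0 < a -> 0 < b -> mnorm w <= b -> mnorm v <= b -> b <= 2 * W -> a * b <= 2 * len (cov w - cov v) ->
    wsize w ^+ 2 * (l1norm (cov w) + l1norm (cov v)) / len (cov w - cov v) ^+ 3 <= 512 * (8 * (2 * W)) * a ^- 3.
  move=> a0 b0 wb vb bW ab.
  set l := len _ in ab *.
  have l0 : 0 < l by have := mulr_gt0 a0 b0; lra.
  have s4 u : mnorm u <= b -> wsize u ^+ 2 <= 16 * b ^+ 2.
    move=> hu; have -> : 16 * b ^+ 2 = (4 * b) ^+ 2 by rewrite exprMn -natrX.
    rewrite ler_sqr ?nnegrE ?wsize_ge0//; last by rewrite mulr_ge0// ltW.
    by apply: (le_trans (wsize_le u)); rewrite ler_wpM2l.
  have h1 : wsize w ^+ 2 * (l1norm (cov w) + l1norm (cov v)) <= 512 * b ^+ 4.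
    have -> : 512 * b ^+ 4 = (16 * b ^+ 2) * (16 * b ^+ 2 + 16 * b ^+ 2) by ring.
    apply: ler_pM; rewrite ?sqr_ge0 ?addr_ge0 ?l1norm_ge0 ?s4//.
    by apply: lerD; apply: (le_trans (l1norm_cov _)); exact: s4.
  have h2 : l ^- 3 <= 8 * (a * b) ^- 3.
    have -> : 8 * (a * b) ^- 3 = (a * b / 2) ^- 3 by field; rewrite !gt_eqF.
    rewrite lef_pV2 ?posrE ?exprn_gt0 ?divr_gt0 ?mulr_gt0//.
    have ab2 : a * b / 2 <= l by lra.
    have ab0 : 0 <= a * b / 2 by rewrite ltW// divr_gt0// mulr_gt0.
    by rewrite ler_pXn2r// nnegrE ltW.
  have l30 : 0 <= l ^- 3 by rewrite invr_ge0 exprn_ge0// ltW.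
  have b40 : 0 <= wsize w ^+ 2 * (l1norm (cov w) + l1norm (cov v)) by rewrite mulr_ge0 ?sqr_ge0 ?addr_ge0 ?l1norm_ge0.
  apply: (le_trans (ler_pM b40 l30 h1 h2)).
  have -> : 512 * b ^+ 4 * (8 * (a * b) ^- 3) = 512 * (8 * b) * a ^- 3.
    by field; rewrite !gt_eqF.
  apply: ler_wpM2r; first by rewrite invr_ge0 exprn_ge0// ltW.
  apply: ler_wpM2l; first exact: ler0n.
  by apply: ler_wpM2l; first exact: ler0n.
have mpos (u : R4 R) : u != 0 -> 0 < mnorm u.
  by move=> u0; rewrite lt_neqAle mnorm_ge0 andbT eq_sym; apply: contra u0 => /eqP/mnorm_eq0 ->.
have a0 : 0 < mnorm (v - w) by apply: mpos; rewrite subr_eq0 eq_sym.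
have b0 : 0 < mnorm (- v - w) by apply: mpos; rewrite subr_eq0 eq_sym.
have ab : mnorm (v - w) * mnorm (- v - w) <= 2 * len (cov w - cov v).
  have := cov_dist w v; rewrite -(mnormN (w - v)) opprB -(mnormN (w + v)) opprD.
  by rewrite [- w - v]addrC.
have hm (x y : R4 R) : mnorm x <= W -> mnorm y <= W -> mnorm (x + y) <= 2 * W.
  rewrite /mnorm !ge_max => /andP[/andP[x1 x2] /andP[x3 x4]] /andP[/andP[y1 y2] /andP[y3 y4]].
  have k (c d : R) : `|c| <= W -> `|d| <= W -> `|c + d| <= 2 * W.
    by move=> h1 h2; apply: (le_trans (ler_normD _ _)); lra.
  by rewrite ?ge_max; apply/andP; split; apply/andP; split; exact: k.
have aW : mnorm (v - w) <= 2 * W by apply: hm; rewrite ?mnormN.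
have bW : mnorm (- v - w) <= 2 * W by apply: hm; rewrite ?mnormN.
have V3 (u : R4 R) : 0 <= mnorm u ^- 3 by rewrite invr_ge0 exprn_ge0// mnorm_ge0.
have cW : 0 <= 512 * (8 * (2 * W)) by do 3 (apply: mulr_ge0; first exact: ler0n).
have half m : mnorm (v - w) <= m -> mnorm (- v - w) <= m -> mnorm w <= m /\ mnorm v <= m.
  move=> h1 h2; split.
    rewrite -mnormN; apply: (mnorm_half h1 h2); rewrite addrACA subrr add0r.
    by [].
  apply: (mnorm_half h1 (_ : mnorm (- (- v - w)) <= m)); first by rewrite mnormN.
  by rewrite opprD !opprK addrACA addNr addr0.
have [hab|hab] := leP (mnorm (v - w)) (mnorm (- v - w)).
  have [m1 m2] := half _ hab (lexx _).
  apply: (le_trans (key _ _ a0 b0 m1 m2 bW ab)).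
  by rewrite ler_wpM2l// lerDl.
have [m1 m2] := half _ (lexx _) (ltW hab).
rewrite mulrC in ab.
apply: (le_trans (key _ _ b0 a0 m1 m2 aW ab)).
by rewrite ler_wpM2l// lerDr.
Qed.

End CovGeometry.

(** * Charts: topology and measurability *)

Section CovTopology.
Variable R : realType.
Local Notation C := (Cplx R).
Local Notation M1 := (measurableTypeR R).
Local Notation M4 := ((M1 * M1) * (M1 * M1))%type.
Local Notation mu4 := (@leb2 R \x @leb2 R)%E.

Lemma cvg_rV (T : Type) (F : set_system T) {FF : Filter F} (f : T -> C3 R) (l : C3 R) :
  (forall j, (fun t => f t ord0 j : C) @ F --> (l ord0 j : C)) -> f @ F --> l.
Proof.
move=> h; apply/cvg_ballP => e e0.
have : \forall t \near F, forall j : 'I_3, ball (l ord0 j) e (f t ord0 j).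
  by apply: filter_forall => j; move/cvg_ballP: (h j); apply.
apply: filterS => t ht; split=> // i j; rewrite (ord1 i); exact: ht.
Qed.

Lemma ucoord_continuous (w : R4 R) : (fun x : R4 R => ucoord x : C) @ w --> (ucoord w : C).
Proof.
by apply: cvg_Complex => /=; apply: (cvg_comp _ _ cvg_fst); [exact: cvg_fst|exact: cvg_snd].
Qed.

Lemma vcoord_continuous (w : R4 R) : (fun x : R4 R => vcoord x : C) @ w --> (vcoord w : C).
Proof.
by apply: cvg_Complex => /=; apply: (cvg_comp _ _ cvg_snd); [exact: cvg_fst|exact: cvg_snd].
Qed.

Lemma cov_continuous (w : R4 R) : (@cov R) @ w --> cov w.
Proof.
have cu := @ucoord_continuous w; have cv := @vcoord_continuous w.
apply: cvg_rV => j; case: (I3P j) => ->.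
- have -> : (fun t => cov t ord0 i1 : C) = (fun t => ucoord t * ucoord t) by apply/funext => t; rewrite covE expr2.
  by rewrite covE expr2; exact: (cvgM cu cu).
- have -> : (fun t => cov t ord0 i2 : C) = (fun t => vcoord t * vcoord t) by apply/funext => t; rewrite covE expr2.
  by rewrite covE expr2; exact: (cvgM cv cv).
- have -> : (fun t => cov t ord0 i3 : C) = (fun t => ucoord t * vcoord t) by apply/funext => t; rewrite covE.
  by rewrite covE; exact: (cvgM cu cv).
Qed.

Lemma cov_Z (w : R4 R) : Z (cov w).
Proof. by rewrite /Z /= !covE; ring. Qed.

Lemma sqnorm_continuous : continuous (@sqnorm R).
Proof.
move=> p; have c (j : 'I_3) : (fun x : C3 R => cmod (x ord0 j)) @ p --> cmod (p ord0 j).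
  exact: (cvg_cmod (@cvg_coord R j p)).
have -> : @sqnorm R = fun p => cmod (p ord0 i1) * cmod (p ord0 i1)
    + cmod (p ord0 i2) * cmod (p ord0 i2) + cmod (p ord0 i3) * cmod (p ord0 i3).
  by apply/funext => x; rewrite sqnormE !expr2.
exact: (cvgD (cvgD (cvgM (c i1) (c i1)) (cvgM (c i2) (c i2))) (cvgM (c i3) (c i3))).
Qed.

Lemma open_B r : open (@B R r).
Proof.
rewrite (_ : @B R r = @sqnorm R @^-1` [set x | x < r ^+ 2]).
  by apply: open_comp; [move=> p _; exact: sqnorm_continuous|exact: open_lt].
by apply/seteqP; split=> p /BE.
Qed.

Lemma closed_Z : closed (@Z R).
Proof.
have c j : continuous (fun p : C3 R => p ord0 j : C) by move=> p; exact: (@cvg_coord R j p).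
have cz : continuous (fun p : C3 R => p ord0 i1 * p ord0 i2 - p ord0 i3 * p ord0 i3 : C).
  by move=> p; exact: (cvgB (cvgM (c i1 p) (c i2 p)) (cvgM (c i3 p) (c i3 p))).
have -> : @Z R = (fun p : C3 R => p ord0 i1 * p ord0 i2 - p ord0 i3 * p ord0 i3 : C) @^-1` [set 0].
  by apply/seteqP; split=> p; rewrite /Z /= expr2.
apply: preimage_closed; first by move=> p _; exact: cz.
by apply: accessible_closed_set1; apply: hausdorff_accessible; exact: norm_hausdorff.
Qed.

Lemma chart_domE (V U : set (C3 R)) (w : R4 R) : V = @Z R `&` U ->
  chart_dom V w <-> 0 < w.1.1 /\ U (cov w).
Proof.
move=> ->; rewrite /chart_dom /=; split=> [[h1 [_ h2]]//|[h1 h2]]; do !split=> //.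
exact: cov_Z.
Qed.

Lemma open_chart_dom (V U : set (C3 R)) : open U -> V = @Z R `&` U -> open (chart_dom V).
Proof.
move=> oU VU; rewrite openE => w /(chart_domE _ VU)[w1 w2].
have h1 : \forall x \near w, 0 < x.1.1.
  have c : (fun x : R4 R => x.1.1) @ w --> w.1.1 by apply: (cvg_comp _ _ cvg_fst); exact: cvg_fst.
  exact: (c _ (lt_nbhsr w1)).
have h2 : \forall x \near w, U (cov x).
  exact: (@cov_continuous w _ (open_nbhs_nbhs (conj oU w2))).
apply: filterS2 h1 h2 => x x1 x2.
by apply/(chart_domE _ VU).
Qed.

Lemma mnorm_lt_radius (w : R4 R) r : sqnorm (cov w) < r ^+ 2 -> mnorm w < 1 + 2 * `|r|.
Proof.
move=> hw; have h0 := mnorm_ge0 w; have h1 := mnorm_cov w.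
have h2 : len (cov w) <= `|r|.
  by rewrite -(@ler_pXn2r _ 2) ?nnegrE ?len_ge0// len_sqr real_normK ?num_real// ltW.
have r0 := normr_ge0 r.
by rewrite ltNge; apply/negP => h3; nra.
Qed.

Lemma chart_dom_box (V : set (C3 R)) r : V `<=` XB r -> chart_dom V `<=` box 0 (1 + 2 * `|r|).
Proof.
move=> Vr w [_ /Vr[_ /BE hw]]; apply: mnorm_lt; rewrite sub0r mnormN.
exact: mnorm_lt_radius.
Qed.

Lemma chart_dom_finite (V : set (C3 R)) r : open (chart_dom V) -> V `<=` XB r ->
  (mu4 (chart_dom V) < +oo)%E.
Proof.
move=> oV Vr; have h0 : 0 <= 1 + 2 * `|r| by rewrite addr_ge0// mulr_ge0.
apply: (@le_lt_trans _ _ (mu4 (box 0 (1 + 2 * `|r|)))); last by rewrite measure_box// ltry.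
apply: le_measure; rewrite ?inE.
- exact: open_measurable4.
- exact: measurable_box.
- exact: chart_dom_box.
Qed.

Section CMeasurable.
Variable D : set M4.
Hypothesis mD : measurable D.

Definition cmeasurable (f : M4 -> C) : Prop :=
  measurable_fun D (fun w => complex.Re (f w)) /\
  measurable_fun D (fun w => complex.Im (f w)).

Lemma cmeasurable_cst c : cmeasurable (fun=> c).
Proof. by split; exact: measurable_cst. Qed.

Lemma cmeasurableD f g : cmeasurable f -> cmeasurable g -> cmeasurable (fun w => f w + g w).
Proof.
move=> [f1 f2] [g1 g2]; split.
  by under eq_fun do rewrite cReD; exact: measurable_funD.
by under eq_fun do rewrite cImD; exact: measurable_funD.
Qed.

Lemma cmeasurableM f g : cmeasurable f -> cmeasurable g -> cmeasurable (fun w => f w * g w).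
Proof.
move=> [f1 f2] [g1 g2]; split.
  by under eq_fun do rewrite cReM; apply: measurable_funB; exact: measurable_funM.
by under eq_fun do rewrite cImM; apply: measurable_funD; exact: measurable_funM.
Qed.

Lemma cmeasurableJ f : cmeasurable f -> cmeasurable (fun w => (f w)^*).
Proof.
move=> [f1 f2]; split.
  by under eq_fun do rewrite cReJ.
by under eq_fun do rewrite cImJ; exact: measurable_funN.
Qed.

Lemma measurable_inv : measurable_fun [set: R] (@GRing.inv R).
Proof.
rewrite (_ : [set: R] = [set 0] `|` ~` [set 0]); last by rewrite setUv.
have m0 : measurable ([set 0] : set R) by exact: measurable_set1.
apply/measurable_funU => //; first exact: measurableC.
split; first exact: measurable_fun_set1.
apply: open_continuous_measurable_fun.
  by apply: closed_openC; exact: closed_eq.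
by move=> x; rewrite inE => /= /eqP x0; exact: inv_continuous.
Qed.

Lemma cmeasurableV f : cmeasurable f -> cmeasurable (fun w => (f w)^-1).
Proof.
move=> [f1 f2].
have mn : measurable_fun D (fun w => (complex.Re (f w) ^+ 2 + complex.Im (f w) ^+ 2)^-1).
  apply: (measurableT_comp measurable_inv).
  by apply: measurable_funD; exact: measurable_funX.
split.
  by under eq_fun do rewrite cReV; exact: measurable_funM.
by under eq_fun do rewrite cImV; apply: measurable_funM => //; exact: measurable_funN.
Qed.

Lemma cmeasurable_continuous (f : R4 R -> C) : open (D : set (R4 R)) ->
  (forall w, D w -> f @ w --> f w) -> cmeasurable f.
Proof.
move=> oD cf; split; apply: (continuous_measurable4 oD) => w Dw.
  exact: (cvg_Re (cf w Dw)).
exact: (cvg_Im (cf w Dw)).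
Qed.

End CMeasurable.
End CovTopology.

(** * Regularity of the kernel *)

Section KernelRegularity.
Variable R : realType.
Local Notation C := (Cplx R).
Local Notation N12 := ((3 + 3) + (3 + 3))%N.
Variables (T : Type) (P : (T -> C) -> Prop).
Hypothesis hP : subalgebra P.
Hypothesis PJ : forall f, P f -> P (fun t => (f t)^*).
Let Pcst := sub_cst hP.
Let PD := subD hP.
Let PM := subM hP.

Definition Pvec (p : T -> C3 R) := forall j, P (fun t => p t ord0 j).

Lemma PN f : P f -> P (fun t => - f t).
Proof. by move=> h; under eq_fun do rewrite -mulN1r; exact: PM. Qed.

Lemma PvecB p q : Pvec p -> Pvec q -> Pvec (fun t => p t - q t).
Proof.
by move=> hp hq j; under eq_fun do rewrite !mxE; apply: PD => //; exact: PN.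
Qed.

Lemma coefs_cform p : Pvec p -> coefs P (fun t => cform (p t)).
Proof.
move=> hp; apply: (coefs_sum hP) => j _; apply: (coefs_scal hP); first exact: PJ.
exact: (coefs_cst hP).
Qed.

Lemma P_norm2 p : Pvec p -> P (fun t => norm2 (p t)).
Proof.
move=> hp; under eq_fun do rewrite norm2_conj.
by apply: (closed_sum hP) => j _; apply: PM; [exact: hp|exact: PJ].
Qed.

Lemma coefs_ds p e : Pvec p -> P (fun t => (twopii R * norm2 (p t))^-1) ->
  coefs P (fun t => ds (p t) e).
Proof.
move=> hp hV; apply: (coefsD hP); apply: (coefs_scal hP).
- apply: PM; last first.
    by under eq_fun do rewrite expr2; exact: PM.
  apply: PN; apply: PM; first exact: Pcst.
  apply: (closed_sum hP) => j _; apply: PD; apply: PM.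
  + exact: Pcst.
  + exact: PJ.
  + exact: hp.
  + exact: Pcst.
- exact: coefs_cform.
- exact: hV.
- exact: (coefs_cst hP).
Qed.

Lemma coefs_wirt (F : T -> C3 R -> ext R N12) j : (forall e, coefs P (fun t => F t e)) ->
  coefs P (fun t => wirt (F t) j).
Proof.
move=> h; apply: (coefs_scal hP); first exact: Pcst.
apply: (coefsD hP); first exact: h.
by apply: (coefs_scal hP); [exact: Pcst|exact: h].
Qed.

(** [sigma] is only controlled on the support of [dbar chi], hence a joint
    hypothesis on the two. *)
Lemma coefs_kernel_rhs chi (zeta z : T -> C3 R) : Pvec zeta -> Pvec z ->
  P (fun t => chi (zeta t)) ->
  P (fun t => (twopii R * norm2 (zeta t - z t))^-1) ->
  coefs P (fun t => dbarchi chi (zeta t) /w\ sigma (zeta t) (z t)) ->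
  coefs P (fun t => kernel_rhs chi (zeta t) (z t)).
Proof.
move=> hzeta hz hchi hV hsig; have heta := PvecB hzeta hz.
have hs : coefs P (fun t => s (zeta t) (z t)).
  under eq_fun do rewrite sE; apply: (coefs_scal hP); [exact: hV|exact: coefs_cform].
have hd : coefs P (fun t => dbars (zeta t) (z t)).
  apply: (coefs_sum hP) => j _.
  by apply: (coefsD hP); apply: (coefs_wedge hP); [exact: (coefs_cst hP)| |exact: (coefs_cst hP)|];
    apply: coefs_wirt => e; exact: coefs_ds.
have hlin j k : coefs P (fun t => scal (zeta t ord0 j + z t ord0 j) (deta R k)).
  by apply: (coefs_scal hP); [exact: PD|exact: (coefs_cst hP)].
apply: (coefs_wedge hP).
  apply: (coefsD hP); last by apply: (coefsN hP); exact: hlin.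
  apply: (coefs_scal hP); first exact: Pcst.
  by apply: (coefsD hP); exact: hlin.
apply: (coefsD hP); last by apply: (coefsN hP); exact: (coefs_wedge hP).
by apply: (coefs_scal hP); [exact: hchi|exact: (coefs_wedge hP)].
Qed.

Lemma coefs_sigma (zeta z : T -> C3 R) : Pvec zeta ->
  P (fun t => (twopii R * (norm2 (zeta t) - \sum_(j < 3) (zeta t ord0 j)^* * z t ord0 j))^-1) ->
  coefs P (fun t => sigma (zeta t) (z t)).
Proof. by move=> hzeta hV; apply: (coefs_scal hP); [exact: hV|exact: coefs_cform]. Qed.

Lemma coefs_dbarchi chi (zeta : T -> C3 R) :
  (forall j, P (fun t => dzbar_deriv j chi (zeta t))) ->
  coefs P (fun t => dbarchi chi (zeta t)).
Proof.
move=> h; apply: (coefs_sum hP) => j _.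
by apply: (coefs_scal hP); [exact: h|exact: (coefs_cst hP)].
Qed.

End KernelRegularity.

(** * Continuity of Koppelman integrals *)

Section KoppelmanContinuity.
Variable R : realType.
Local Notation C := (Cplx R).
Local Notation N12 := ((3 + 3) + (3 + 3))%N.
Local Notation M1 := (measurableTypeR R).
Local Notation M4 := ((M1 * M1) * (M1 * M1))%type.
Local Notation mu4 := (@leb2 R \x @leb2 R)%E.
Implicit Types (V : set (C3 R)).

(** Compositions satisfy more than [continuous_form_at]: their own coefficients
    are continuous. *)
Definition continuous_form V (q : nat) (phi : form3 R) : Prop :=
  (forall p, V p -> has_bideg 0 q (phi p)) /\
  (forall p S, V p -> (fun x => phi x S : C) @ within V (nbhs p) --> (phi p S : C)).

Lemma cvg_subalgebra (T : topologicalType) (F : set_system T) {FF : Filter F} (t0 : T) :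
  subalgebra (fun f : T -> C => f @ F --> (f t0 : C)).
Proof.
split=> [c|f g hf hg|f g hf hg]; first exact: cvg_cst.
  exact: (cvgD hf hg).
exact: (cvgM hf hg).
Qed.

Lemma cmeasurable_subalgebra (D : set M4) : measurable D -> subalgebra (cmeasurable D).
Proof. by move=> mD; split; [exact: cmeasurable_cst|exact: cmeasurableD|exact: cmeasurableM]. Qed.

Lemma cmeasurable_cov (D : set M4) : open (D : set (R4 R)) ->
  Pvec (cmeasurable D) (fun w : M4 => cov w).
Proof.
move=> oD j; apply: cmeasurable_continuous => // w _.
exact: (cvg_comp _ _ (@cov_continuous R w) (@cvg_coord R j (cov w))).
Qed.

Lemma cmeasurable_comp_cov V U (D : set M4) (f : C3 R -> C) :
  open U -> V = @Z R `&` U -> D = chart_dom V ->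
  (forall p, V p -> f @ within V (nbhs p) --> f p) ->
  cmeasurable D (fun w => f (cov w)).
Proof.
move=> oU VU DV hf; rewrite DV; have oD := open_chart_dom oU VU.
apply: cmeasurable_continuous => // w Dw.
have Vw : V (cov w) by case: Dw.
apply: (cvg_comp (@cov R) f _ (hf _ Vw)).
move=> A; rewrite /within /= => hA.
have h1 := @cov_continuous R w _ hA.
have h2 : nbhs w (chart_dom V) by exact: open_nbhs_nbhs.
apply: filterS2 h2 h1 => x Dx hx; exact: (hx Dx.2).
Qed.

Lemma coefs_cov_diff (P : (M4 -> C) -> Prop) i : subalgebra P ->
  (forall f, P f -> P (fun w => (f w)^*)) ->
  P (fun w => ucoord w) -> P (fun w => vcoord w) ->
  coefs P (fun w : M4 => cov_diff w i).
Proof.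
move=> hP PJ mu mv.
have mdu j : P (fun w : M4 => cov_du w j).
  case: (I3P j) => ->; under eq_fun do rewrite cov_duE.
  - exact: (subM hP (sub_cst hP _) mu).
  - exact: (sub_cst hP).
  - exact: mv.
have mdv j : P (fun w : M4 => cov_dv w j).
  case: (I3P j) => ->; under eq_fun do rewrite cov_dvE.
  - exact: (sub_cst hP).
  - exact: (subM hP (sub_cst hP _) mv).
  - exact: mu.
rewrite /cov_diff; case: (fintype.split i) => j; apply: (coefsD hP);
  apply: (coefs_scal hP); try exact: (coefs_cst hP).
- exact: mdu.
- exact: mdv.
- exact: PJ.
- exact: PJ.
Qed.

Lemma cmeasurable_uv (D : set M4) : measurable D -> open (D : set (R4 R)) ->
  cmeasurable D (fun w : M4 => ucoord w) /\ cmeasurable D (fun w : M4 => vcoord w).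
Proof.
move=> mD oD; split; apply: cmeasurable_continuous => // w _.
  exact: ucoord_continuous.
exact: vcoord_continuous.
Qed.

Lemma pull_gen_cmeasurable (D : set M4) i : measurable D -> open (D : set (R4 R)) ->
  coefs (cmeasurable D) (fun w : M4 => pull_gen w i).
Proof.
move=> mD oD; have hP := cmeasurable_subalgebra mD; have [mu mv] := cmeasurable_uv mD oD.
rewrite /pull_gen; case: (fintype.split i) => k; last exact: (coefs_cst hP).
apply: (coefs_subst hP) => [l|]; first exact: (coefs_cst hP).
exact: (coefs_cov_diff k hP (@cmeasurableJ R D) mu mv).
Qed.

(** Convergence theorems for integrals are about sequences; [A] is a
    neighbourhood in which a bound uniform in [z] is available. *)
Lemma cvg_within_seq V (A : set (C3 R)) (p : C3 R) (f : C3 R -> C) : nbhs p A ->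
  (forall z_ : nat -> C3 R, (forall n, V (z_ n) /\ A (z_ n)) ->
    z_ n @[n --> \oo] --> p -> (f (z_ n) : C) @[n --> \oo] --> (f p : C)) ->
  f @ within V (nbhs p) --> (f p : C).
Proof.
move=> pA h; apply/cvg_cmodP => e e0; apply: contrapT => hn.
have pos n : 0 < ((n.+1%:R : R)^-1)%:C%C :> C by rewrite (ltcR 0) invr_gt0.
have /choice[z_ hz] : forall n, exists z, [/\ V z, A z,
    ball p (((n.+1%:R : R)^-1)%:C%C : C) z & ~ cmod (f p - f z) < e].
  move=> n; apply: contrapT => hx; apply: hn; rewrite /within /=.
  have hb : nbhs p (ball p (((n.+1%:R : R)^-1)%:C%C : C)) by exact: nbhsx_ballx.
  apply: filterS2 hb pA => z zb zA zV; apply: contrapT => he; apply: hx.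
  by exists z.
have cz : z_ n @[n --> \oo] --> p.
  apply/cvg_ballP => a a0; have [a1 a2] : 0 < complex.Re a /\ a = (complex.Re a)%:C%C.
    by move: a0; case: a => x y; rewrite ltcE /= => /andP[/eqP -> ->].
  have hs : \forall n \near \oo, (n.+1%:R : R)^-1 < complex.Re a by exact: near_infty_natSinv_lt (PosNum a1).
  apply: filterS hs => n hs; have [_ _ zb _] := hz n.
  by apply: le_ball zb; rewrite a2 lecR ltW.
have hz' n : V (z_ n) /\ A (z_ n) by have [] := hz n.
have hc : (f (z_ n) : C) @[n --> \oo] --> (f p : C) := h z_ hz' cz.
have hl : \forall n \near \oo, cmod (f p - f (z_ n)) < e.
  exact: ((cvg_cmodP (fun n => f (z_ n)) (f p)).1 hc e e0).
have [n /= hl'] := @filter_ex _ \oo%classic _ _ hl.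
by have [_ _ _] := hz n.
Qed.

(** Two points form a null set, and a function that is measurable off them is
    measurable. *)
Lemma Rintegral_off_points (D : set M4) (f g : M4 -> R) (c : R4 R) : measurable D ->
  measurable_fun D f -> (forall w, D w -> w != c -> w != - c -> f w = g w) ->
  Rintegral mu4 D f = Rintegral mu4 D g.
Proof.
move=> mD mf h; congr fine.
have [mc _] := measure_point c; have [mc' _] := measure_point (- c).
have mg : measurable_fun D g.
  pose E := D `\` ([set c] `|` [set - c]).
  have mE : measurable E by apply: measurableD => //; exact: measurableU.
  apply: (@measurable_funS _ _ _ _ (([set c] `|` [set - c]) `|` E)).
  - by apply: measurableU => //; exact: measurableU.
  - move=> w Dw; have [wc|wc] := pselect (([set c] `|` [set - c]) w); first by left.
    by right.
  apply/measurable_funU => //; first exact: measurableU.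
  split.
    by apply/measurable_funU => //; split; exact: measurable_fun_set1.
  apply: (@eq_measurable_fun _ _ _ _ E f).
    move=> w; rewrite inE => -[Dw nw]; apply: h => //; apply/eqP => wc; apply: nw.
      by left.
    by right.
  by apply: (measurable_funS mD _ mf) => w [].
apply: ae_eq_integral => //; [exact/measurable_EFinP|exact/measurable_EFinP|].
have [n1 sqnorm] := (ae_neq c, ae_neq (- c)).
by apply: filterS2 n1 sqnorm => w wc wc' Dw; rewrite h.
Qed.

Variables (r r' : R) (chi : C3 R -> C) (K : form33 R) (phi : form3 R) (q : nat).
Hypotheses (cut : cutoff r r' chi) (hK : is_Ktilde r r' chi K).
Hypothesis hphi : continuous_form (XB r') q phi.
Variable c : {set 'I_N12} -> C.
Hypothesis c1 : forall B, cmod (c B) <= 1 /\ (c B != 0 -> exists2 x, anti x & B = [set x]%SET).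
Hypothesis hc : forall r r' chi K zeta z, smooth_on setT chi -> is_Ktilde r r' chi K ->
  XB r' zeta -> XB r z -> zeta != z ->
  forall B, K zeta z B = c B * kernel_rhs chi zeta z (zset :|: B)%SET.

(** The formula for the kernel off the diagonal, taken everywhere:
    measurability in [zeta] is then a matter of algebra. *)
Definition kernel_ext (zeta z : C3 R) : ext R N12 :=
  [ffun B : {set 'I_N12} => c B * kernel_rhs chi zeta z (zset :|: B)%SET].

Let D : set M4 := chart_dom (XB r').

Let XBr' : XB r' = @Z R `&` @B R r'. Proof. by []. Qed.

Let oD : open (D : set (R4 R)).
Proof. exact: (open_chart_dom (@open_B R r') XBr'). Qed.

Let mD : measurable D.
Proof. exact: open_measurable4. Qed.

Definition kernel_integrand (S : {set 'I_(3 + 3)}) (w : M4) (z : C3 R) : C :=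
  pull_zeta w (omega (cov w) /w\ kernel_ext (cov w) z /w\ in_zeta (phi (cov w))) (topset S)
  / vol R [set: 'I_(2 + 2)]%SET.

Lemma kernel_integrand_bideg S w z : D w -> kernel_integrand S w z != 0 -> holdeg S = 0%N /\ antideg S = q.-1.
Proof.
move=> [_ Dw]; rewrite /kernel_integrand mulf_eq0 negb_or => /andP[h _].
apply: (pull_koppelman_bideg _ (hphi.1 _ Dw) h) => B.
by rewrite ffunE mulf_eq0 negb_or => /andP[/(c1 B).2].
Qed.

Lemma kernel_integrand_measurable S z : cmeasurable D (fun w => kernel_integrand S w z).
Proof.
have [hchi cchi schi _] := cut.
have hP := cmeasurable_subalgebra mD; have hJ := @cmeasurableJ R D.
have hcov := cmeasurable_cov oD.
have hcont (f : C3 R -> C) : continuous f -> cmeasurable D (fun w : M4 => f (cov w)).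
  move=> cf; apply: (cmeasurable_comp_cov (@open_B R r') XBr' erefl) => p _.
  by apply: cvg_within_filter; exact: cf.
have hz : Pvec (cmeasurable D) (fun=> z) by move=> j; exact: sub_cst.
have hk : coefs (cmeasurable D) (fun w => kernel_rhs chi (cov w) z).
  apply: (coefs_kernel_rhs hP hJ hcov hz).
  - by apply: hcont => p; have [] := hchi [::] p I.
  - apply: cmeasurableV => //; apply: (subM hP (sub_cst hP _)).
    by apply: (P_norm2 hP hJ); exact: (PvecB hP hcov hz).
  - apply: (coefs_wedge hP).
      by apply: (coefs_dbarchi hP) => j; apply: hcont; exact: dzbar_deriv_continuous.
    apply: (coefs_sigma hP hJ hcov); apply: cmeasurableV => //; apply: (subM hP (sub_cst hP _)).
    apply: (subD hP); first exact: (P_norm2 hP hJ).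
    apply: (PN hP); apply: (closed_sum hP) => j _; apply: (subM hP); last exact: sub_cst.
    exact: hJ.
apply: (subM hP _ (sub_cst hP _)).
apply: (coefs_subst hP) => [i|]; first exact: pull_gen_cmeasurable.
apply: (coefs_wedge hP); last first.
  apply: (coefs_subst hP) => [i|]; first exact: (coefs_cst hP).
  move=> T; exact: (@cmeasurable_comp_cov _ _ D (fun p => phi p T) (@open_B R r') XBr' erefl
    (fun p Vp => hphi.2 p T Vp)).
apply: (coefs_wedge hP).
  apply: (coefs_scal hP); last exact: (coefs_cst hP).
  by apply: cmeasurableV => //; apply: (subM hP (sub_cst hP _)).
move=> B; under eq_fun do rewrite ffunE.
exact: (subM hP (sub_cst hP _)).
Qed.

Lemma kernel_integrand_cvg S w z0 : XB r z0 -> cov w != z0 ->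
  (fun z => kernel_integrand S w z) @ within (XB r) (nbhs z0) --> kernel_integrand S w z0.
Proof.
move=> Xz0 wz0; have [hchi cchi schi _] := cut.
pose F := within (XB r) (nbhs z0).
pose P (f : C3 R -> C) := f @ F --> (f z0 : C).
have hP : subalgebra P by exact: cvg_subalgebra.
have hJ (f : C3 R -> C) : P f -> P (fun t => (f t)^*).
  exact: cvg_conj.
have hz : Pvec P id.
  by move=> j; apply: cvg_within_filter; exact: (@cvg_coord R j z0).
have hw : Pvec P (fun=> cov w).
  by move=> j; exact: cvg_cst.
have hV (f : C3 R -> C) : f z0 != 0 -> P f -> P (fun t => (f t)^-1).
  by move=> f0; exact: cvgV.
have hk : coefs P (fun z => kernel_rhs chi (cov w) z).
  apply: (@coefs_kernel_rhs R _ P hP hJ chi (fun=> cov w) id hw hz).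
  - exact: cvg_cst.
  - apply: hV; first by rewrite mulf_neq0 ?twopii_neq0// norm2_neq0// subr_eq0.
    apply: (subM hP (sub_cst hP _)).
    by apply: (P_norm2 hP hJ); exact: (PvecB hP hw hz).
  - have [d0|dn] := dbarchi_near (cov w) cut.
      under eq_fun do rewrite d0 wedge0l; exact: (coefs_cst hP).
    apply: (coefs_wedge hP); first exact: (coefs_cst hP).
    apply: (@coefs_sigma R _ P hP hJ (fun=> cov w) id hw); apply: hV.
      rewrite mulf_neq0 ?twopii_neq0// -cmod_eq0 gt_eqF//.
      apply: lt_le_trans (sigma_den _ _); case: Xz0 => _ /BE hz0.
      by rewrite divr_gt0// subr_gt0; exact: lt_trans dn.
    apply: (subM hP (sub_cst hP _)); apply: (subD hP); first exact: (P_norm2 hP hJ).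
    apply: (PN hP); apply: (closed_sum hP) => j _; apply: (subM hP); last exact: hz.
    exact: (sub_cst hP).
apply: (subM hP _ (sub_cst hP _)).
apply: (coefs_subst hP) => [i|]; first exact: (coefs_cst hP).
apply: (coefs_wedge hP); last exact: (coefs_cst hP).
apply: (coefs_wedge hP); first exact: (coefs_cst hP).
move=> B.
have -> : (fun z => kernel_ext (cov w) z B) = (fun z => c B * kernel_rhs chi (cov w) z (zset :|: B)%SET).
  by apply/funext => z; rewrite ffunE.
exact: (subM hP (sub_cst hP (c B)) (hk _)).
Qed.

Lemma enorm_kernel_ext zeta z :
  enorm (kernel_ext zeta z) <= #|{set 'I_N12}|%:R * enorm (kernel_rhs chi zeta z).
Proof.
rewrite mulr_natl -sumr_const; apply: ler_sum => B _.
rewrite ffunE cmodM -[leRHS]mul1r; apply: ler_pM; rewrite ?cmod_ge0 ?cmod_le_enorm//.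
by have [] := c1 B.
Qed.

Lemma kernel_ext_off_supp zeta z : ~ supp chi zeta -> kernel_ext zeta z = 0.
Proof.
move=> nz; have c0 : chi zeta = 0 by exact: nbhs_singleton (off_supp nz).
have k0 : kernel_rhs chi zeta z = 0.
  by rewrite /kernel_rhs (dbarchi_supp nz) !wedge0l c0 scal0l subr0 wedge0r.
by apply/ffunP => B; rewrite [LHS]ffunE k0 !zeroextE mulr0.
Qed.

Lemma phi_bound : exists2 F, 0 <= F &
  forall p, Z p -> supp chi p -> enorm (phi p) <= F.
Proof.
have [_ cchi schi _] := cut.
pose A := @Z R `&` supp chi.
have cA : compact A.
  rewrite /A setIC; apply: compact_closedI => //; exact: closed_Z.
have AX : A `<=` XB r' by move=> p [Zp /schi].
have [S|F _ hF] := @compact_bound _ A (fun p => enorm (phi p)) cA.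
  move=> AS; rewrite /enorm; apply: cvg_big => [|T _]; first exact: add_continuous.
  apply: (cvg_cmod (l := phi S T)); apply: cvg_trans (hphi.2 S T (AX _ AS)).
  by apply: cvg_app; exact: within_subset.
exists `|F| => // p Zp cp; apply: le_trans (ler_norm _) _.
apply: le_trans (hF p (conj Zp cp)) (ler_norm _).
Qed.

(** The bounds of the kernel and of the pull-back combine to [cov_kernel_le].
    The point [z = cov v] stays in a smaller ball because the bound of [sigma]
    degenerates when [z] approaches the sphere of radius [r]. *)
Lemma kernel_integrand_bound rho : rho < r ^+ 2 -> exists2 M, 0 <= M &
  forall S w v, D w -> sqnorm (cov v) <= rho -> w != v -> w != - v ->
  cmod (kernel_integrand S w (cov v)) <= M * inv_cubes v w.
Proof.
move=> hrho.
have [A A0 hA] := kernel_rhs_bound (r' ^+ 2) cut hrho.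
have [F F0 hF] := phi_bound.
pose t := cmod (vol R [set: 'I_(2 + 2)]%SET)^-1.
pose N : R := #|{set 'I_N12}|%:R.
pose W := 1 + 2 * `|r| + 2 * `|r'|.
have W0 : 0 <= W by rewrite !addr_ge0// mulr_ge0.
have N0 : 0 <= N by exact: ler0n.
have t0 : 0 <= t by exact: cmod_ge0.
pose M1 := 8 * N * A * F * t.
have M10 : 0 <= M1 by rewrite !mulr_ge0.
exists (M1 * (512 * (8 * (2 * W)))).
  apply: (mulr_ge0 M10).
  by do 3 (apply: mulr_ge0; first exact: ler0n).
move=> S w v [w1 [Zw /BE hw]] hv wv wNv.
have covwv : cov w != cov v.
  by apply: contraNN wv => /eqP/cov_eq[->|h] //; rewrite h eqxx in wNv.
have mw : mnorm w <= W.
  apply: (le_trans (ltW (mnorm_lt_radius hw))).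
  by rewrite /W; have := normr_ge0 r; lra.
have mv : mnorm v <= W.
  apply: (le_trans (ltW (mnorm_lt_radius (le_lt_trans hv hrho)))).
  by rewrite /W; have := normr_ge0 r'; lra.
have hcov := cov_kernel_le W0 mw mv wv wNv.
rewrite -mulrA; apply: le_trans (ler_wpM2l M10 hcov).
rewrite /kernel_integrand cmodM -/t.
have ws := sqr_ge0 (wsize w).
set Q := _ / _; have Q0 : 0 <= Q.
  apply: mulr_ge0; last by rewrite invr_ge0 exprn_ge0// len_ge0.
  by apply: mulr_ge0 => //; rewrite addr_ge0 ?l1norm_ge0.
have -> : M1 * Q = 8 * N * A * F * Q * t by rewrite /M1; ring.
apply: ler_wpM2r => //; apply: (le_trans (pull_koppelman_bound _ _ _ _)).
have [cw|ncw] := pselect (supp chi (cov w)); last first.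
  rewrite (kernel_ext_off_supp _ ncw) enorm0 mulr0 mul0r.
  by do 4 (apply: mulr_ge0; last by []); exact: ler0n.
have hk : enorm (kernel_ext (cov w) (cov v)) <= N * (A * (l1norm (cov w) + l1norm (cov v)) / len (cov w - cov v) ^+ 3).
  apply: (le_trans (enorm_kernel_ext _ _)); apply: ler_wpM2l => //.
  exact: (hA _ _ hv (ltW hw) covwv).
have hp := hF _ Zw cw.
have -> : 8 * N * A * F * Q = 8 * wsize w ^+ 2 * (N * (A * (l1norm (cov w) + l1norm (cov v)) / len (cov w - cov v) ^+ 3)) * F.
  by rewrite /Q; ring.
have ws8 : 0 <= 8 * wsize w ^+ 2 by apply: mulr_ge0 => //; exact: ler0n.
apply: ler_pM => //; last exact: ler_wpM2l.
  by apply: mulr_ge0 => //; exact: enorm_ge0.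
exact: enorm_ge0.
Qed.

(** [K] is unspecified where [zeta = z], that is, over the two preimages of
    [z]. *)
Lemma koppelman_opE z S : XB r z ->
  koppelman_op r' K phi z S = Cintegral D (fun w => kernel_integrand S w z).
Proof.
move=> Xz; have [v hv] := cov_surj Xz.1; have [hchi _ _ _] := cut.
rewrite /koppelman_op ffunE /Cintegral.
have [m1 m2] := kernel_integrand_measurable S z.
have hE w : D w -> w != v -> w != - v -> kernel_integrand S w z =
    pull_zeta w (omega (cov w) /w\ K (cov w) z /w\ in_zeta (phi (cov w))) (topset S)
    / vol R [set: 'I_(2 + 2)]%SET.
  move=> [_ Dw] wv wNv.
  have ne : cov w != z.
    by rewrite -hv; apply: contraNN wv => /eqP/cov_eq[->|h] //; rewrite h eqxx in wNv.
  rewrite /kernel_integrand; congr (pull_zeta w (_ /w\ _ /w\ _) _ / _).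
  by apply/ffunP => B; rewrite ffunE (hc hchi hK Dw Xz ne).
have hRe := Rintegral_off_points mD m1 (fun w Dw a b => congr1 (@complex.Re R) (hE w Dw a b)).
have hIm := Rintegral_off_points mD m2 (fun w Dw a b => congr1 (@complex.Im R) (hE w Dw a b)).
by rewrite hRe hIm.
Qed.

Lemma koppelman_op_bideg z : XB r z -> has_bideg 0 q.-1 (koppelman_op r' K phi z).
Proof.
move=> Xz S; rewrite (koppelman_opE _ Xz) => h; apply: contrapT => hS.
have k0 w : D w -> kernel_integrand S w z = 0.
  by move=> Dw; apply: contrapT => /eqP/(kernel_integrand_bideg Dw).
move/eqP: h; apply; rewrite /Cintegral.
have z0 (f : M4 -> R) : (forall w, D w -> f w = 0) -> Rintegral mu4 D f = 0.
  by move=> hf; rewrite /Rintegral integral0_eq// => w Dw; rewrite hf.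
rewrite (z0 _ (fun w Dw => congr1 (@complex.Re R) (k0 w Dw))).
by rewrite (z0 _ (fun w Dw => congr1 (@complex.Im R) (k0 w Dw))).
Qed.

(** Lifting a sequence [z_n] to points [v_n] of the covering gives integrands
    with the common majorant [M * inv_cubes v_n], although the [v_n] themselves
    need not converge to [v]: only the kernels do, pointwise. *)
Lemma koppelman_op_cvg z0 S : XB r z0 -> (fun z => koppelman_op r' K phi z S : C)
  @ within (XB r) (nbhs z0) --> (koppelman_op r' K phi z0 S : C).
Proof.
move=> Xz0; have /BE hz0 := Xz0.2.
pose rho := (sqnorm z0 + r ^+ 2) / 2.
have r1 : sqnorm z0 < rho by rewrite /rho; lra.
have r2 : rho < r ^+ 2 by rewrite /rho; lra.
have [M M0 hM] := kernel_integrand_bound r2.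
have hA : nbhs z0 [set z | sqnorm z < rho].
  exact: (@sqnorm_continuous R z0 _ (lt_nbhsl r1)).
apply: (cvg_within_seq hA) => z_ hz cz.
have [v hv] := cov_surj Xz0.1.
have /choice[v_ hv_] n : exists v, cov v = z_ n.
  by apply: cov_surj; have [[]] := hz n.
have -> : (fun n => koppelman_op r' K phi (z_ n) S : C) =
    (fun n => Cintegral D (fun w => kernel_integrand S w (z_ n))).
  by apply/funext => n; have [Xn _] := hz n; rewrite (koppelman_opE S Xn).
rewrite (koppelman_opE S Xz0).
have fD : (mu4 D < +oo)%E by exact: (chart_dom_finite oD (fun _ h => h)).
have czn w : D w -> w != v -> w != - v ->
    (kernel_integrand S w (z_ n) : C) @[n --> \oo] --> (kernel_integrand S w z0 : C).
  move=> Dw wv wNv.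
  have ne : cov w != z0.
    by rewrite -hv; apply: contraNN wv => /eqP/cov_eq[->|h] //; rewrite h eqxx in wNv.
  have cz' : z_ n @[n --> \oo] --> within (XB r) (nbhs z0).
    move=> A hA'; have hn : \forall n \near \oo, XB r (z_ n) -> A (z_ n) by exact: (cz _ hA').
    by apply: filterS hn => n; apply; have [] := hz n.
  exact: (cvg_comp _ _ cz' (kernel_integrand_cvg Xz0 ne)).
have wsg (f : C -> R) z u : (forall x, `|f x| <= cmod x) -> cov u = z -> sqnorm z < rho ->
    weakly_singular D M u (fun w => f (kernel_integrand S w z)).
  move=> hf <- hu w Dw wu wNu; apply: (le_trans (hf _)).
  by apply: hM => //; exact: ltW.
have key (f : C -> R) : (forall x, `|f x| <= cmod x) ->
    (forall z, measurable_fun D (fun w => f (kernel_integrand S w z))) ->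
    (forall w, D w -> w != v -> w != - v -> f (kernel_integrand S w (z_ n)) @[n --> \oo] --> f (kernel_integrand S w z0)) ->
    Rintegral mu4 D (fun w => f (kernel_integrand S w (z_ n))) @[n --> \oo] -->
    Rintegral mu4 D (fun w => f (kernel_integrand S w z0)).
  move=> hf mf cf; apply: (@weakly_singular_cvg R D M v_ v) => //.
    by move=> n; apply: wsg => //; have [] := hz n.
  exact: wsg.
apply: cvg_Complex => /=.
- apply: (key (@complex.Re R)) => [x|z|w Dw wv wNv]; first exact: Re_le_cmod.
    by have [] := kernel_integrand_measurable S z.
  exact: (cvg_Re (czn w Dw wv wNv)).
- apply: (key (@complex.Im R)) => [x|z|w Dw wv wNv]; first exact: Im_le_cmod.
    by have [] := kernel_integrand_measurable S z.
  exact: (cvg_Im (czn w Dw wv wNv)).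
Qed.

End KoppelmanContinuity.

Section KoppelmanOperator.
Variable R : realType.

Lemma koppelman_continuous (r r' : R) chi K phi q : cutoff r r' chi ->
  is_Ktilde r r' chi K -> continuous_form (XB r') q phi ->
  continuous_form (XB r) q.-1 (koppelman_op r' K phi).
Proof.
move=> cut hK hphi; have [c [c1 hc]] := Ktilde_coef R.
split=> [p Vp|p S Vp].
  exact: (koppelman_op_bideg cut hK hphi c1 hc Vp).
exact: (koppelman_op_cvg cut hK hphi c1 hc Vp).
Qed.

End KoppelmanOperator.

(** * Compositions *)

Section Composition.
Variable R : realType.
Local Notation C := (Cplx R).
Implicit Types (V : set (C3 R)).

Lemma degD (S A : {set 'I_(3 + 3)}) : A \subset S ->
  holdeg S = (holdeg A + holdeg (S :\: A)%SET)%N /\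
  antideg S = (antideg A + antideg (S :\: A)%SET)%N.
Proof.
move=> AS; have key (f : 'I_3 -> 'I_(3 + 3)) : #|[set j | f j \in S]%SET| =
    (#|[set j | f j \in A]%SET| + #|[set j | f j \in (S :\: A)%SET]%SET|)%N.
  rewrite -(cardsID [set j | f j \in A]%SET); congr (_ + _)%N; apply: eq_card => j.
    by rewrite !inE andb_idl// => /(fintype.subsetP AS).
  by rewrite !inE.
by split; exact: key.
Qed.

Lemma continuous_form_wedge V p q a b : continuous_form V p a ->
  continuous_form V q b -> continuous_form V (p + q) (fun x => a x /w\ b x).
Proof.
move=> [a1 a2] [b1 b2]; split=> [x Vx S /wedge_neq0[A [AS aA bA]]|x S Vx].
  have [h1 h2] := a1 _ Vx _ aA; have [h3 h4] := b1 _ Vx _ bA.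
  by have [-> ->] := degD AS; rewrite h1 h2 h3 h4.
pose P (f : C3 R -> C) := f @ within V (nbhs x) --> (f x : C).
have hP : subalgebra P by exact: cvg_subalgebra.
by apply: (@coefs_wedge R _ P hP) => T; [exact: a2|exact: b2].
Qed.

Lemma smooth_continuous_form r q (xi : form3 R) : smooth_0q r q xi ->
  continuous_form (XB r) q xi.
Proof.
move=> [U oU [XU sxi hdeg]]; split=> [p Xp|p S Xp]; first exact/hdeg/XU.
by apply: cvg_within_filter; have [] := sxi S [::] p (XU _ Xp).
Qed.

Lemma composition_continuous r q (psi : form3 R) : composition r q psi ->
  continuous_form (XB r) q psi.
Proof.
elim=> {r q psi} [r q xi _|r r' q m phi xi chi K _ hphi _ _ cut hK hxi].
  exact: smooth_continuous_form.
apply: continuous_form_wedge; first exact: smooth_continuous_form.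
exact: koppelman_continuous cut hK hphi.
Qed.

Lemma continuous_form_sub V W q (phi : form3 R) : V `<=` W ->
  continuous_form W q phi -> continuous_form V q phi.
Proof.
move=> VW [h1 h2]; split=> [p /VW/h1//|p S /VW Wp].
by apply: cvg_trans (h2 p S Wp); apply: cvg_app; exact: within_subset.
Qed.

End Composition.

(** * Currents of continuous forms *)

Section CurrentsOfForms.
Variable R : realType.
Local Notation C := (Cplx R).
Local Notation M1 := (measurableTypeR R).
Local Notation M4 := ((M1 * M1) * (M1 * M1))%type.
Local Notation mu4 := (@leb2 R \x @leb2 R)%E.
Implicit Types (V W : set (C3 R)) (D : set M4).

Definition cintegrable D (f : M4 -> C) : Prop :=
  mu4.-integrable D (EFin \o (fun w => complex.Re (f w))) /\
  mu4.-integrable D (EFin \o (fun w => complex.Im (f w))).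

Lemma CintegralD D f g : measurable D -> cintegrable D f -> cintegrable D g ->
  Cintegral D (fun w => f w + g w) = Cintegral D f + Cintegral D g.
Proof.
move=> mD [f1 f2] [g1 g2]; rewrite /Cintegral.
have -> : Rintegral mu4 D (fun w => complex.Re (f w + g w)) =
    Rintegral mu4 D (fun w => complex.Re (f w)) + Rintegral mu4 D (fun w => complex.Re (g w)).
  by rewrite -RintegralD//; congr Rintegral; apply/funext => w; rewrite cReD.
have -> // : Rintegral mu4 D (fun w => complex.Im (f w + g w)) =
    Rintegral mu4 D (fun w => complex.Im (f w)) + Rintegral mu4 D (fun w => complex.Im (g w)).
by rewrite -RintegralD//; congr Rintegral; apply/funext => w; rewrite cImD.
Qed.

Lemma cintegrableD D f g : measurable D -> cintegrable D f -> cintegrable D g ->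
  cintegrable D (fun w => f w + g w).
Proof.
move=> mD [f1 f2] [g1 g2]; split.
  have := integrableD mD f1 g1; congr (integrable _ _ _).
  by apply/funext => w /=; rewrite cReD EFinD.
have := integrableD mD f2 g2; congr (integrable _ _ _).
by apply/funext => w /=; rewrite cImD EFinD.
Qed.

Lemma Cintegral0 D : Cintegral D (fun=> 0) = 0.
Proof. by rewrite /Cintegral /Rintegral /= integral0_eq. Qed.

Lemma cintegrable0 D : cintegrable D (fun=> 0).
Proof. by split; exact: integrable0. Qed.

Lemma Cintegral_sum D (I : Type) (s : seq I) (f : I -> M4 -> C) : measurable D ->
  (forall i, cintegrable D (f i)) ->
  cintegrable D (fun w => \sum_(i <- s) f i w) /\
  Cintegral D (fun w => \sum_(i <- s) f i w) = \sum_(i <- s) Cintegral D (f i).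
Proof.
move=> mD hf; elim: s => [|i s [h1 h2]].
  rewrite big_nil; under eq_fun do rewrite big_nil.
  by split; [exact: cintegrable0|exact: Cintegral0].
rewrite big_cons -h2; under eq_fun do rewrite big_cons.
by split; [exact: cintegrableD|exact: CintegralD].
Qed.

Lemma cintegrable_bounded D f (M : R) : measurable D -> (mu4 D < +oo)%E ->
  cmeasurable D f -> (forall w, D w -> cmod (f w) <= M) -> cintegrable D f.
Proof.
move=> mD fD [m1 m2] h; split.
  apply: (integrable_bounded mD fD (M := M)) => // w Dw.
  exact: le_trans (Re_le_cmod _) (h w Dw).
apply: (integrable_bounded mD fD (M := M)) => // w Dw.
exact: le_trans (Im_le_cmod _) (h w Dw).
Qed.

Definition cbounded D (f : M4 -> C) : Prop := exists M : R, forall w, D w -> cmod (f w) <= M.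

Lemma cbounded_subalgebra D : subalgebra (cbounded D).
Proof.
split=> [c|f g [M hM] [N hN]|f g [M hM] [N hN]].
- by exists (cmod c).
- exists (M + N) => w Dw; apply: (le_trans (cmodD _ _)).
  by apply: lerD; [exact: hM|exact: hN].
exists (M * N) => w Dw; rewrite cmodM.
by apply: ler_pM; rewrite ?cmod_ge0 ?hM ?hN.
Qed.

Definition top_coef (w : M4) (a : ext R (3 + 3)) : C :=
  pull w a [set: 'I_(2 + 2)]%SET / vol R [set: 'I_(2 + 2)]%SET.

Lemma top_coef0 w : top_coef w 0 = 0.
Proof. by rewrite /top_coef /pull subst0 zeroextE mul0r. Qed.

Lemma open_in_X_open V : open_in_X V -> V `<=` XB 1 /\
  exists2 U : set (C3 R), open U & V = @Z R `&` U.
Proof.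
move=> [U oU ->]; split; first exact: subIsetl.
exists (B 1 `&` U); first by apply: openI => //; exact: open_B.
by rewrite /X /XB setIA.
Qed.

(** Cutting a form off outside a compact set makes its coefficients bounded and
    does not affect its product with a test form supported there. *)
Definition cut_form (L : set (C3 R)) (phi : form3 R) : form3 R :=
  fun p => if pselect (L p) then phi p else 0.

Lemma cut_form_in L phi p : L p -> cut_form L phi p = phi p.
Proof. by rewrite /cut_form; case: pselect. Qed.

Lemma cut_form_out L phi p : ~ L p -> cut_form L phi p = 0.
Proof. by rewrite /cut_form; case: pselect. Qed.

Lemma cut_form_bounded D L (phi : form3 R) : compact L ->
  (forall p S, L p -> (fun x => phi x S : C) @ within L (nbhs p) --> (phi p S : C)) ->
  coefs (cbounded D) (fun w => cut_form L phi (cov w)).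
Proof.
move=> cL hphi S; have [p Lp|M M0 hM] := @compact_bound _ L (fun p => cmod (phi p S)) cL.
  exact: (cvg_cmod (hphi p S Lp)).
exists M => w _; have [Lw|nLw] := pselect (L (cov w)).
  by rewrite cut_form_in//; apply: le_trans (ler_norm _) (hM _ Lw).
by rewrite cut_form_out// zeroextE cmod0.
Qed.

Lemma uv_bounded V r : V `<=` XB r -> cbounded (chart_dom V) (fun w => ucoord w) /\
  cbounded (chart_dom V) (fun w => vcoord w).
Proof.
move=> Vr; have h w : chart_dom V w -> mnorm w <= 1 + 2 * `|r|.
  by move=> [_ /Vr[_ /BE hw]]; exact: ltW (mnorm_lt_radius hw).
split; exists ((1 + 2 * `|r|) + (1 + 2 * `|r|)) => w /h; rewrite /mnorm !ge_max.
  move=> /andP[/andP[h1 h2] _]; apply: (le_trans (cmod_le_ReIm _)).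
  exact: lerD h1 h2.
move=> /andP[_ /andP[h1 h2]]; apply: (le_trans (cmod_le_ReIm _)).
exact: lerD h1 h2.
Qed.

(** The coefficient is measurable because [phi] is continuous on [V], and
    bounded because only its values on the support of [tau] matter. *)
Lemma top_coef_integrable V q (phi tau : form3 R) : open_in_X V ->
  continuous_form V q phi -> smooth_form_on setT tau -> compact (supp tau) ->
  supp tau `&` @Z R `<=` V ->
  cintegrable (chart_dom V) (fun w => top_coef w (phi (cov w) /w\ tau (cov w))).
Proof.
move=> hV hphi stau ctau Ltau; have [VX [U oU VU]] := open_in_X_open hV.
pose D : set M4 := chart_dom V.
have oD : open (D : set (R4 R)) by exact: open_chart_dom oU VU.
have mD : measurable D by exact: open_measurable4.
have fD : (mu4 D < +oo)%E by exact: chart_dom_finite oD VX.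
have hP := cmeasurable_subalgebra mD; have [mu mv] := cmeasurable_uv mD oD.
have tauc p S : (fun x => tau x S : C) @ p --> (tau p S : C) by have [] := stau S [::] p I.
have mf : cmeasurable D (fun w => top_coef w (phi (cov w) /w\ tau (cov w))).
  apply: (subM hP _ (sub_cst hP _)); apply: (coefs_subst hP) => [i|].
    exact: (coefs_cov_diff i hP (@cmeasurableJ R D) mu mv).
  apply: (coefs_wedge hP) => S.
    exact: (cmeasurable_comp_cov oU VU erefl (fun p Vp => hphi.2 p S Vp)).
  apply: (@cmeasurable_comp_cov R V U D (fun p => tau p S) oU VU erefl) => p _.
  by apply: cvg_within_filter; exact: tauc.
pose L := @Z R `&` supp tau.
have cL : compact L.
  by rewrite /L setIC; apply: compact_closedI => //; exact: closed_Z.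
have LV : L `<=` V by move=> p [Zp tp]; apply: Ltau.
have hB := @cbounded_subalgebra D.
have BJ f : cbounded D f -> cbounded D (fun w => (f w)^*).
  by move=> [M hM]; exists M => w /hM; rewrite cmodJ.
have [bu bv] := uv_bounded VX.
have : cbounded D (fun w => top_coef w (cut_form L phi (cov w) /w\ cut_form L tau (cov w))).
  apply: (subM hB _ (sub_cst hB _)); apply: (coefs_subst hB) => [i|].
    exact: (coefs_cov_diff i hB BJ bu bv).
  apply: (coefs_wedge hB); apply: cut_form_bounded => // p S Lp.
    apply: cvg_trans (hphi.2 p S (LV _ Lp)).
    by apply: cvg_app; exact: within_subset.
  by apply: cvg_within_filter; exact: tauc.
move=> [M hM]; apply: (cintegrable_bounded mD fD mf (M := M)) => w Dw.
have [Lw|nLw] := pselect (L (cov w)).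
  by have := hM w Dw; rewrite !cut_form_in.
have -> : tau (cov w) = 0.
  by apply: supp_off => tw; apply: nLw; split => //; exact: cov_Z.
by have := hM w Dw; rewrite !cut_form_out// !wedge0r.
Qed.

End CurrentsOfForms.

(** * Test forms *)

Section TestForms.
Variable R : realType.
Local Notation C := (Cplx R).
Local Notation M1 := (measurableTypeR R).
Local Notation M4 := ((M1 * M1) * (M1 * M1))%type.
Local Notation mu4 := (@leb2 R \x @leb2 R)%E.
Implicit Types (V W : set (C3 R)) (D : set M4) (phi tau : form3 R).

Lemma current_ofE V phi tau : current_of V phi tau =
  Cintegral (chart_dom V) (fun w => top_coef w (phi (cov w) /w\ tau (cov w))).
Proof. by []. Qed.

Lemma eq_Cintegral D (f g : M4 -> C) : (forall w, D w -> f w = g w) ->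
  Cintegral D f = Cintegral D g.
Proof.
by move=> h; congr Complex; apply: eq_Rintegral => w; rewrite inE => /h ->.
Qed.

Lemma sub_Cintegral D D' (f g : M4 -> C) : D' `<=` D ->
  (forall w, D' w -> f w = g w) -> (forall w, D w -> ~ D' w -> g w = 0) ->
  Cintegral D' f = Cintegral D g.
Proof.
move=> DD h1 h2; rewrite /Cintegral.
have key (F : C -> R) : F 0 = 0 -> Rintegral mu4 D' (fun w => F (f w)) = Rintegral mu4 D (fun w => F (g w)).
  move=> F0; rewrite Rintegral_mkcond [RHS]Rintegral_mkcond; congr Rintegral.
  apply/funext => w; rewrite /patch.
  have [Dw'|nDw'] := pselect (D' w).
    by rewrite !mem_set ?h1//; exact: DD.
  rewrite memNset//; case: ifPn => //; rewrite inE => Dw.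
  by rewrite h2.
by rewrite (key (@complex.Re R) erefl) (key (@complex.Im R) erefl).
Qed.

Lemma current_of_restrict V W phi tau (rho : C3 R -> C) :
  (forall p, ~ W p -> rho p = 0) ->
  current_of (V `&` W) phi (fun p => scal (rho p) (tau p)) =
  current_of V (fun p => scal (rho p) (phi p)) tau.
Proof.
move=> h; rewrite !current_ofE; apply: sub_Cintegral => [w [w1 [Vw _]]|w _|w [w1 Vw] nw].
- by [].
- by rewrite scal_wedgel scal_wedger.
have nW : ~ W (cov w) by move=> Ww; apply: nw.
by rewrite h// scal0l wedge0l top_coef0.
Qed.

Lemma current_of_sum V q (I : Type) (s : seq I) (psi : I -> form3 R) tau :
  open_in_X V -> (forall i, continuous_form V q (psi i)) -> test_form V q tau ->
  \sum_(i <- s) current_of V (psi i) tau =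
  current_of V (fun p => \sum_(i <- s) psi i p) tau.
Proof.
move=> hV hpsi [stau ctau Vtau _]; rewrite !current_ofE.
have [VX [U oU VU]] := open_in_X_open hV.
have mD : measurable (chart_dom V : set M4) by apply: open_measurable4; exact: open_chart_dom oU VU.
pose f i w := top_coef w (psi i (cov w) /w\ tau (cov w)).
have hf i : cintegrable (chart_dom V) (f i).
  exact: (top_coef_integrable hV (hpsi i) stau ctau Vtau).
have [_ h] := Cintegral_sum s mD hf.
transitivity (\sum_(i <- s) Cintegral (chart_dom V) (f i)); first by [].
rewrite -h; apply: eq_Cintegral => w _.
by rewrite wedge_suml /top_coef /pull subst_sum sumextE mulr_suml.
Qed.

Lemma continuous_form_sum V q (I : Type) (s : seq I) (psi : I -> form3 R) :
  (forall i, continuous_form V q (psi i)) ->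
  continuous_form V q (fun p => \sum_(i <- s) psi i p).
Proof.
move=> h; split=> [p Vp S|p S Vp].
  elim: s => [|i s IH]; first by rewrite big_nil zeroextE eqxx.
  rewrite big_cons addextE; have [->|ni] := eqVneq (psi i p S) 0.
    by rewrite add0r; exact: IH.
  by move=> _; exact: ((h i).1 p Vp S ni).
pose P (f : C3 R -> C) := f @ within V (nbhs p) --> (f p : C).
have hP : subalgebra P by exact: cvg_subalgebra.
by apply: (@coefs_sum R _ P hP) => i _ T; exact: (h i).2.
Qed.

Lemma test_form_scal V W q tau (rho : C3 R -> C) : smooth_on setT rho ->
  supp rho `<=` W -> test_form V q tau ->
  test_form (V `&` W) q (fun p => scal (rho p) (tau p)).
Proof.
move=> srho rW [stau ctau Vtau dtau].
have s1 : supp (fun p => scal (rho p) (tau p)) `<=` supp tau.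
  apply: closureS => p /= /eqP h; apply/eqP => t0; apply: h.
  by apply/ffunP => S; rewrite scalE t0 zeroextE mulr0.
have s2 : supp (fun p => scal (rho p) (tau p)) `<=` supp rho.
  by apply: closureS => p /= /eqP h; apply/eqP => t0; apply: h; rewrite t0 scal0l.
split=> [S|||p S].
- under eq_fun do rewrite scalE.
  exact: (smooth_onM srho (stau S)).
- by apply: (subclosed_compact _ ctau s1); exact: closed_closure.
- by move=> p [tp Zp]; split; [apply: Vtau; split => //; exact: s1|exact/rW/s2].
by rewrite scalE mulf_eq0 negb_or => /andP[_]; exact: dtau.
Qed.

Lemma test_form_sub V V' q tau : V `<=` V' -> test_form V q tau -> test_form V' q tau.
Proof. by move=> VV [h1 h2 h3 h4]; split=> // p /h3/VV. Qed.

Lemma supp0 (T : topologicalType) (M : nmodType) : supp (fun=> 0 : M) = (set0 : set T).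
Proof.
rewrite /supp -[RHS]closure0; congr closure.
by apply/seteqP; split=> // p /=; rewrite eqxx.
Qed.

End TestForms.

Section Currents.
Variable R : realType.
Local Notation C := (Cplx R).
Variables (V : set (C3 R)) (q : nat) (T : form3 R -> C).
Hypothesis hT : is_current V q T.

Lemma test_form0 : test_form V q (fun=> 0 : ext R (3 + 3)).
Proof.
split=> [S|||p S]; rewrite ?supp0.
- under eq_fun do rewrite zeroextE.
  exact: smooth_on_cst.
- exact: compact0.
- by move=> p [].
by rewrite zeroextE eqxx.
Qed.

(** Linearity, applied to the difference of the zero form with itself, gives [T
    0 = 0]. *)
Lemma current0 tau : test_form V q tau -> (forall p, V p -> tau p = 0) -> T tau = 0.
Proof.
move=> ht t0; have [lin heq _] := hT; have h0 := test_form0.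
have -> : T tau = T (fun=> 0 : ext R (3 + 3)).
  by apply: heq => // w _ Vw; rewrite t0.
have := lin (-1) _ _ h0 h0.
have -> : (fun p : C3 R => scal (-1) ((fun=> 0) p) + (fun=> 0) p) = (fun=> 0 : ext R (3 + 3)).
  by apply/funext => p; rewrite addr0; apply/ffunP => S; rewrite scalE zeroextE mulr0.
by move=> ->; rewrite mulN1r addNr.
Qed.

Lemma current_sum (n : nat) (rho : nat -> C3 R -> C) tau :
  (forall i, smooth_on setT (rho i)) -> test_form V q tau ->
  T (fun p => scal (\sum_(i < n) rho i p) (tau p)) =
  \sum_(i < n) T (fun p => scal (rho i p) (tau p)).
Proof.
move=> hr ht; have [lin _ _] := hT.
have tf (r : C3 R -> C) : smooth_on setT r -> test_form V q (fun p => scal (r p) (tau p)).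
  move=> sr; have := @test_form_scal R V setT q tau r sr (fun _ _ => I) ht.
  by rewrite setIT.
elim: n => [|n IH].
  rewrite big_ord0 current0 //; first by apply: tf; apply: smooth_on_sum => i.
  by move=> p _; rewrite big_ord0 scal0l.
rewrite big_ord_recr /= -IH.
have := lin 1 _ _ (tf _ (hr n)) (tf (fun p => \sum_(i < n) rho i p) _).
rewrite mul1r addrC => <-; last by apply: smooth_on_sum => i.
congr T; apply/funext => p; apply/ffunP => S.
by rewrite big_ord_recr /= addextE !scalE mul1r mulrDl addrC.
Qed.

End Currents.

(** * Gluing *)

Section Gluing.
Variable R : realType.
Local Notation C := (Cplx R).
Variables (V : set (C3 R)) (q : nat) (T : form3 R -> C).
Hypotheses (hV : open_in_X V) (hT : is_current V q T).
Variables (beta : nat -> C3 R -> C) (W O : nat -> set (C3 R)) (Psi : nat -> form3 R).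
Hypothesis beta_smooth : forall n, smooth_on setT (beta n).
Hypothesis beta_supp : forall n, supp (beta n) `<=` W n.
Hypothesis W_open : forall n, open (W n).
Hypothesis Psi_cont : forall n, continuous_form (V `&` W n) q (Psi n).
Hypothesis T_local : forall n tau, test_form (V `&` W n) q tau ->
  T tau = current_of (V `&` W n) (Psi n) tau.
Hypothesis O_open : forall n, open (O n).
Hypothesis beta1 : forall n p, O n p -> beta n p = 1.
Hypothesis cover : forall p, V p -> exists n, O n p.

(** A telescoping variant of a partition of unity: the sum is 1 as soon as one
    [beta k] is 1, and all later terms vanish there, which makes the sums
    locally finite. *)
Definition unity (n : nat) (p : C3 R) : C := beta n p * \prod_(i < n) (1 - beta i p).

Lemma sum_unity n p : \sum_(i < n) unity i p = 1 - \prod_(i < n) (1 - beta i p).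
Proof.
elim: n => [|n IH]; first by rewrite !big_ord0 subrr.
by rewrite !big_ord_recr /= IH /unity; set P := \prod_(i < n) _; ring.
Qed.

Lemma prod_beta0 k n p : O k p -> (k < n)%N -> \prod_(i < n) (1 - beta i p) = 0.
Proof.
move=> Ok kn; rewrite (bigD1 (Ordinal kn))//=.
by rewrite (beta1 Ok) subrr mul0r.
Qed.

Lemma sum_unity1 k n p : O k p -> (k < n)%N -> \sum_(i < n) unity i p = 1.
Proof. by move=> Ok kn; rewrite sum_unity (prod_beta0 Ok kn) subr0. Qed.

Lemma unity0 k n p : O k p -> (k < n)%N -> unity n p = 0.
Proof. by move=> Ok kn; rewrite /unity (prod_beta0 Ok kn) mulr0. Qed.

Lemma unity_smooth n : smooth_on setT (unity n).
Proof.
apply: (smooth_onM (beta_smooth n)); apply: smooth_on_prod => i.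
have := smooth_onD (smooth_on_cst 1) (smooth_onM (smooth_on_cst (-1)) (beta_smooth i)).
by under eq_fun do rewrite mulN1r.
Qed.

Lemma unity_supp n : supp (unity n) `<=` W n.
Proof.
apply: subset_trans (@beta_supp n); apply: closureS => p /=.
by rewrite /unity mulf_eq0 negb_or => /andP[].
Qed.

Lemma unity_off n p : ~ W n p -> unity n p = 0.
Proof. by move=> nW; apply: supp_off => /unity_supp. Qed.

Definition partial_glue (n : nat) : form3 R :=
  fun p => \sum_(i < n) scal (unity i p) (Psi i p).

(** Every index [k] with [O k p] gives the same partial sum at [p]. *)
Definition glued_form : form3 R :=
  fun p => partial_glue (xget 0%N [set k | O k p]).+1 p.

Lemma partial_glue_stable k n m p : O k p -> (k < n)%N -> (n <= m)%N ->
  partial_glue m p = partial_glue n p.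
Proof.
move=> Ok kn /subnKC <-; elim: (m - n)%N => [|d IH]; first by rewrite (addn0 n).
rewrite (addnS n d) /partial_glue big_ord_recr /= (unity0 Ok); last exact: leq_trans kn (leq_addr _ _).
by rewrite scal0l addr0; exact: IH.
Qed.

Lemma glueE k n p : O k p -> (k < n)%N -> glued_form p = partial_glue n p.
Proof.
move=> Ok kn; have Ok' : O (xget 0%N [set k | O k p]) p by exact: (@xgetI _ 0%N [set k | O k p] k Ok).
rewrite /glued_form; move: (xget _ _) Ok' => k' Ok'.
rewrite -(partial_glue_stable Ok' (ltnSn k') (leq_addr n k'.+1)).
by rewrite -(partial_glue_stable Ok kn (leq_addl k'.+1 n)).
Qed.

Lemma unity_Psi_cont n : continuous_form V q (fun p => scal (unity n p) (Psi n p)).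
Proof.
split=> [p Vp S|p S Vp].
  rewrite scalE mulf_eq0 negb_or => /andP[r0]; apply: (Psi_cont n).1.
  by split=> //; apply: contrapT => /unity_off/eqP; apply/negP.
under eq_fun do rewrite scalE; rewrite scalE.
have [Wp|nWp] := pselect (W n p).
  apply: cvgM; first by apply: cvg_within_filter; have [] := @unity_smooth n [::] p I.
  move=> A hA; have h1 : \forall x \near p, (V `&` W n) x -> A (Psi n x S).
    exact: ((Psi_cont n).2 p S (conj Vp Wp) A hA).
  have h2 : nbhs p (W n) by exact: open_nbhs_nbhs.
  have h3 : \forall x \near p, V x -> A (Psi n x S).
    by apply: filterS2 h1 h2 => x hx Wx Vx; exact: (hx (conj Vx Wx)).
  exact: h3.
rewrite (unity_off nWp) mul0r; apply: cvg_near_cst; apply: cvg_within.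
have hb : ~ supp (unity n) p by move/unity_supp.
by apply: filterS (off_supp hb) => x ->; rewrite mul0r.
Qed.

Lemma partial_glue_cont n : continuous_form V q (partial_glue n).
Proof. by apply: continuous_form_sum => i; exact: unity_Psi_cont. Qed.

Lemma glue_cont : continuous_form V q glued_form.
Proof.
split=> [p Vp|p S Vp]; have [k Ok] := cover Vp.
  by rewrite (glueE Ok (ltnSn k)); exact: (partial_glue_cont k.+1).1.
rewrite (glueE Ok (ltnSn k)); apply: cvg_trans ((partial_glue_cont k.+1).2 p S Vp).
apply: near_eq_cvg; apply: cvg_within.
have h : nbhs p (O k) by exact: open_nbhs_nbhs.
by apply: filterS h => x Ox; rewrite (glueE Ox (ltnSn k)).
Qed.

(** Finitely many sets [O k] cover the support of [tau] in [Z], so that [T tau]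
    is a finite sum of values [T (unity i * tau)], each given by [Psi i]. *)
Lemma glue_current tau : test_form V q tau -> T tau = current_of V glued_form tau.
Proof.
move=> ht; have [stau ctau Vtau dtau] := ht; have [_ heq _] := hT.
pose L := @Z R `&` supp tau.
have cL : compact L.
  by rewrite /L setIC; apply: compact_closedI => //; exact: closed_Z.
have [N hN] : exists N, forall p, L p -> exists2 k, (k < N)%N & O k p.
  move: cL; rewrite compact_cover => /(_ nat setT O (fun n _ => @O_open n)).
  case=> [p [Zp tp]|E _ hE].
    by have [k Ok] := cover (Vtau p (conj tp Zp)); exists k.
  exists (\max_(i <- finmap.enum_fset E) i).+1 => p /hE[k Ek Ok]; exists k => //.
  by rewrite ltnS; exact: (@leq_bigmax_seq _ (finmap.enum_fset E) xpredT id k Ek isT).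
have offL w : V (cov w) -> ~ L (cov w) -> tau (cov w) = 0.
  move=> Vw nL; apply: supp_off => tw; apply: nL; split => //; exact: cov_Z.
have tf r : smooth_on setT r -> test_form V q (fun p => scal (r p) (tau p)).
  move=> sr; have := @test_form_scal R V setT q tau r sr (fun _ _ => I) ht.
  by rewrite setIT.
have -> : T tau = T (fun p => scal (\sum_(i < N) unity i p) (tau p)).
  apply: (heq _ _ ht); first by apply: tf; apply: smooth_on_sum => i; exact: unity_smooth.
  move=> w _ Vw; congr pull; have [/hN[k kN Ok]|nL] := pselect (L (cov w)).
    by rewrite (sum_unity1 Ok kN) scal1.
  by rewrite (offL w Vw nL); apply/ffunP => S; rewrite scalE zeroextE mulr0.
rewrite (current_sum hT N unity_smooth ht).
have -> : current_of V glued_form tau = current_of V (partial_glue N) tau.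
  rewrite !current_ofE; apply: eq_Cintegral => w [_ Vw].
  have [/hN[k kN Ok]|nL] := pselect (L (cov w)).
    by rewrite (glueE Ok kN).
  by rewrite (offL w Vw nL) !wedge0r.
rewrite -(current_of_sum (index_enum 'I_N) hV (fun i : 'I_N => unity_Psi_cont i) ht).
apply: eq_bigr => i _.
rewrite (T_local (test_form_scal (@unity_smooth i) (@unity_supp i) ht)).
by apply: current_of_restrict; exact: unity_off.
Qed.

End Gluing.

(** * Countably many cubes *)

Section RationalCubes.
Variable R : realType.
Local Notation C := (Cplx R).
Local Notation index := ({ffun dir -> rat} * rat)%type.

Lemma rcoord_dist_continuous d (a : R) :
  continuous (fun p : C3 R => `|rcoord d p - a|).
Proof.
by move=> p; exact: (cvg_norm (cvgB (@rcoord_continuous R d p) (cvg_cst a))).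
Qed.

Lemma open_cube c e : open (@cube R c e).
Proof.
rewrite openE => p hp.
have h d : \forall x \near p, `|rcoord d x - c d| < e.
  exact: (@rcoord_dist_continuous d (c d) p _ (lt_nbhsl (hp d))).
exact: (@filter_forall _ _ (fun (d : dir) x => `|rcoord d x - c d| < e) (nbhs p) _ h).
Qed.

(** [cube_bump c e] vanishes off the cube of size [2 * e]; a larger cube has
    room for the closure. *)
Lemma cube_bump_supp c e : 0 < e -> supp (@cube_bump R c e) `<=` cube c (3 * e).
Proof.
move=> e0; pose K : set (C3 R) := [set p | forall d, `|rcoord d p - c d| <= 2 * e].
have cK : closed K.
  rewrite (_ : K = \bigcap_(d in setT) (fun p : C3 R => `|rcoord d p - c d|) @^-1` [set t | t <= 2 * e]).
    apply: closed_bigI => d _; apply: preimage_closed; last exact: closed_le.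
    by move=> p _; exact: rcoord_dist_continuous.
  by apply/seteqP; split=> p hp d; [move=> _; exact: hp|exact: (hp d I)].
have h : supp (cube_bump c e) `<=` K.
  rewrite ((closure_id K).1 cK); apply: closureS => p /= h d.
  exact: ltW (cube_bump_neq0 e0 h d).
by move=> p /h hp d; apply: le_lt_trans (hp d) _; rewrite ltr_pM2r// ltr_nat.
Qed.

Lemma nbhs_cube (x : C3 R) (W : set (C3 R)) : nbhs x W ->
  exists2 e : R, 0 < e & cube (fun d => rcoord d x) e `<=` W.
Proof.
move=> /nbhs_ballP[a /= a0 h].
have [a1 a2] : 0 < complex.Re a /\ a = (complex.Re a)%:C%C.
  by move: a0; case: a {h} => u v; rewrite ltcE /= => /andP[/eqP -> ->].
exists (complex.Re a / 2); first by rewrite divr_gt0.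
move=> p hp; apply: h; split=> // i j; rewrite (ord1 i).
rewrite -ball_normE /= cmodE a2 ltcR.
apply: (le_lt_trans (cmod_le_ReIm _)).
have := hp (j, false); have := hp (j, true); rewrite /rcoord /= => h1 h2.
rewrite cReB cImB distrC [X in _ + X]distrC.
by rewrite [ltRHS](splitr (complex.Re a)) ltrD.
Qed.

Lemma rational_cube (x : C3 R) (W : set (C3 R)) : nbhs x W ->
  exists i : index, [/\ 0 < i.2, cube (fun d => ratr (i.1 d) : R) (ratr i.2) x &
    cube (fun d => ratr (i.1 d)) (3 * ratr i.2) `<=` W].
Proof.
move=> /nbhs_cube[e e0 h].
have e8 : 0 < e / 4 by rewrite divr_gt0.
have /rat_in_itvoo[r] := e8; rewrite in_itv /= => /andP[r0 re].
have r0' : 0 < r by rewrite -(ltr0q R).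
have /choice[c hc] : forall d : dir, exists c : rat, `|ratr c - rcoord d x| < ratr r.
  by move=> d; exact: rat_near.
exists (finfun c, r); split=> //= [d|p hp].
  by rewrite ffunE distrC.
apply: h => d; have := hp d; have := hc d; rewrite ffunE => h1 h2.
apply: (le_lt_trans (ler_distD (ratr (c d)) _ _)).
by move: h1 h2 re; move: `|_| `|_| => u v; lra.
Qed.

End RationalCubes.

Section LocalData.
Variable R : realType.
Local Notation C := (Cplx R).
Variables (V : set (C3 R)) (q : nat) (T : form3 R -> C).
Hypotheses (hV : open_in_X V) (hT : sheafA q V T).

Definition represents (W : set (C3 R)) (Psi : form3 R) : Prop :=
  [/\ open W, continuous_form (V `&` W) q Psi &
    forall tau, test_form (V `&` W) q tau -> T tau = current_of (V `&` W) Psi tau].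

Lemma represents_near x : V x -> exists W Psi, W x /\ represents W Psi.
Proof.
move=> Vx; have [_ loc] := hT; have [W [oW Wx [n [psi [hpsi hloc]]]]] := loc x Vx.
have cpsi k : continuous_form (V `&` W) q (psi k).
  have [r VWr comp] := hpsi k.
  exact: continuous_form_sub VWr (composition_continuous comp).
exists W, (fun p => \sum_k psi k p); split=> //; split=> //.
  exact: continuous_form_sum.
move=> tau ht; rewrite (hloc tau ht); apply: current_of_sum ht => //.
have [U oU ->] := hV; exists (U `&` W); first exact: openI.
by rewrite setIA.
Qed.

(** The trivial piece, for the indices to which no cube corresponds. *)
Lemma represents0 : represents set0 (fun=> 0).
Proof.
split; first exact: open0.
  by split=> [p []|p S []].
move=> tau ht; have [_ _ tV _] := ht.
rewrite (current0 hT.1); last first.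
- move=> p Vp; apply: supp_off => tp.
  have [VX _] := open_in_X_open hV; have [Zp _] := VX p Vp.
  by have [] := tV p (conj tp Zp).
- by apply: test_form_sub ht => p [].
rewrite current_ofE -[LHS](Cintegral0 (chart_dom (V `&` set0))).
by apply: eq_Cintegral => w [_ []].
Qed.

End LocalData.

Theorem corollary1p2 (R : realType) (q : nat) (V : set (C3 R))
    (hV : open_in_X V) :
  sheafA q V `<=` sheafC0 q V.
Proof.
move=> T hT; have [cT _] := hT; split=> //.
pose index := ({ffun dir -> rat} * rat)%type.
pose Q (i : index) (e : R) : set (C3 R) := cube (fun d => ratr (i.1 d)) (e * ratr i.2).
pose good (i : index) := 0 < i.2 /\ exists W Psi, represents V q T W Psi /\ Q i 3 `<=` W.
(* The components of [data n] are a bump function, an open set containing its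
   support, a cube on which it is 1, and a representative of the current on the
   open set. *)
have /choice[data hdata] : forall n : nat, exists t : (C3 R -> Cplx R) * set (C3 R) * set (C3 R) * form3 R,
    [/\ smooth_on setT t.1.1.1, supp t.1.1.1 `<=` t.1.1.2,
      represents V q T t.1.1.2 t.2,
      open t.1.2 /\ forall p, t.1.2 p -> t.1.1.1 p = 1 &
      forall i : index, unpickle n = Some i -> good i -> t.1.2 = Q i 1].
  move=> n; have [[i [ni gi]]|ng] := pselect (exists i : index, unpickle n = Some i /\ good i).
    have [i0 [W [Psi [rW QW]]]] := gi.
    have i0' : 0 < ratr i.2 :> R by rewrite ltr0q.
    exists (cube_bump (fun d => ratr (i.1 d)) (ratr i.2), W, Q i 1, Psi); split=> //=.
    - exact: cube_bump_smooth.
    - by move=> p hp; apply: QW; exact: (cube_bump_supp i0' hp).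
    - by split=> [|p]; rewrite /Q mul1r; [exact: open_cube|exact: cube_bump1].
    - by move=> j; rewrite ni => -[->].
  exists (fun=> 0, set0, set0, fun=> 0); split=> //=.
  - exact: smooth_on_cst.
  - by rewrite supp0.
  - exact: represents0.
  - by split=> //; exact: open0.
  - by move=> i ni gi; exfalso; apply: ng; exists i.
pose beta n := (data n).1.1.1; pose W n := (data n).1.1.2.
pose O n := (data n).1.2; pose Psi n := (data n).2.
have cover p : V p -> exists n, O n p.
  move=> Vp; have [W' [Psi' [Wp rW]]] := represents_near hV hT Vp.
  have pW : nbhs p W' by apply: open_nbhs_nbhs; split=> //; case: rW.
  have [i [i0 hi1 hi2]] := rational_cube pW.
  exists (pickle i); rewrite /O; have [_ _ _ _ Oi] := hdata (pickle i).
  rewrite (Oi i (pickleK i)); first by rewrite /Q mul1r.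
  by split=> //; exists W', Psi'.
have sbeta n : smooth_on setT (beta n) by case: (hdata n).
have suppbeta n : supp (beta n) `<=` W n by case: (hdata n).
have oW n : open (W n) by case: (hdata n) => _ _ [].
have cPsi n : continuous_form (V `&` W n) q (Psi n) by case: (hdata n) => _ _ [].
have TPsi n tau : test_form (V `&` W n) q tau -> T tau = current_of (V `&` W n) (Psi n) tau.
  by case: (hdata n) => _ _ [_ _ h] _ _; exact: h.
have oO n : open (O n) by case: (hdata n) => _ _ _ [].
have beta1 n p : O n p -> beta n p = 1 by case: (hdata n) => _ _ _ [_ h] _; exact: h.
exists (glued_form beta O Psi); split=> [a Va|tau ht].
  have [b1 b2] := glue_cont sbeta suppbeta oW cPsi oO beta1 cover.
  by exists (glued_form beta O Psi); split=> // S; exact: b2.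
exact: (glue_current hV cT sbeta suppbeta oW cPsi TPsi oO beta1 cover ht).
Qed.
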